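(* For any $d>0$ and $\lambda>0$, the stochastic integral $$\mathcal{I}^{d,\lambda}(f)=\int_{\mathbb{R}}f(x)\,dS^{I\!I}_{d,\lambda}(x):=\int_{\mathbb{R}}\big(\mathbb{I}^{d,\lambda}_{-}f\big)(x)\,dL(x),\qquad f\in\mathcal{A}_1,$$ is an isometry between $\mathcal{A}_1$ and a strict subset of $$\overline{\mathrm{Sp}}(S^{I\!I}_{d,\lambda})=\Big\{X\in L^2(\Omega):\ \|\mathcal{I}^{d,\lambda}(f_n)-X\|_{L^2(\Omega)}\to 0\text{ for some sequence }(f_n)_{n\in\mathbb{N}}\subseteq\mathcal{E}\Big\}.$$
   Context: Driving Lévy process. $L=\{L(t)\}_{t\in\mathbb{R}}$ is the two-sided Lévy process $L(t)=L_1(t)\mathbf 1_{[0,\infty)}(t)-L_2((-t)-)\mathbf 1_{(-\infty,0)}(t)$, where $L_1,L_2$ are independent copies of a Lévy process on $[0,\infty)$. It is centered ($\mathbb{E}[L(1)]=0$), has no Brownian component, and $\mathbb{E}[e^{i\theta L(t)}]=e^{t\psi(\theta)}$ for $t\ge 0$, with $\psi(\theta)=\int_{\mathbb{R}}(e^{i\theta x}-1-i\theta x)\,\nu(dx)$, where the Lévy measure $\nu$ satisfies $\nu(\{0\})=0$, $\int_{\mathbb{R}}(|x|^2\wedge 1)\,\nu(dx)<\infty$ and $\int_{|x|>1}x^2\,\nu(dx)<\infty$; hence $\mathbb{E}[L(1)^2]<\infty$. For deterministic $f\in L^2(\mathbb{R})$, $\int_{\mathbb{R}} f\,dL$ is the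 usual Wiener-type integral in $L^2(\Omega)$, with $\mathbb{E}[\int f\,dL\int g\,dL]=\mathbb{E}[L(1)^2]\int fg$. TFLP II. With $(x)_+=x\mathbf 1_{\{x>0\}}$ and oriented integrals, the tempered fractional Lévy process of the second kind is $$S^{I\!I}_{d,\lambda}(t)=\frac{1}{\Gamma(d+1)}\int_{\mathbb{R}}\Big[(t-y)_+^{d}e^{-\lambda(t-y)_+}-(-y)_+^{d}e^{-\lambda(-y)_+}+\lambda\int_0^t(s-y)_+^{d}e^{-\lambda(s-y)_+}ds\Big]dL(y),\ t\in\mathbb{R}.$$ Integrands. $\mathcal{E}$ is the space of step functions $f=\sum_{i=1}^n a_i\mathbf 1_{[t_i,t_{i+1})}$ with $a_i,t_i$ real and $t_i\le t_{i+1}$; for such $f$, $\mathcal{I}^{d,\lambda}(f)=\sum_{i=1}^n a_i[S^{I\!I}_{d,\lambda}(t_{i+1})-S^{I\!I}_{d,\lambda}(t_i)]$ (which agrees with the formula in the claim). The negative tempered fractional integral is $\mathbb{I}^{\kappa,\lambda}_{-}f(y)=\frac{1}{\Gamma(\kappa)}\int_{y}^{\infty}f(s)(s-y)^{\kappa-1}e^{-\lambda(s-y)}ds$, $\kappa>0$, and $$\mathcal{A}_1=\Big\{f\in L^2(\mathbb{R}):\int_{\mathbb{R}}|(\mathbb{I}^{d,\lambda}_{-}f)(x)|^2dx<\infty\Big\},\qquad\langle f,g\rangle_{\mathcal{A}_1}=\langle\mathbb{I}^{d,\lambda}_{-}f,\mathbb{I}^{d,\lambda}_{-}g\rangle_{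L^2(\mathbb{R})}.$$
   Formalization: The isometry is stated up to the constant E[L(1)²], i.e. E[I(f)I(g)] = E[L(1)²]⟨f,g⟩, literal only when E[L(1)²]=1 (otherwise the plain isometry fails), and the Lévy measure ν is assumed nonzero, since for ν=0 the claim is false. *)

(* Defs.v *)
From HB Require Import structures.
From mathcomp Require Import all_boot all_order all_algebra.
From mathcomp Require Import all_classical all_reals all_analysis.
From mathcomp Require Import complex.

Set Implicit Arguments.
Unset Strict Implicit.
Unset Printing Implicit Defensive.
Import Order.TTheory GRing.Theory Num.Theory.
Import numFieldNormedType.Exports.
Local Open Scope classical_set_scope.
Local Open Scope ring_scope.

Section ComplexExponential.
Variable R : realType.

Definition cexp (z : R[i]) : R[i] :=
  let: (a +i* b)%C := z in ((expR a * cos b) +i* (expR a * sin b))%C.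

Definition cintegral (d : measure_display) (T : measurableType d)
    (mu : {measure set T -> \bar R}) (f : T -> R[i]) : R[i] :=
  ((\int[mu]_x complex.Re (f x)) +i* (\int[mu]_x complex.Im (f x)))%C.

End ComplexExponential.

Section LevyProcess.
Context (R : realType) (disp : measure_display) (Omega : measurableType disp).
Variable P : probability Omega R.

Definition mutually_independent (n : nat) (X : 'I_n -> Omega -> R) : Prop :=
  forall B : 'I_n -> set R, (forall i, measurable (B i)) ->
    P (\bigcap_(i in [set: 'I_n]) X i @^-1` B i) =
    (\prod_(i < n) P (X i @^-1` B i))%E.

(* Time is indexed by R, but only the values at t >= 0 are used. *)
Definition process_sigma_algebra (X : R -> Omega -> R) : set (set Omega) :=
  <<s [set A | exists t B, [/\ 0 <= t, measurable B & A = X t @^-1` B]] >>.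

Definition independent_processes (X Y : R -> Omega -> R) : Prop :=
  forall A B, process_sigma_algebra X A -> process_sigma_algebra Y B ->
    P (A `&` B) = (P A * P B)%E.

Definition cadlag (x : R -> R) : Prop :=
  (forall t, 0 <= t -> x u @[u --> t^'+] --> x t) /\
  (forall t, 0 < t -> cvg (x u @[u --> t^'-])).

Record levy_process (X : R -> {RV P >-> R}) : Prop := LevyProcess {
  levy_start : {ae P, forall w, X 0 w = 0} ;
  levy_indep : forall (n : nat) (t : nat -> R), 0 <= t 0%N ->
    (forall i, (i < n)%N -> t i <= t i.+1) ->
    mutually_independent (fun (i : 'I_n) w => X (t i.+1) w - X (t i) w) ;
  levy_stationary : forall s t (B : set R), 0 <= s -> s <= t -> measurable B ->
    P ((fun w => X t w - X s w) @^-1` B) = P (X (t - s) @^-1` B) ;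
  levy_stoch_continuous : forall t e : R, 0 <= t -> 0 < e ->
    P [set w | e < `|X s w - X t w|]
      @[s --> within [set s | 0 <= s] (nbhs t)] --> 0%E ;
  levy_cadlag : {ae P, forall w, cadlag (fun t => X t w)} }.

Definition charfun (X : Omega -> R) (theta : R) : R[i] :=
  cintegral P (fun w => cexp (0 +i* (theta * X w))%C).

Record levy_measure (nu : {measure set R -> \bar R}) : Prop := LevyMeasure {
  levy_measure0 : nu [set 0] = 0%E ;
  levy_measure_min : (\int[nu]_x (Num.min (`|x| ^+ 2) 1)%:E < +oo)%E }.

Definition levy_psi (nu : {measure set R -> \bar R}) (theta : R) : R[i] :=
  cintegral nu
    (fun x => cexp (0 +i* (theta * x))%C - 1 - (0 +i* (theta * x))%C).

Record centered_pure_jump_levy (nu : {measure set R -> \bar R})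
    (X : R -> {RV P >-> R}) : Prop := CenteredPureJumpLevy {
  cpj_levy : levy_process X ;
  cpj_centered : ('E_P[X 1%R] = 0)%E ;
  cpj_charfun : forall t theta : R, 0 <= t ->
    charfun (X t) theta = cexp (t%:C%C * levy_psi nu theta) }.

Definition two_sided (X1 X2 : R -> Omega -> R) (t : R) (w : Omega) : R :=
  if 0 <= t then X1 t w else - lim (X2 u w @[u --> (- t)^'-]).

End LevyProcess.

Section StepFunctions.
Variable R : realType.

Record step_fun := StepFun {
  step_size : nat ;
  step_coef : nat -> R ;
  step_knot : nat -> R ;
  step_knot_le : forall i, (i < step_size)%N -> step_knot i <= step_knot i.+1 }.

Definition step_eval (f : step_fun) (x : R) : R :=
  \sum_(i < step_size f)
    step_coef f i * \1_(`[step_knot f i, step_knot f i.+1[%classic) x.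

Definition step_integral (Omega : Type) (X : R -> Omega -> R) (f : step_fun)
    (w : Omega) : R :=
  \sum_(i < step_size f)
    step_coef f i * (X (step_knot f i.+1) w - X (step_knot f i) w).

End StepFunctions.

Section WienerIntegral.
Context (R : realType) (disp : measure_display) (Omega : measurableType disp).
Variables (P : probability Omega R) (L : R -> Omega -> R).

Local Notation mu := (@lebesgue_measure R).

Definition is_wiener_integral (f : R -> R) (X : Omega -> R) : Prop :=
  [/\ f \in Lfun mu 2%:E, X \in Lfun P 2%:E &
   exists f_ : nat -> step_fun R,
     'N[mu]_2%:E[EFin \o (step_eval (f_ n) \- f)%R]%E @[n --> \oo] --> 0%E /\
     'N[P]_2%:E[EFin \o (step_integral L (f_ n) \- X)%R]%E
       @[n --> \oo] --> 0%E].

(* A chosen version of the L^2(Omega)-limit, which is unique only up to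
   P-almost sure equality; it is 0 when f is not in L^2(R). *)
Definition wiener_integral (f : R -> R) : Omega -> R :=
  xget (fun=> 0) [set X | is_wiener_integral f X].

End WienerIntegral.

Section TemperedFractional.
Variable R : realType.

Local Notation mu := (@lebesgue_measure R).

Definition Gamma (a : R) : R :=
  \int[mu]_(s in `]0, +oo[) (s `^ (a - 1) * expR (- s)).

Definition pos_part (x : R) : R := if 0 < x then x else 0.

Definition oriented_integral (a b : R) (f : R -> R) : R :=
  if a <= b then \int[mu]_(s in `[a, b]) f s
  else - \int[mu]_(s in `[b, a]) f s.

Definition tempered_power (d lambda x : R) : R :=
  pos_part x `^ d * expR (- lambda * pos_part x).

Definition tflp2_kernel (d lambda t y : R) : R :=
  tempered_power d lambda (t - y) - tempered_power d lambda (- y) +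
  lambda * oriented_integral 0 t (fun s => tempered_power d lambda (s - y)).

(* The integral converges absolutely for almost every y when f is in L^2(R);
   at the remaining points the value is immaterial. *)
Definition tfi_neg (kappa lambda : R) (f : R -> R) (y : R) : R :=
  (Gamma kappa)^-1 *
  \int[mu]_(s in `]y, +oo[)
    (f s * (s - y) `^ (kappa - 1) * expR (- lambda * (s - y))).

Definition A1 (d lambda : R) : set (R -> R) :=
  [set f | f \in Lfun mu 2%:E /\
    (\int[mu]_x (`|tfi_neg d lambda f x| ^+ 2)%:E < +oo)%E].

Definition A1_dot (d lambda : R) (f g : R -> R) : R :=
  \int[mu]_x (tfi_neg d lambda f x * tfi_neg d lambda g x).

Context (disp : measure_display) (Omega : measurableType disp).
Variables (P : probability Omega R) (L : R -> Omega -> R).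

Definition tflp2 (d lambda t : R) (w : Omega) : R :=
  (Gamma (d + 1))^-1 * wiener_integral P L (tflp2_kernel d lambda t) w.

Definition tflp2_integral (d lambda : R) (f : R -> R) : Omega -> R :=
  wiener_integral P L (tfi_neg d lambda f).

Definition closed_span (S : R -> Omega -> R) : set (Omega -> R) :=
  [set X | X \in Lfun P 2%:E /\
    exists f_ : nat -> step_fun R,
      'N[P]_2%:E[EFin \o (step_integral S (f_ n) \- X)%R]%E
        @[n --> \oo] --> 0%E].

End TemperedFractional.

(* Main.v *)
Require Import Defs.
From HB Require Import structures.
From mathcomp Require Import all_boot all_order all_algebra.
From mathcomp Require Import all_classical all_reals all_analysis.
From mathcomp Require Import measurable_realfun.
From mathcomp Require Import complex ring lra.

(* Write k_a(u) = u^(a-1) e^(-lambda u) for u > 0 and k_a(u) = 0 otherwise, and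
   T_a h(y) = \int h(s) k_a(s - y) ds, so that the tempered fractional integral
   of order a is T_a / Gamma(a).
   The second-order behaviour of the characteristic functions at 0, stationarity
   and independence of increments give E[(L(t) - L(s))^2] = M |t - s|, where M is
   the second moment of nu; hence the Wiener integral multiplies squared norms
   by M.
   Integrating by parts in k_(d+1), the kernel of the process is d T_d applied to
   the indicator of [0, t). As T_d is bounded on L^2 and step functions are
   dense, I(f) lies in the closed span, and I is an isometry up to M.
   T_d is injective: since T_a T_b is a multiple of T_(a+b), T_d may be replaced
   by an operator of integer order, hence by T_1, and T_1 h is, up to a
   factor e^(lambda y), a primitive of - e^(-lambda y) h(y).
   The inclusion is strict: h(y) = k_(1/2)(-y) is not in L^2, yet T_d h is an
   L^2-limit of T_d of truncations of h, so its Wiener integral belongs to the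
   closed span; by injectivity it is not I(f) for any f in L^2. *)

Set Implicit Arguments.
Unset Strict Implicit.
Unset Printing Implicit Defensive.
Import Order.TTheory GRing.Theory Num.Theory.
Import numFieldNormedType.Exports.
Local Open Scope classical_set_scope.
Local Open Scope ring_scope.

(** * Square-integrable functions *)

(** The witness [halfk] lies outside L^2, so injectivity of T_d on L^2 alone would not exclude T_d
    halfk = T_d f. Injectivity is therefore proved on [tconv_dom], the functions whose transforms of
    every positive order converge absolutely almost everywhere. This class contains L^1 and L^2 and
    is stable under linear combinations and under each T_b, so the order can be raised to an integer
    and then lowered one unit at a time. Norms are kept squared ([L2dist]): an isometry up to M is
    then multiplication by M, and inner products follow by polarisation. From E[(L(t) - L(s))^2] = M
    |t - s| on, only this identity, M > 0 and L(t) in L^2 enter the construction of the integral.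
    Square-integrability of L(t) has to be derived: x^2 is the limit from below of the bounded
    functions 2 (1 - cos(theta x)) / theta^2, whose expectations are read off the characteristic
    function. At negative times the process is a left limit, so L(t) = - L2(-t) almost surely is a
    separate step. *)

Section SquareIntegrable.
Context d (T : measurableType d) (R : realType).
Variable mu : {measure set T -> \bar R}.
Implicit Types f g h : T -> R.

Definition L2dot f g : R := \int[mu]_x (f x * g x).

(** The square of the L^2 distance: without roots, expansions are ring identities and isometries are
    linear; the price is a factor 2 in the triangle inequality. *)
Definition L2dist f g : R := L2dot (fun x => f x - g x) (fun x => f x - g x).

Lemma Lfun2P f : f \in Lfun mu 2%:E <->
  measurable_fun setT f /\ (\int[mu]_x (f x ^+ 2)%:E < +oo)%E.
Proof.
split=> [fL|[mf fint]].
  split; first by move: fL; rewrite inE => /andP[]; rewrite inE.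
  have /integrableP[_] := Lfun2_integrable_sqr fL.
  by under eq_integral do rewrite /= ger0_norm ?sqr_ge0//.
rewrite inE; apply/andP; split; rewrite inE//= /finite_norm unlock.
rewrite poweR_lty//.
by under eq_integral do rewrite /= powR_mulrn// -normrX ger0_norm ?sqr_ge0//.
Qed.

Lemma Lfun2_measurable f : f \in Lfun mu 2%:E -> measurable_fun setT f.
Proof. by move=> /Lfun2P[]. Qed.

Lemma Lfun2_mul f g : f \in Lfun mu 2%:E -> g \in Lfun mu 2%:E ->
  mu.-integrable setT (fun x => (f x * g x)%:E).
Proof. by move=> fL gL; have /Lfun1_integrable := Lfun2_mul_Lfun1 fL gL. Qed.

Lemma ge0_integrable_EFin f : measurable_fun setT f -> (forall x, 0 <= f x) ->
  (\int[mu]_x (f x)%:E < +oo)%E -> mu.-integrable setT (EFin \o f).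
Proof.
move=> mf f0 fi; apply/integrableP; split; first exact/measurable_EFinP.
by under eq_integral do rewrite /= ger0_norm//.
Qed.

Lemma Lfun2_le f g : measurable_fun setT f -> g \in Lfun mu 2%:E ->
  (forall x, `|f x| <= `|g x|) -> f \in Lfun mu 2%:E.
Proof.
move=> mf /Lfun2P[mg gi] fg; apply/Lfun2P; split => //.
apply: le_lt_trans gi; apply: ge0_le_integral => //=.
- by move=> x _; rewrite lee_fin sqr_ge0.
- by apply/measurable_EFinP; exact: measurable_funX.
- by apply/measurable_EFinP; exact: measurable_funX.
- by move=> x _; rewrite lee_fin -[f x ^+ 2]real_normK ?num_real// -[g x ^+ 2]real_normK ?num_real// lerXn2r ?nnegrE.
Qed.

Lemma Lfun2_comb (a : R) f g : f \in Lfun mu 2%:E -> g \in Lfun mu 2%:E ->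
  (fun x => a * f x + g x) \in Lfun mu 2%:E.
Proof.
move=> fL gL; apply/Lfun2P.
have mf := Lfun2_measurable fL; have mg := Lfun2_measurable gL.
have mfg : measurable_fun setT (fun x => a * f x + g x).
  by apply: measurable_funD => //; exact: measurable_funM.
split => //.
(* Dominating function from (a f + g)^2 <= 2 a^2 f^2 + 2 g^2, which is (a f - g)^2 >= 0. *)
have bnd : mu.-integrable setT
    (fun x => ((2 * a ^+ 2) * (f x * f x) + 2 * (g x * g x))%:E).
  under eq_fun do rewrite EFinD !EFinM.
  apply: integrableD => //; apply: integrableZl => //; exact: Lfun2_mul.
apply: (@le_lt_trans _ _ (\int[mu]_x ((2 * a ^+ 2) * (f x * f x) + 2 * (g x * g x))%:E)%E).
  apply: ge0_le_integral => //=.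
  - by move=> x _; rewrite lee_fin sqr_ge0.
  - by apply/measurable_EFinP; exact: measurable_funX.
  - by apply: measurable_int bnd.
  - by move=> x _; rewrite lee_fin; have := sqr_ge0 (a * f x - g x); nra.
have := integrable_fin_num measurableT bnd; rewrite ge0_fin_numE//.
by apply: integral_ge0 => x _; rewrite lee_fin; nra.
Qed.

Lemma Lfun2_add f g : f \in Lfun mu 2%:E -> g \in Lfun mu 2%:E ->
  (fun x => f x + g x) \in Lfun mu 2%:E.
Proof.
move=> fL gL; have := Lfun2_comb 1 fL gL.
by under eq_fun do rewrite mul1r.
Qed.

Lemma Lfun2_cst0 : (fun=> 0) \in Lfun mu 2%:E.
Proof.
apply/Lfun2P; split => //.
by under eq_integral do rewrite expr0n/=; rewrite integral0.
Qed.

Lemma Lfun2_mulr (a : R) f : f \in Lfun mu 2%:E -> (fun x => a * f x) \in Lfun mu 2%:E.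
Proof.
move=> fL; have := Lfun2_comb a fL Lfun2_cst0.
by under eq_fun do rewrite addr0.
Qed.

Lemma Lfun2_sub f g : f \in Lfun mu 2%:E -> g \in Lfun mu 2%:E ->
  (fun x => f x - g x) \in Lfun mu 2%:E.
Proof.
move=> fL gL; have := Lfun2_comb (-1) gL fL.
by under eq_fun do rewrite mulN1r addrC.
Qed.

Lemma Lfun2_sum n (F : 'I_n -> T -> R) : (forall i, F i \in Lfun mu 2%:E) ->
  (fun x => \sum_(i < n) F i x) \in Lfun mu 2%:E.
Proof.
elim: n F => [|n IH] F FL.
  under eq_fun do rewrite big_ord0; exact: Lfun2_cst0.
under eq_fun do rewrite big_ord_recl.
apply: Lfun2_add; [exact: FL|exact: (IH (fun i => F (lift ord0 i)))].
Qed.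

Lemma Lfun2_ae f g : measurable_fun setT f -> g \in Lfun mu 2%:E ->
  {ae mu, forall x, f x = g x} -> f \in Lfun mu 2%:E.
Proof.
move=> mf /Lfun2P[mg gi] fg; apply/Lfun2P; split => //.
rewrite (ae_eq_integral (fun x => (g x ^+ 2)%:E))//.
- by apply/measurable_EFinP; exact: measurable_funX.
- by apply/measurable_EFinP; exact: measurable_funX.
- by apply: filterS fg => x fx _; rewrite fx.
Qed.

Lemma L2dotC f g : L2dot f g = L2dot g f.
Proof. by apply: eq_Rintegral => x _; rewrite mulrC. Qed.

Lemma L2dot_combl (a : R) f g h : f \in Lfun mu 2%:E -> g \in Lfun mu 2%:E ->
  h \in Lfun mu 2%:E ->
  L2dot (fun x => a * f x + g x) h = a * L2dot f h + L2dot g h.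
Proof.
move=> fL gL hL; rewrite /L2dot -RintegralZl//; last exact: Lfun2_mul.
rewrite -RintegralD//; last 2 first.
  exact: (integrableZl measurableT a (Lfun2_mul fL hL)).
  exact: Lfun2_mul.
by apply: eq_Rintegral => x _; ring.
Qed.

Lemma L2dot_combr (a : R) f g h : f \in Lfun mu 2%:E -> g \in Lfun mu 2%:E ->
  h \in Lfun mu 2%:E ->
  L2dot h (fun x => a * f x + g x) = a * L2dot h f + L2dot h g.
Proof. by move=> fL gL hL; rewrite L2dotC L2dot_combl// ![L2dot h _]L2dotC. Qed.

Lemma L2dot_cst0l f : L2dot (fun=> 0) f = 0.
Proof.
rewrite /L2dot; under eq_Rintegral do rewrite mul0r.
by rewrite /Rintegral integral0.
Qed.

Lemma L2dot_mulr (a : R) f g : f \in Lfun mu 2%:E -> g \in Lfun mu 2%:E ->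
  L2dot (fun x => a * f x) g = a * L2dot f g.
Proof.
move=> fL gL; have := L2dot_combl a fL Lfun2_cst0 gL.
by under eq_fun do rewrite addr0; rewrite L2dot_cst0l addr0.
Qed.

Lemma L2dot_suml n (F : 'I_n -> T -> R) g : (forall i, F i \in Lfun mu 2%:E) ->
  g \in Lfun mu 2%:E ->
  L2dot (fun x => \sum_(i < n) F i x) g = \sum_(i < n) L2dot (F i) g.
Proof.
move=> + gL; elim: n F => [|n IH] F FL.
  by under eq_fun do rewrite big_ord0; rewrite L2dot_cst0l big_ord0.
under eq_fun do rewrite big_ord_recl -[X in X + _]mul1r.
rewrite L2dot_combl// ?mul1r ?big_ord_recl.
- by rewrite (IH (fun i => F (lift ord0 i))).
- exact: (Lfun2_sum (F := fun i => F (lift ord0 i))).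
Qed.

Lemma L2dot_ge0 f : 0 <= L2dot f f.
Proof. by apply: Rintegral_ge0 => x _; rewrite -expr2 sqr_ge0. Qed.

Lemma L2dotE f : f \in Lfun mu 2%:E ->
  (L2dot f f)%:E = (\int[mu]_x (f x ^+ 2)%:E)%E.
Proof.
move=> fL; rewrite /L2dot /Rintegral fineK//.
exact: integrable_fin_num (Lfun2_mul fL fL).
Qed.

Lemma L2dist_ge0 f g : 0 <= L2dist f g.
Proof. exact: L2dot_ge0. Qed.

Lemma L2distC f g : L2dist f g = L2dist g f.
Proof. by apply: eq_Rintegral => x _; ring. Qed.

Lemma L2dot_eq0 f : f \in Lfun mu 2%:E -> L2dot f f = 0 ->
  {ae mu, forall x, f x = 0}.
Proof.
move=> fL f0; have := L2dotE fL; rewrite f0 => /esym int0.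
have mf := Lfun2_measurable fL.
have /ae_eq_integral_abs : measurable_fun setT (fun x => (f x ^+ 2)%:E).
  by apply/measurable_EFinP; exact: measurable_funX.
move=> /(_ mu measurableT)[+ _]; move=> /(_ _).
under eq_integral do rewrite gee0_abs ?lee_fin ?sqr_ge0//.
move=> /(_ int0); apply: filterS => x /(_ I)/= [] /eqP.
by rewrite sqrf_eq0 => /eqP.
Qed.

Lemma L2dist_eq0 f g : f \in Lfun mu 2%:E -> g \in Lfun mu 2%:E ->
  L2dist f g = 0 -> {ae mu, forall x, f x = g x}.
Proof.
move=> fL gL /(L2dot_eq0 (Lfun2_sub fL gL)).
by apply: filterS => x /eqP; rewrite subr_eq0 => /eqP.
Qed.

Lemma L2dot_ae f f' g g' :
  f \in Lfun mu 2%:E -> f' \in Lfun mu 2%:E ->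
  g \in Lfun mu 2%:E -> g' \in Lfun mu 2%:E ->
  {ae mu, forall x, f x = f' x} -> {ae mu, forall x, g x = g' x} ->
  L2dot f g = L2dot f' g'.
Proof.
move=> fL fL' gL gL' ff' gg'; congr fine; apply: ae_eq_integral => //.
- exact: measurable_int (Lfun2_mul fL gL).
- exact: measurable_int (Lfun2_mul fL' gL').
- by apply: filterS2 ff' gg' => x -> ->.
Qed.

Lemma L2dist_ae f f' g g' :
  f \in Lfun mu 2%:E -> f' \in Lfun mu 2%:E ->
  g \in Lfun mu 2%:E -> g' \in Lfun mu 2%:E ->
  {ae mu, forall x, f x = f' x} -> {ae mu, forall x, g x = g' x} ->
  L2dist f g = L2dist f' g'.
Proof.
move=> fL fL' gL gL' ff' gg'; apply: L2dot_ae; try exact: Lfun2_sub.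
- by apply: filterS2 ff' gg' => x -> ->.
- by apply: filterS2 ff' gg' => x -> ->.
Qed.

Lemma L2distE f g : f \in Lfun mu 2%:E -> g \in Lfun mu 2%:E ->
  L2dist f g = L2dot f f - 2 * L2dot f g + L2dot g g.
Proof.
move=> fL gL.
rewrite /L2dist (_ : (fun x => f x - g x) = (fun x => -1 * g x + f x)); last first.
  by apply/funext => x; ring.
rewrite L2dot_combl//; last exact: Lfun2_comb.
by rewrite !L2dot_combr// [L2dot g f]L2dotC; ring.
Qed.

(** With u = f - g and v = g - h, nonnegativity of the squared norm of u - v gives 2 <u, v> <= |u|^2
    + |v|^2. *)
Lemma L2dist_triangle f g h : f \in Lfun mu 2%:E -> g \in Lfun mu 2%:E ->
  h \in Lfun mu 2%:E -> L2dist f h <= 2 * L2dist f g + 2 * L2dist g h.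
Proof.
move=> fL gL hL.
rewrite -subr_ge0; have fg := Lfun2_sub fL gL; have gh := Lfun2_sub gL hL.
have := L2dist_ge0 (fun x => f x - g x) (fun x => g x - h x).
rewrite L2distE//.
suff -> : L2dist f h = L2dist f g + 2 * L2dot (fun x => f x - g x) (fun x => g x - h x)
   + L2dist g h by rewrite /L2dist; lra.
rewrite {1}/L2dist (_ : (fun x => f x - h x) =
  (fun x => 1 * (f x - g x) + (g x - h x))); last by apply/funext => x; ring.
rewrite L2dot_combl//; last exact: Lfun2_comb.
by rewrite !L2dot_combr// [L2dot (fun x => g x - h x) (fun x => f x - g x)]L2dotC /L2dist; ring.
Qed.

Lemma L2dot_CauchySchwarz f g : f \in Lfun mu 2%:E -> g \in Lfun mu 2%:E ->
  L2dot f g ^+ 2 <= L2dot f f * L2dot g g.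
Proof.
move=> fL gL.
have key t : 0 <= t ^+ 2 * L2dot f f + 2 * t * L2dot f g + L2dot g g.
  have := L2dot_ge0 (fun x => t * f x + g x).
  rewrite L2dot_combl//; last exact: Lfun2_comb.
  by rewrite !L2dot_combr// [L2dot g f]L2dotC; congr (0 <= _); ring.
have := L2dot_ge0 f; rewrite le_eqVlt => /predU1P[f0|f0].
  rewrite -f0 mul0r; have [->|gt0] := eqVneq (L2dot f g) 0; first by rewrite expr0n.
  (* Here <f, f> = 0, so the quadratic in t is affine; this t gives it the value -1 unless its slope
     <f, g> vanishes. *)
  have := key (- (L2dot g g + 1) / (2 * L2dot f g)).
  rewrite -f0 mulr0 add0r.
  have -> : 2 * (- (L2dot g g + 1) / (2 * L2dot f g)) * L2dot f g = - (L2dot g g + 1).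
    by field.
  lra.
have := key (- (L2dot f g / L2dot f f)).
have -> : (- (L2dot f g / L2dot f f)) ^+ 2 * L2dot f f +
   2 * - (L2dot f g / L2dot f f) * L2dot f g + L2dot g g =
   (L2dot f f * L2dot g g - L2dot f g ^+ 2) / L2dot f f.
  by field; rewrite gt_eqF.
by rewrite pmulr_lge0 ?invr_gt0// subr_ge0.
Qed.

Lemma Lnorm2_L2dot f : f \in Lfun mu 2%:E ->
  'N[mu]_2%:E[EFin \o f]%E = (Num.sqrt (L2dot f f))%:E.
Proof.
move=> fL; rewrite unlock.
under eq_integral do rewrite /= powR_mulrn// -normrX ger0_norm ?sqr_ge0//.
by rewrite -L2dotE// poweR_EFin powR12_sqrt// L2dot_ge0.
Qed.

(** Bridge between the extended-real norm used in the definitions of the integral and of the closed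
    span, and the real-valued squared distance used in all proofs. *)
Lemma cvg_Lnorm2P (f_ : nat -> T -> R) f : (forall n, f_ n \in Lfun mu 2%:E) ->
  f \in Lfun mu 2%:E ->
  'N[mu]_2%:E[EFin \o (f_ n \- f)%R]%E @[n --> \oo] --> 0%E <->
  L2dist (f_ n) f @[n --> \oo] --> 0.
Proof.
move=> fnL fL.
under eq_fun do rewrite Lnorm2_L2dot ?Lfun2_sub//.
have -> : (0%E : \bar R) = (0:R)%:E by [].
rewrite -[X in X <-> _]/((EFin \o (fun n => Num.sqrt (L2dist (f_ n) f))) @ \oo --> (0:R)%:E).
split => [/fine_cvg|].
  rewrite -[fine \o _]/(fun n => Num.sqrt (L2dist (f_ n) f)) => h.
  have : Num.sqrt (L2dist (f_ n) f) * Num.sqrt (L2dist (f_ n) f) @[n --> \oo] --> 0.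
    by rewrite -[X in _ --> X](mulr0 0); exact: cvgM.
  by under eq_fun do rewrite -expr2 sqr_sqrtr ?L2dist_ge0//.
move=> h; apply: cvg_EFin; first by near=> n.
rewrite -[fine \o _]/(fun n => Num.sqrt (L2dist (f_ n) f)).
have := @sqrt_continuous R 0; rewrite /continuous_at sqrtr0 => c.
exact: (cvg_comp _ _ h c).
Unshelve. all: by end_near. Qed.

(** Expand both arguments around their limits; by Cauchy-Schwarz each of the three remainders is
    dominated by a product with one factor tending to 0. *)
Lemma L2dot_cvg (f_ g_ : nat -> T -> R) f g :
  (forall n, f_ n \in Lfun mu 2%:E) -> (forall n, g_ n \in Lfun mu 2%:E) ->
  f \in Lfun mu 2%:E -> g \in Lfun mu 2%:E ->
  L2dist (f_ n) f @[n --> \oo] --> 0 -> L2dist (g_ n) g @[n --> \oo] --> 0 ->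
  L2dot (f_ n) (g_ n) @[n --> \oo] --> L2dot f g.
Proof.
move=> fnL gnL fL gL cf cg.
have CS0 (u_ v_ : nat -> T -> R) (c : R) : (forall n, u_ n \in Lfun mu 2%:E) ->
   (forall n, v_ n \in Lfun mu 2%:E) ->
   L2dot (u_ n) (u_ n) @[n --> \oo] --> 0 ->
   L2dot (v_ n) (v_ n) @[n --> \oo] --> c ->
   L2dot (u_ n) (v_ n) @[n --> \oo] --> 0.
  move=> uL vL u0 vc.
  have prod0 : L2dot (u_ n) (u_ n) * L2dot (v_ n) (v_ n) @[n --> \oo] --> 0.
    by rewrite -(mul0r c); exact: cvgM.
  have sq0 : Num.sqrt (L2dot (u_ n) (u_ n) * L2dot (v_ n) (v_ n)) @[n --> \oo] --> 0.
    have := @sqrt_continuous R 0; rewrite /continuous_at sqrtr0 => k.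
    exact: (cvg_comp _ _ prod0 k).
  apply/norm_cvg0P; apply: squeeze_cvgr (cvg_cst 0) sq0; near=> n.
  rewrite normr_ge0/= -sqrtr_sqr ler_wsqrtr// .
  exact: L2dot_CauchySchwarz.
have e1 n : L2dot (f_ n) (g_ n) = L2dot f g +
  (L2dot (fun x => f_ n x - f x) (fun x => g_ n x - g x) +
   (L2dot (fun x => f_ n x - f x) g + L2dot (fun x => g_ n x - g x) f)).
  have fE : f_ n = (fun x => 1 * (f_ n x - f x) + f x) by apply/funext => x; ring.
  have gE : g_ n = (fun x => 1 * (g_ n x - g x) + g x) by apply/funext => x; ring.
  have fs := Lfun2_sub (fnL n) fL; have gs := Lfun2_sub (gnL n) gL.
  rewrite {1}fE {1}gE L2dot_combl//; last exact: Lfun2_comb.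
  by rewrite !L2dot_combr// [L2dot f (fun x => g_ n x - g x)]L2dotC; ring.
under eq_fun do rewrite e1.
have H1 : L2dot (fun x => f_ n x - f x) (fun x => g_ n x - g x) @[n --> \oo] --> 0.
  apply: (CS0 (fun n x => f_ n x - f x) (fun n x => g_ n x - g x) 0) => // n; exact: Lfun2_sub.
have H2 : L2dot (fun x => f_ n x - f x) g @[n --> \oo] --> 0.
  apply: (CS0 (fun n x => f_ n x - f x) (fun=> g) (L2dot g g)) => //.
    by move=> n; exact: Lfun2_sub.
  exact: cvg_cst.
have H3 : L2dot (fun x => g_ n x - g x) f @[n --> \oo] --> 0.
  apply: (CS0 (fun n x => g_ n x - g x) (fun=> f) (L2dot f f)) => //.
    by move=> n; exact: Lfun2_sub.
  exact: cvg_cst.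
by have := cvgD (cvg_cst (L2dot f g)) (cvgD H1 (cvgD H2 H3)); rewrite !addr0; exact.
Unshelve. all: by end_near. Qed.

End SquareIntegrable.

(** * Changes of variable on the line, and a fundamental theorem of calculus with a singular
    endpoint *)

Section AffineChange.
Context {R : realType}.
Local Notation mu := (@lebesgue_measure R).

(** Lebesgue measure is c times its pushforward under x |-> c x + b: the two agree on half-open
    intervals, hence everywhere by uniqueness. *)
Lemma ge0_integral_affine (c b : R) (f : R -> \bar R) : 0 < c ->
  measurable_fun setT f -> (forall x, 0 <= f x)%E ->
  (\int[mu]_x f x = c%:E * \int[mu]_x f (c * x + b)%R)%E.
Proof.
move=> c0 mf f0.
pose phi (x : measurableTypeR R) : measurableTypeR R := c * x + b.
have mphi : measurable_fun setT phi by apply: measurable_funD => //; exact: measurable_funM.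
have cnn : 0 <= c by exact: ltW.
unshelve epose (pf := (pushforward mu phi : {measure set (measurableTypeR R) -> \bar R})).
  exact: mphi.
pose k : {nonneg R} := NngNum cnn.
have mphiE (A : set R) : measurable A -> mu A = mscale k pf A.
  move=> mA.
  apply: (lebesgue_measure_unique (mu := mscale k pf)) => //= _ [[p q]] _ <-.
  rewrite /mscale /pf /pushforward/=.
  have preE : phi @^-1` `]p, q] = `](p - b) / c, (q - b) / c]%classic.
    apply/seteqP; split => x /=; rewrite !in_itv/= /phi => /andP[h1 h2]; apply/andP; split.
    - by rewrite ltr_pdivrMr// mulrC; lra.
    - by rewrite ler_pdivlMr// mulrC; lra.
    - by move: h1; rewrite ltr_pdivrMr// mulrC; lra.
    - by move: h2; rewrite ler_pdivlMr// mulrC; lra.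
  rewrite [X in (_ * mu X)%E]preE !lebesgue_measure_itv/= !lte_fin ltr_pM2r ?invr_gt0// ltrD2r.
  case: ifPn => pq; last by rewrite mule0.
  by rewrite -!EFinB -EFinM; congr EFin; field; rewrite gt_eqF.
transitivity (\int[mscale k pf]_x f x)%E.
  by apply: eq_measure_integral => A mA _; exact: mphiE.
rewrite ge0_integral_mscale//; congr (_ * _)%E.
by rewrite ge0_integral_pushforward//.
Qed.

Lemma ge0_integral_reflect (b : R) (f : R -> \bar R) :
  measurable_fun setT f -> (forall x, 0 <= f x)%E ->
  (\int[mu]_x f x = \int[mu]_x f (b - x)%R)%E.
Proof.
move=> mf f0.
rewrite (ge0_integral_affine b ltr01 mf f0) mul1e.
pose g x := f (1 * x + b)%R.
have mg : measurable_fun setT g.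
  by apply: (measurableT_comp mf); apply: measurable_funD => //; exact: measurable_funM.
unshelve epose (pf := (pushforward mu (-%R : measurableTypeR R -> measurableTypeR R) :
  {measure set (measurableTypeR R) -> \bar R})); first exact: oppr_measurable.
transitivity (\int[pf]_x g x)%E.
  by apply: eq_measure_integral => A mA _; exact/esym/lebesgue_measureN.
have g0 : {in setT, forall x, (0 <= g x)%E} by move=> x _; exact: f0.
have mN : measurable_fun setT (-%R : measurableTypeR R -> measurableTypeR R).
  exact: oppr_measurable.
have mg' : measurable_fun (setT : set (measurableTypeR R)) g by exact: mg.
have pfE := ge0_integral_pushforward mN mu measurableT mg' g0.
etransitivity; first exact: pfE.
by apply: eq_integral => x _; rewrite /g/=; congr f; ring.
Qed.

Lemma ge0_integral_shift (b : R) (f : R -> \bar R) :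
  measurable_fun setT f -> (forall x, 0 <= f x)%E ->
  (\int[mu]_x f x = \int[mu]_x f (x - b)%R)%E.
Proof.
move=> mf f0; rewrite (ge0_integral_affine (- b) ltr01 mf f0) mul1e.
by apply: eq_integral => x _; rewrite mul1r.
Qed.

(* [f] may be unbounded near [a]: only the limit of [F] at [a] is assumed. *)
Lemma ge0_FTC_oc (f F : R -> R) (a b : R) : a <= b -> measurable_fun setT f ->
  (forall x, a < x -> 0 <= f x) -> (forall x, a < x -> {for x, continuous f}) ->
  (forall x, a < x -> is_derive x 1 F (f x)) ->
  F x @[x --> a^'+] --> F a ->
  (\int[mu]_(x in `]a, b]) (f x)%:E = (F b - F a)%:E)%E.
Proof.
rewrite le_eqVlt => /predU1P[<- _ _ _ _ _|ab mf f0 cf dF Fa].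
  by rewrite subrr set_itvoc0 integral_set0.
(* The points a_n decrease to a: the theorem on the closed intervals [a_n, b] avoids the
   singularity, and monotone convergence recovers ]a, b]. Since a_0 = b, the degenerate interval has
   to be treated too. *)
pose a_ n : R := a + (b - a) * n.+1%:R^-1.
have a_gt n : a < a_ n by rewrite ltrDl mulr_gt0// ?subr_gt0// invr_gt0.
have a_le n : a_ n <= b.
  rewrite /a_ -lerBrDl ler_piMr// ?subr_ge0 ?(ltW ab)// invf_le1//.
  by rewrite ler1n.
have a_cvg : a_ n @[n --> \oo] --> a.
  rewrite -[X in _ --> X]addr0; apply: cvgD; first exact: cvg_cst.
  rewrite -[X in _ --> X](mulr0 (b - a)); apply: cvgMr; exact: cvg_harmonic.
pose S n : set R := `[a_ n, b]%classic.
have SU : \bigcup_n S n = `]a, b]%classic.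
  apply/seteqP; split => [x [n _]|x]; rewrite /S /= !in_itv/=.
    by move=> /andP[ax ->]; rewrite (lt_le_trans _ ax).
  move=> /andP[ax xb].
  have : \forall n \near \oo, a_ n <= x by exact: (cvgr_le _ a_cvg).
  move=> [N _ /(_ N (leqnn N)) aN]; exists N => //.
  by rewrite /= in_itv/= aN.
have intS n : (\int[mu]_(x in S n) (f x)%:E = (F b - F (a_ n))%:E)%E.
  have := a_le n; rewrite le_eqVlt => /predU1P[anb|anb].
    by rewrite /S anb set_itv1 integral_set1 subrr.
  rewrite EFinB; apply: continuous_FTC2 => //.
  - apply/continuous_within_itvP => //; split.
    + by move=> x; rewrite in_itv/= => /andP[anx _]; apply: cf; exact: lt_trans anx.
    + by apply: cvg_at_right_filter; exact: cf.
    + by apply: cvg_at_left_filter; apply: cf; exact: (lt_le_trans (a_gt n)).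
  - have cF x : a < x -> {for x, continuous F}.
      move=> ax; apply/differentiable_continuous/derivable1_diffP.
      by have [] := dF _ ax.
    split.
    + move=> x; rewrite in_itv/= => /andP[anx _].
      by have [] := dF _ (lt_trans (a_gt n) anx).
    + by apply: cvg_at_right_filter; exact: cF.
    + by apply: cvg_at_left_filter; apply: cF; exact: (lt_le_trans (a_gt n)).
  - move=> x; rewrite in_itv/= => /andP[anx _].
    have dFx := dF _ (lt_trans (a_gt n) anx).
    by rewrite derive1E derive_val.
have h1 : (\int[mu]_(x in S n) (f x)%:E)%E @[n --> \oo] --> (\int[mu]_(x in `]a, b]) (f x)%:E)%E.
  rewrite -SU; apply: ge0_nondecreasing_set_cvg_integral.
  - apply/nondecreasing_seqP => n; apply/subsetPset => x.
    rewrite /S/= !in_itv/= => /andP[ax ->]; rewrite andbT.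
    apply: le_trans ax; rewrite lerD2l ler_wpM2l// ?subr_ge0 ?(ltW ab)//.
    by rewrite lef_pV2 ?posrE// ler_nat.
  - by move=> n; exact: measurable_itv.
  - by move=> n; apply/measurable_EFinP; exact: measurable_funTS.
  - move=> n x; rewrite /S/= in_itv/= => /andP[ax _].
    by rewrite lee_fin; apply: f0; exact: lt_le_trans ax.
have h2 : (\int[mu]_(x in S n) (f x)%:E)%E @[n --> \oo] --> (F b - F a)%:E.
  under eq_fun do rewrite intS.
  apply: cvg_EFin; first by near=> n.
  apply: cvgB; first exact: cvg_cst.
  have /cvg_at_rightP := Fa; apply; split => //.
exact: (cvg_unique _ h1 h2).
Unshelve. all: by end_near. Qed.

End AffineChange.

(** * Tempered kernels and convolutions *)

Section TemperedKernel.
Context {R : realType} (lambda : R).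
Hypothesis lambda0 : 0 < lambda.
Local Notation mu := (@lebesgue_measure R).
Implicit Types a u : R.

Definition tempk a u : R := if 0 < u then u `^ (a - 1) * expR (- lambda * u) else 0.

Lemma tempk_ge0 a u : 0 <= tempk a u.
Proof. by rewrite /tempk; case: ifP => // _; rewrite mulr_ge0 ?powR_ge0 ?expR_ge0. Qed.

Lemma tempk_gt0 a u : 0 < u -> 0 < tempk a u.
Proof. by move=> u0; rewrite /tempk u0 mulr_gt0 ?powR_gt0 ?expR_gt0. Qed.

Lemma tempk_le0 a u : u <= 0 -> tempk a u = 0.
Proof. by rewrite /tempk ltNge => ->. Qed.

Lemma measurable_expRM (c : R) : measurable_fun setT (fun u : R => expR (c * u)).
Proof. by apply: measurableT_comp => //; exact: measurable_funM. Qed.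

Lemma measurable_tempk a : measurable_fun setT (tempk a).
Proof.
apply: measurable_fun_ifT => //; first exact: measurable_fun_ltr.
apply: measurable_funM; first exact: measurable_powR.
exact: measurable_expRM.
Qed.

Definition tempkint a : \bar R := (\int[mu]_u (tempk a u)%:E)%E.

Lemma tempkint_ge0 a : (0 <= tempkint a)%E.
Proof. by apply: integral_ge0 => u _; rewrite lee_fin tempk_ge0. Qed.

(** For a < 1 the integrand is unbounded at 0, hence the recourse to [ge0_FTC_oc] with primitive u^a
    / a. *)
Lemma integral_powR_oc a (b : R) : 0 < a -> 0 <= b ->
  (\int[mu]_(u in `]0%R, b]) (u `^ (a - 1))%:E = (b `^ a / a)%:E)%E.
Proof.
move=> a0 b0.
have dF (x : R) : 0 < x -> is_derive x 1 (fun u : R => u `^ a / a) (x `^ (a - 1)).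
  move=> x0; have h := is_derive1_powR a x0.
  have -> : x `^ (a - 1) = a^-1 *: (a * x `^ (a - 1)).
    by rewrite /GRing.scale/= mulrA mulVf ?mul1r// gt_eqF.
  have -> : (fun u : R => u `^ a / a) = (a^-1 *: (fun u : R => u `^ a)).
    by apply/funext => u /=; rewrite mulrC.
  exact: is_deriveZ.
have Fa : (fun u : R => u `^ a / a) u @[u --> 0^'+] --> (0 : R) `^ a / a.
  rewrite powR0 ?gt_eqF//; apply: cvgMl; exact: powR_cvg0.
have cf (x : R) : 0 < x -> {for x, continuous (fun u : R => u `^ (a - 1))}.
  move=> x0; apply/differentiable_continuous/derivable1_diffP.
  by apply: derivable_powR; rewrite in_itv/= x0.
have f0 (x : R) : 0 < x -> 0 <= x `^ (a - 1) by rewrite powR_ge0.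
have -> := ge0_FTC_oc b0 (measurable_powR _) f0 cf dF Fa.
by rewrite powR0 ?gt_eqF// mul0r subr0.
Qed.

(** For u >= 1 the power is at most an integer power u^(n+1), and the latter is controlled by one
    term of the exponential series at c u. *)
Lemma powR_le_expR a (c : R) : 0 < c ->
  exists2 C : R, 0 <= C & forall u, 1 <= u -> u `^ a <= C * expR (c * u).
Proof.
move=> c0.
have [n an] : exists n : nat, a <= n.+1%:R.
  exists (Num.trunc a); rewrite ltW//; have := @truncnS_gt R a; rewrite //.
exists (n.+1`!%:R / c ^+ n.+1); first by rewrite divr_ge0// exprn_ge0// ltW.
move=> u u1; have u0 : 0 <= u by exact: le_trans u1.
apply: (@le_trans _ _ (u ^+ n.+1)).
  by rewrite -powR_mulrn//; exact: ler_powR.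
have := @expR_ge1Dxn R (c * u) n; rewrite mulr_ge0// ?(ltW c0)// => /(_ isT) h.
have {}h : (c * u) ^+ n.+1 / n.+1`!%:R <= expR (c * u).
  by apply: le_trans h; rewrite lerDr.
rewrite mulrAC ler_pdivlMr ?exprn_gt0// mulrC -exprMn.
by move: h; rewrite ler_pdivrMr ?ltr0n ?fact_gt0// [_ * expR _]mulrC.
Qed.

Lemma tempkint_lty a : 0 < a -> (tempkint a < +oo)%E.
Proof.
move=> a0.
have l2 : 0 < lambda / 2 by rewrite divr_gt0.
have [C C0 hC] := powR_le_expR (a - 1) l2.
pose g1 (u : R) : \bar R := (((fun u => u `^ (a - 1)) \_ `]0, 1]) u)%:E.
(* Beyond 1, half of the exponential absorbs u^(a-1) at cost C; dividing by lambda / 2 turns the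
   remaining C e^(-lambda u / 2) into a multiple of the exponential density. *)
pose g2 (u : R) : \bar R := ((C / (lambda / 2)) * exponential_pdf (lambda / 2) u)%:E.
have g10 u : (0 <= g1 u)%E.
  by rewrite lee_fin patchE; case: ifP => // _; rewrite powR_ge0.
have g20 u : (0 <= g2 u)%E.
  rewrite lee_fin; apply: mulr_ge0; first exact: divr_ge0 (ltW l2).
  exact: (exponential_pdf_ge0 (ltW l2)).
have mg1 : measurable_fun setT g1.
  apply/measurable_EFinP; apply/measurable_restrict => //.
  exact: measurable_funTS (measurable_powR _).
have mg2 : measurable_fun setT g2.
  apply/measurable_EFinP; apply: measurable_funM => //.
  exact: measurable_exponential_pdf.
apply: (@le_lt_trans _ _ (\int[mu]_u (g1 u + g2 u))%E).
  apply: ge0_le_integral => //.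
  - by move=> u _; rewrite lee_fin tempk_ge0.
  - by apply/measurable_EFinP; exact: measurable_tempk.
  - exact: emeasurable_funD.
  - move=> u _; rewrite /tempk; case: ifPn => u0; last by rewrite adde_ge0.
    rewrite -EFinD lee_fin patchE; case: ifPn => [_|].
      apply: (@le_trans _ _ (u `^ (a - 1))); last by rewrite lerDl -lee_fin g20.
      rewrite ler_piMr ?powR_ge0// -expR0 ler_expR mulNr oppr_le0 mulr_ge0// ltW//.
    rewrite notin_setE/= in_itv/= u0/= => /negP; rewrite -ltNge => /ltW u1.
    rewrite add0r exponential_pdfE ?(ltW u0)//.
    have -> : C / (lambda / 2) * (lambda / 2 * expR (- (lambda / 2) * u)) =
      C * expR (lambda / 2 * u) * (expR (- (lambda / 2) * u) * expR (- (lambda / 2) * u)).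
      rewrite mulNr expRN; field.
      by rewrite ?gt_eqF ?expR_gt0.
    have -> : - lambda * u = - (lambda / 2) * u + - (lambda / 2) * u by field.
    by rewrite expRD ler_wpM2r ?mulr_ge0 ?expR_ge0// hC.
rewrite ge0_integralD// lte_add_pinfty//.
  have -> : (\int[mu]_u g1 u = \int[mu]_(u in `]0%R, 1%R]) (u `^ (a - 1))%:E)%E.
    rewrite [RHS]integral_mkcond; apply: eq_integral => u _.
    by rewrite /g1 !patchE; case: ifP.
  by rewrite integral_powR_oc// ltry.
rewrite /g2; under eq_integral do rewrite EFinM.
rewrite ge0_integralZl//=.
- by rewrite integral_exponential_pdf// mule1 ltry.
- by apply/measurable_EFinP; exact: measurable_exponential_pdf.
- by move=> u _; rewrite lee_fin; exact: (exponential_pdf_ge0 (ltW l2)).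
- by rewrite lee_fin; exact: divr_ge0 (ltW l2).
Qed.

(** A zero integral would make [tempk] vanish almost everywhere, yet it is positive on ]0, 1[, of
    measure 1. *)
Lemma tempkint_gt0 a : (0 < tempkint a)%E.
Proof.
rewrite lt0e tempkint_ge0 andbT; apply/negP => /eqP k0.
have /(ae_eq_integral_abs mu measurableT) : measurable_fun setT (EFin \o tempk a).
  by apply/measurable_EFinP; exact: measurable_tempk.
move=> [+ _].
under eq_integral do rewrite /= ger0_norm ?tempk_ge0//.
move=> /(_ k0) [N [mN N0 sN]].
have : (mu `]0%R, 1%R[%classic <= mu N)%E.
  apply: le_measure; rewrite ?inE//.
  move=> u /=; rewrite in_itv/= => /andP[u0 _]; apply: sN => /= /(_ I) [] /eqP.
  by rewrite gt_eqF// tempk_gt0.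
by rewrite N0 lebesgue_measure_itv/= lte_fin ltr01 oppr0 adde0 lee_fin ler10.
Qed.

(** This is Gamma(a) / lambda^a; it serves both as the L^2 operator bound of T_a and as the source
    of the Beta constants. *)
Definition tempc a : R := fine (tempkint a).

Lemma tempcE a : 0 < a -> tempkint a = (tempc a)%:E.
Proof. by move=> a0; rewrite fineK// ge0_fin_numE ?tempkint_ge0// tempkint_lty. Qed.

Lemma tempc_gt0 a : 0 < a -> 0 < tempc a.
Proof. by move=> a0; rewrite -lte_fin -tempcE// tempkint_gt0. Qed.

End TemperedKernel.

(** * Almost-everywhere reasoning and Tonelli on the line *)

Section LebesgueTools.
Context {R : realType}.
Local Notation mu := (@lebesgue_measure R).

Lemma lebesgue_aeS (P Q : R -> Prop) : (forall x, P x -> Q x) ->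
  {ae mu, forall x, P x} -> {ae mu, forall x, Q x}.
Proof.
move=> PQ [N [mN N0 sN]]; exists N; split => // x nQ.
by apply: sN => Px; apply: nQ; exact: PQ.
Qed.

Lemma lebesgue_aeS2 (P Q S : R -> Prop) : (forall x, P x -> Q x -> S x) ->
  {ae mu, forall x, P x} -> {ae mu, forall x, Q x} -> {ae mu, forall x, S x}.
Proof.
move=> PQS aeP aeQ; have := negligibleU aeP aeQ; apply: negligibleS => x nS.
by apply: contrapT => /not_orP[/contrapT Px /contrapT Qx]; apply: nS; exact: PQS.
Qed.

Lemma tonelliR (f : R -> R -> \bar R) :
  measurable_fun setT (fun p : R * R => f p.1 p.2) -> (forall x y, 0 <= f x y)%E ->
  (\int[mu]_x \int[mu]_y f x y = \int[mu]_y \int[mu]_x f x y)%E.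
Proof.
move=> mf f0.
exact: (@fubini_tonelli _ _ _ _ R mu mu (fun p => f p.1 p.2) mf (fun p => f0 p.1 p.2)).
Qed.

Lemma measurable_integral_snd (f : R -> R -> \bar R) :
  measurable_fun setT (fun p : R * R => f p.1 p.2) -> (forall x y, 0 <= f x y)%E ->
  measurable_fun setT (fun x => \int[mu]_y f x y)%E.
Proof.
move=> mf f0.
exact: (@measurable_fun_fubini_tonelli_F _ _ _ _ R mu (fun p => f p.1 p.2) mf (fun p => f0 p.1 p.2)).
Qed.

Lemma tonelli_EFin (f : R -> R -> R) :
  measurable_fun setT (fun p : R * R => f p.1 p.2) -> (forall x y, 0 <= f x y) ->
  (\int[mu]_x \int[mu]_y (f x y)%:E = \int[mu]_y \int[mu]_x (f x y)%:E)%E.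
Proof.
move=> mf f0; apply: (tonelliR (f := fun x y => (f x y)%:E)).
  exact: (measurableT_comp _ mf).
by move=> x y; rewrite lee_fin.
Qed.

Lemma ae_lty_integral (f : R -> \bar R) : measurable_fun setT f ->
  (forall x, 0 <= f x)%E -> (\int[mu]_x f x < +oo)%E ->
  {ae mu, forall x, (f x < +oo)%E}.
Proof.
move=> mf f0 fi.
have : mu.-integrable setT f.
  by apply/integrableP; split => //; under eq_integral do rewrite gee0_abs//.
move=> /(integrable_ae measurableT); apply: filterS => x /(_ I).
by rewrite ge0_fin_numE.
Qed.

(** A null set contains no interval. This supplies points where an almost-everywhere property holds
    as close as desired to a given point. *)
Lemma ae_exists_between (P : R -> Prop) (x y : R) : {ae mu, forall z, P z} ->
  x < y -> exists z, [/\ x < z, z < y & P z].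
Proof.
move=> [N [mN N0 sN]] xy; apply: contrapT => nP.
have : (mu `]x, y[%classic <= mu N)%E.
  apply: le_measure; rewrite ?inE//.
  move=> u /=; rewrite in_itv/= => /andP[xu uy]; apply: sN => /= Pu.
  by apply: nP; exists u.
by rewrite N0 lebesgue_measure_itv/= lte_fin xy -EFinB lee_fin leNgt subr_gt0 xy.
Qed.

End LebesgueTools.

(** * The operators T_a: domain, linearity and semigroup law *)

Section TemperedConvolution.
Context {R : realType} (lambda : R).
Hypothesis lambda0 : 0 < lambda.
Local Notation mu := (@lebesgue_measure R).
Local Notation k := (tempk lambda).
Local Notation kint := (tempkint lambda).
Local Notation c_ := (tempc lambda).
Implicit Types (a b : R) (h f g : R -> R).

Definition tconv_abs a h (y : R) : \bar R := (\int[mu]_s (`|h s| * k a (s - y))%:E)%E.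

Definition tconv a h (y : R) : R := \int[mu]_s (h s * k a (s - y)).

(** All orders are required at once because composing T_a with T_b raises the order to a + b. The
    class has to hold both L^2 and the non-square-integrable witness [halfk]. *)
Definition tconv_dom : set (R -> R) := [set h | measurable_fun setT h /\
  forall a, 0 < a -> {ae mu, forall y, (tconv_abs a h y < +oo)%E}].

Lemma measurable_tempk2 a (f g : R * R -> R) : measurable_fun setT f ->
  measurable_fun setT g -> measurable_fun setT (fun p => k a (f p - g p)).
Proof.
move=> mf mg; apply: (measurableT_comp (measurable_tempk lambda a)).
exact: measurable_funB.
Qed.

Lemma measurable_tempk_shift a (y : R) : measurable_fun setT (fun s : R => k a (s - y)).
Proof.
apply: (measurableT_comp (measurable_tempk lambda a)); exact: measurable_funB.
Qed.

Lemma measurable_tempk_reflect a (s : R) : measurable_fun setT (fun y : R => k a (s - y)).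
Proof.
apply: (measurableT_comp (measurable_tempk lambda a)); exact: measurable_funB.
Qed.

Lemma integral_tempk_shift a (y : R) : (\int[mu]_s (k a (s - y))%:E = kint a)%E.
Proof.
rewrite /tempkint [RHS](ge0_integral_shift y)//.
  by apply/measurable_EFinP; exact: measurable_tempk.
by move=> x; rewrite lee_fin tempk_ge0.
Qed.

Lemma integral_tempk_reflect a (s : R) : (\int[mu]_y (k a (s - y))%:E = kint a)%E.
Proof.
rewrite /tempkint [RHS](ge0_integral_reflect s)//.
  by apply/measurable_EFinP; exact: measurable_tempk.
by move=> x; rewrite lee_fin tempk_ge0.
Qed.

Lemma tconv_abs_ge0 a h y : (0 <= tconv_abs a h y)%E.
Proof. by apply: integral_ge0 => s _; rewrite lee_fin mulr_ge0// tempk_ge0. Qed.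

Lemma measurable_tconv_integrand a h y : measurable_fun setT h ->
  measurable_fun setT (fun s : R => h s * k a (s - y)).
Proof. by move=> mh; apply: measurable_funM => //; exact: measurable_tempk_shift. Qed.

Lemma measurable_tconv_integrand2 a h : measurable_fun setT h ->
  measurable_fun setT (fun p : R * R => h p.2 * k a (p.2 - p.1)).
Proof.
move=> mh; apply: measurable_funM.
  exact: (measurableT_comp mh measurable_snd).
by apply: measurable_tempk2; [exact: measurable_snd|exact: measurable_fst].
Qed.

Lemma measurable_tconv_abs a h : measurable_fun setT h ->
  measurable_fun setT (tconv_abs a h).
Proof.
move=> mh; apply: (measurable_integral_snd (f := fun y s : R => (`|h s| * k a (s - y))%:E)).
  apply/measurable_EFinP.
  by apply: (measurable_tconv_integrand2 a (h := fun s => `|h s|)); exact: measurableT_comp.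
by move=> y s; rewrite lee_fin mulr_ge0// tempk_ge0.
Qed.

(** The integral may diverge at some y, so positive and negative parts are integrated separately,
    each measurable in y by Tonelli. *)
Lemma measurable_tconv a h : measurable_fun setT h -> measurable_fun setT (tconv a h).
Proof.
move=> mh; rewrite /tconv /Rintegral.
pose F (p : R * R) : \bar R := (h p.2 * k a (p.2 - p.1))%:E.
have mF : measurable_fun setT F.
  exact: (measurableT_comp _ (measurable_tconv_integrand2 a mh)).
apply: measurableT_comp; first exact: fine_measurable.
have intE (y : R) : (\int[mu]_s (h s * k a (s - y))%:E =
    \int[mu]_s (F^\+ (y, s)) - \int[mu]_s (F^\- (y, s)))%E.
  by rewrite integralE; congr (_ - _)%E; apply: eq_integral => s _; rewrite ?funeposE ?funenegE.
under eq_fun do rewrite intE.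
have mp : measurable_fun setT (fun y : R => \int[mu]_s (F^\+ (y, s)))%E.
  apply: (measurable_integral_snd (f := fun y s : R => F^\+%E (y, s))) => //.
  rewrite (_ : (fun p => _) = F^\+%E); last by apply/funext => -[].
  exact: measurable_funepos.
have mn : measurable_fun setT (fun y : R => \int[mu]_s (F^\- (y, s)))%E.
  apply: (measurable_integral_snd (f := fun y s : R => F^\-%E (y, s))) => //.
  rewrite (_ : (fun p => _) = F^\-%E); last by apply/funext => -[].
  exact: measurable_funeneg.
exact: (emeasurable_funB mp mn).
Qed.

Lemma tconv_integrable a h y : measurable_fun setT h -> (tconv_abs a h y < +oo)%E ->
  mu.-integrable setT (fun s : R => (h s * k a (s - y))%:E).
Proof.
move=> mh hy; apply/integrableP; split.
  by apply/measurable_EFinP; exact: measurable_tconv_integrand.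
under eq_integral do rewrite /= normrM (ger0_norm (tempk_ge0 _ _ _)).
exact: hy.
Qed.

Lemma le_tconv_abs a h y : measurable_fun setT h ->
  (`|tconv a h y|%:E <= tconv_abs a h y)%E.
Proof.
move=> mh.
apply: (@le_trans _ _ `|\int[mu]_s (h s * k a (s - y))%:E|%E).
  (* An infinite integral has real value 0, so the bound holds without integrability. *)
  by rewrite /tconv /Rintegral; case: integral => [r||]//=; rewrite normr0 ?leey.
apply: le_trans (le_abse_integral _ _ _) _ => //.
  by apply/measurable_EFinP; exact: measurable_tconv_integrand.
rewrite le_eqVlt; apply/orP; left; apply/eqP; apply: eq_integral => s _.
by rewrite /= normrM (ger0_norm (tempk_ge0 _ _ _)).
Qed.

Lemma tconv_comb a (c : R) f g y : measurable_fun setT f -> measurable_fun setT g ->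
  (tconv_abs a f y < +oo)%E -> (tconv_abs a g y < +oo)%E ->
  tconv a (fun s : R => c * f s + g s) y = c * tconv a f y + tconv a g y.
Proof.
move=> mf mg /(tconv_integrable mf) fi /(tconv_integrable mg) gi.
rewrite /tconv -RintegralZl// -RintegralD//.
  by apply: eq_Rintegral => s _; ring.
exact: (integrableZl measurableT c fi).
Qed.

Lemma tconv_dom_comb (c : R) f g : tconv_dom f -> tconv_dom g ->
  tconv_dom (fun s : R => c * f s + g s).
Proof.
move=> [mf fD] [mg gD]; split.
  by apply: measurable_funD => //; exact: measurable_funM.
move=> a a0; have fa := fD a a0; have ga := gD a a0.
apply: (lebesgue_aeS2 _ fa ga) => y fy gy.
apply: (@le_lt_trans _ _ (`|c|%:E * tconv_abs a f y + tconv_abs a g y)%E).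
  rewrite -ge0_integralZl//; last 2 first.
  - apply/measurable_EFinP; apply: (measurable_tconv_integrand a y (h := fun s => `|f s|)).
    exact: measurableT_comp.
  - by move=> s _; rewrite lee_fin mulr_ge0// tempk_ge0.
  rewrite -ge0_integralD//; last 4 first.
  - by move=> s _; rewrite -EFinM lee_fin !mulr_ge0// tempk_ge0.
  - apply/measurable_EFinP; apply: measurable_funM => //.
    apply: (measurable_tconv_integrand a y (h := fun s => `|f s|)).
    exact: measurableT_comp.
  - by move=> s _; rewrite lee_fin mulr_ge0// tempk_ge0.
  - apply/measurable_EFinP; apply: (measurable_tconv_integrand a y (h := fun s => `|g s|)).
    exact: measurableT_comp.
  apply: ge0_le_integral => //.
  - by move=> s _; rewrite lee_fin mulr_ge0// tempk_ge0.
  - apply/measurable_EFinP; apply: measurable_tconv_integrand.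
    apply: measurableT_comp => //.
    by apply: measurable_funD => //; exact: measurable_funM.
  - apply: emeasurable_funD; apply/measurable_EFinP.
      apply: measurable_funM => //.
      by apply: (measurable_tconv_integrand a y (h := fun s => `|f s|)); exact: measurableT_comp.
    by apply: (measurable_tconv_integrand a y (h := fun s => `|g s|)); exact: measurableT_comp.
  - move=> s _; rewrite -EFinM -EFinD lee_fin mulrA -mulrDl ler_wpM2r ?tempk_ge0//.
    by rewrite (le_trans (ler_normD _ _))// normrM.
by rewrite lte_add_pinfty// lte_mul_pinfty// lee_fin.
Qed.

Lemma integral_tconv_abs a h : measurable_fun setT h ->
  (\int[mu]_y tconv_abs a h y = (\int[mu]_s `|h s|%:E) * kint a)%E.
Proof.
move=> mh; have mah : measurable_fun setT (fun s : R => `|h s|) by exact: measurableT_comp.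
rewrite /tconv_abs (tonelli_EFin (f := fun y s : R => `|h s| * k a (s - y))).
- rewrite -ge0_integralZr//; last 2 first.
    exact/measurable_EFinP.
    exact: tempkint_ge0.
  apply: eq_integral => s _.
  under eq_integral do rewrite EFinM.
  rewrite (ge0_integralZl _ measurableT); last 3 first.
  - by apply/measurable_EFinP; exact: measurable_tempk_reflect.
  - by move=> y _; rewrite lee_fin tempk_ge0.
  - by rewrite lee_fin normr_ge0.
  by rewrite integral_tempk_reflect.
- exact: (measurable_tconv_integrand2 a mah).
- by move=> y s; rewrite mulr_ge0// tempk_ge0.
Qed.

(** By Tonelli the integral of [tconv_abs] is |h|_1 times [tempc], so [tconv_abs] is finite almost
    everywhere. *)
Lemma tconv_dom_L1 h : mu.-integrable setT (EFin \o h) -> tconv_dom h.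
Proof.
move=> /integrableP[/measurable_EFinP mh hi]; split => // a a0.
apply: ae_lty_integral; first exact: measurable_tconv_abs.
  by move=> y; exact: tconv_abs_ge0.
rewrite integral_tconv_abs// (tempcE lambda0 a0) muleC lte_mul_pinfty// lee_fin.
exact/ltW/(tempc_gt0 lambda0).
Qed.

(** Since |h| <= 1 + h^2, the transform of |h| is at most the total mass of the kernel plus the
    transform of h^2, and h^2 is in L^1. *)
Lemma tconv_dom_L2 h : h \in Lfun mu 2%:E -> tconv_dom h.
Proof.
move=> hL; have mh := Lfun2_measurable hL; split => // a a0.
have [_ h2D] : tconv_dom (fun s : R => h s ^+ 2).
  by apply: tconv_dom_L1; exact: Lfun2_integrable_sqr.
apply: (lebesgue_aeS _ (h2D a a0)) => y hy.
have msq : measurable_fun setT (fun s : R => `|h s ^+ 2| * k a (s - y)).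
  apply: (measurable_tconv_integrand a y (h := fun s => `|h s ^+ 2|)).
  by apply: measurableT_comp => //; exact: measurable_funX.
apply: (@le_lt_trans _ _ (kint a + tconv_abs a (fun s : R => (h s ^+ 2)%R) y)%E).
  rewrite -(integral_tempk_shift a y) -ge0_integralD//; last 4 first.
  - by move=> s _; rewrite lee_fin tempk_ge0.
  - by apply/measurable_EFinP; exact: measurable_tempk_shift.
  - by move=> s _; rewrite lee_fin mulr_ge0// tempk_ge0.
  - exact/measurable_EFinP.
  apply: ge0_le_integral => //.
  - by move=> s _; rewrite lee_fin mulr_ge0// tempk_ge0.
  - apply/measurable_EFinP; apply: measurable_tconv_integrand.
    exact: measurableT_comp.
  - apply: emeasurable_funD; apply/measurable_EFinP => //.
    exact: measurable_tempk_shift.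
  - move=> s _; rewrite -EFinD lee_fin -{2}(mul1r (k a _)) -mulrDl.
    rewrite ler_wpM2r ?tempk_ge0// normrX.
    have := sqr_ge0 (`|h s| - 1); have := normr_ge0 (h s); nra.
by rewrite lte_add_pinfty// tempkint_lty.
Qed.

Section Beta.
Variables (a b : R).
Hypotheses (a0 : 0 < a) (b0 : 0 < b).

Let betaf (u : R) : R := if (0 < u) && (u < 1) then u `^ (a - 1) * (1 - u) `^ (b - 1) else 0.

Let betaf_ge0 u : 0 <= betaf u.
Proof. by rewrite /betaf; case: ifP => // _; rewrite mulr_ge0 ?powR_ge0. Qed.

Let measurable_betaf : measurable_fun setT betaf.
Proof.
apply: measurable_fun_ifT => //.
  by apply: measurable_and; exact: measurable_fun_ltr.
apply: measurable_funM; first exact: measurable_powR.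
apply: (measurableT_comp (measurable_powR _)); exact: measurable_funB.
Qed.

(** The substitution t = w u separates the variables: the exponentials multiply to e^(-lambda w),
    the powers of w add up to w^(a+b-1), and what is left is the Beta integral in u. *)
Let tempk_conv_aux w : (\int[mu]_t (k a t * k b (w - t))%:E =
  (\int[mu]_u (betaf u)%:E) * (k (a + b) w)%:E)%E.
Proof.
have [w0|w0] := leP w 0.
  rewrite (tempk_le0 _ _ w0) mule0 integral0_eq// => t _.
  have [t0|t0] := leP t 0; first by rewrite (tempk_le0 _ _ t0) mul0r.
  by rewrite [k b _]tempk_le0 ?mulr0//; lra.
rewrite (ge0_integral_affine 0 w0); last 2 first.
- apply/measurable_EFinP; apply: measurable_funM; first exact: measurable_tempk.
  exact: measurable_tempk_reflect.
- by move=> t; rewrite lee_fin mulr_ge0 ?tempk_ge0.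
rewrite -ge0_integralZl//; last 3 first.
- apply/measurable_EFinP; apply: measurable_funM.
    apply: (measurableT_comp (measurable_tempk lambda a)).
    by apply: measurable_funD => //; exact: measurable_funM.
  apply: (measurableT_comp (measurable_tempk lambda b)); apply: measurable_funB => //.
  by apply: measurable_funD => //; exact: measurable_funM.
- by move=> t _; rewrite lee_fin mulr_ge0 ?tempk_ge0.
- by rewrite lee_fin ltW.
rewrite -ge0_integralZr//; last 3 first.
- exact/measurable_EFinP.
- by move=> u _; rewrite lee_fin.
- by rewrite lee_fin tempk_ge0.
apply: eq_integral => u _; rewrite -!EFinM; congr EFin; rewrite addr0.
have wuE : w - w * u = w * (1 - u) by ring.
rewrite /betaf; case: ifPn => [/andP[u0 u1]|].
  have u1' : 0 < 1 - u by lra.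
  rewrite wuE /tempk w0 !pmulr_rgt0// u0 u1'.
  rewrite !powRM ?(ltW w0) ?(ltW u0) ?(ltW u1')//.
  have -> : w `^ (a + b - 1) = w * w `^ (a - 1) * w `^ (b - 1).
    have -> : a + b - 1 = 1 + (a - 1) + (b - 1) by ring.
    move: (a - 1) (b - 1) => p q.
    by rewrite !powRD ?(gt_eqF w0) ?implybT// powRr1 ?(ltW w0).
  have -> : - lambda * w = - lambda * (w * u) + - lambda * (w * (1 - u)) by ring.
  by rewrite expRD; ring.
rewrite negb_and -!leNgt => /orP[u0|u1].
  by rewrite (tempk_le0 _ a) ?mul0r ?mulr0// pmulr_rle0.
by rewrite [k b _]tempk_le0 ?mul0r ?mulr0// wuE pmulr_rle0// subr_le0.
Qed.

(** The Beta function B(a, b) = Gamma(a) Gamma(b) / Gamma(a + b), the powers of lambda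
    cancelling. *)
Definition tempbeta : R := c_ a * c_ b / c_ (a + b).

Lemma tempbeta_gt0 : 0 < tempbeta.
Proof. by rewrite divr_gt0 ?mulr_gt0// (tempc_gt0 lambda0)// addr_gt0. Qed.

(** The Beta integral is identified by integrating over w: Tonelli gives c_a c_b on one side and the
    Beta integral times c_(a+b) on the other. *)
Lemma tempk_conv w :
  (\int[mu]_t (k a t * k b (w - t))%:E = (tempbeta * k (a + b) w)%:E)%E.
Proof.
rewrite tempk_conv_aux.
have ab0 : 0 < a + b by rewrite addr_gt0.
have cab0 := tempc_gt0 lambda0 ab0.
suff -> : (\int[mu]_u (betaf u)%:E = tempbeta%:E)%E by rewrite EFinM.
have B0 : (0 <= \int[mu]_u (betaf u)%:E)%E by apply: integral_ge0 => u _; rewrite lee_fin.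
have mk2 : measurable_fun setT (fun p : R * R => k a p.2 * k b (p.1 - p.2)).
  apply: measurable_funM.
    exact: (measurableT_comp (measurable_tempk lambda a) measurable_snd).
  by apply: measurable_tempk2; [exact: measurable_fst|exact: measurable_snd].
have : (\int[mu]_w \int[mu]_t (k a t * k b (w - t))%:E = (c_ a * c_ b)%:E)%E.
  rewrite (tonelli_EFin (f := fun w t : R => k a t * k b (w - t))); last 2 first.
  - exact: mk2.
  - by move=> x t; rewrite mulr_ge0 ?tempk_ge0.
  under eq_integral => t _.
    under eq_integral do rewrite EFinM.
    rewrite ge0_integralZl//; last 3 first.
    - by apply/measurable_EFinP; exact: measurable_tempk_shift.
    - by move=> x _; rewrite lee_fin tempk_ge0.
    - by rewrite lee_fin tempk_ge0.
    rewrite integral_tempk_shift (tempcE lambda0 b0); over.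
  have cb0 : (0 <= (c_ b)%:E)%E by rewrite lee_fin; exact: ltW (tempc_gt0 lambda0 b0).
  have mka : measurable_fun setT (fun t : R => (k a t)%:E).
    exact: (measurableT_comp _ (measurable_tempk lambda a)).
  have ka0 (t : R) : setT t -> (0 <= (k a t)%:E)%E by rewrite lee_fin tempk_ge0.
  rewrite (ge0_integralZr mu measurableT mka ka0 cb0) -/(tempkint lambda a).
  by rewrite (tempcE lambda0 a0).
under eq_integral do rewrite tempk_conv_aux.
rewrite ge0_integralZl//; last 2 first.
- by apply/measurable_EFinP; exact: measurable_tempk.
- by move=> x _; rewrite lee_fin tempk_ge0.
rewrite -/(tempkint lambda (a + b)) (tempcE lambda0 ab0).
(* The Beta integral was not known to be finite: an infinite value times the positive c_(a+b) would
   contradict the finite c_a c_b. *)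
case: integral B0 => [r _|_|//].
  rewrite -EFinM => -[] rE; congr EFin; rewrite /tempbeta -rE mulfK//.
  by rewrite gt_eqF.
by rewrite gt0_mulye// lte_fin.
Qed.

Lemma tempk_conv_shift (s y : R) :
  (\int[mu]_t (k b (s - t) * k a (t - y))%:E = (tempbeta * k (a + b) (s - y))%:E)%E.
Proof.
rewrite -tempk_conv [RHS](ge0_integral_shift y).
- by apply: eq_integral => t _; rewrite mulrC; congr (_ * k b _)%:E; ring.
- apply/measurable_EFinP; apply: measurable_funM; first exact: measurable_tempk.
  exact: measurable_tempk_reflect.
- by move=> t; rewrite lee_fin mulr_ge0 ?tempk_ge0.
Qed.

Let measurable_triple h y : measurable_fun setT h -> measurable_fun setT
  (fun p : R * R => h p.2 * k b (p.2 - p.1) * k a (p.1 - y)).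
Proof.
move=> mh; apply: measurable_funM; first exact: measurable_tconv_integrand2.
exact: (measurableT_comp (measurable_tempk_shift a y) measurable_fst).
Qed.

Lemma tconv_abs_semigroup h y : measurable_fun setT h ->
  (\int[mu]_t (tconv_abs b h t * (k a (t - y))%:E) =
   tempbeta%:E * tconv_abs (a + b) h y)%E.
Proof.
move=> mh; have mah : measurable_fun setT (fun s : R => `|h s|) by exact: measurableT_comp.
transitivity (\int[mu]_t \int[mu]_s (`|h s| * k b (s - t) * k a (t - y))%:E)%E.
  apply: eq_integral => t _; rewrite -ge0_integralZr//.
  - by apply/measurable_EFinP; exact: (measurable_tconv_integrand _ _ mah).
  - by move=> s _; rewrite lee_fin mulr_ge0// tempk_ge0.
  - by rewrite lee_fin tempk_ge0.
rewrite (tonelli_EFin (f := fun t s : R => `|h s| * k b (s - t) * k a (t - y))); last 2 first.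
- exact: (measurable_triple y mah).
- by move=> t s; rewrite !mulr_ge0// tempk_ge0.
rewrite -ge0_integralZl//; last 3 first.
- by apply/measurable_EFinP; exact: (measurable_tconv_integrand _ _ mah).
- by move=> s _; rewrite lee_fin mulr_ge0// tempk_ge0.
- by rewrite lee_fin ltW// tempbeta_gt0.
apply: eq_integral => s _.
under eq_integral do rewrite -mulrA EFinM.
rewrite ge0_integralZl// ?tempk_conv_shift ?lee_fin//.
- by rewrite -!EFinM; congr EFin; ring.
- apply/measurable_EFinP; apply: measurable_funM; first exact: measurable_tempk_reflect.
  exact: measurable_tempk_shift.
- by move=> t _; rewrite lee_fin mulr_ge0 ?tempk_ge0.
Qed.

(** Fubini for h(s) k_b(s - t) k_a(t - y). Absolute convergence of order a + b at the single point y
    is exactly its integrability in (t, s), so the identity is pointwise. *)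
Lemma tconv_semigroup h y : measurable_fun setT h -> (tconv_abs (a + b) h y < +oo)%E ->
  tconv a (tconv b h) y = tempbeta * tconv (a + b) h y.
Proof.
move=> mh hy; have mah : measurable_fun setT (fun s : R => `|h s|) by exact: measurableT_comp.
pose F (p : R * R) : \bar R := (h p.2 * k b (p.2 - p.1) * k a (p.1 - y))%:E.
have mF : measurable_fun setT F by exact: (measurableT_comp _ (measurable_triple y mh)).
have iF : (mu \x mu)%E.-integrable setT F.
  apply/integrable12ltyP => //.
  rewrite (_ : (\int[mu]_x _)%E = (tempbeta%:E * tconv_abs (a + b) h y)%E).
    by rewrite lte_mul_pinfty// lee_fin ltW// tempbeta_gt0.
  rewrite -tconv_abs_semigroup//; apply: eq_integral => t _.
  rewrite -ge0_integralZr//.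
  - apply: eq_integral => s _ /=.
    by rewrite !normrM !(ger0_norm (tempk_ge0 _ _ _)).
  - by apply/measurable_EFinP; exact: (measurable_tconv_integrand _ _ mah).
  - by move=> s _; rewrite lee_fin mulr_ge0// tempk_ge0.
  - by rewrite lee_fin tempk_ge0.
have FF : (\int[mu]_t \int[mu]_s F (t, s) = \int[mu]_s \int[mu]_t F (t, s))%E.
  exact: (Fubini iF).
have R1 : (\int[mu]_s \int[mu]_t F (t, s) =
    \int[mu]_s (tempbeta%:E * (h s * k (a + b) (s - y))%:E))%E.
  apply: eq_integral => s _; rewrite /F/=.
  under eq_integral do rewrite -mulrA EFinM.
  have ik : mu.-integrable setT (EFin \o (fun t : R => k b (s - t) * k a (t - y))).
    apply: ge0_integrable_EFin.
    - apply: measurable_funM; first exact: measurable_tempk_reflect.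
      exact: measurable_tempk_shift.
    - by move=> t; rewrite mulr_ge0 ?tempk_ge0.
    - by rewrite tempk_conv_shift ltry.
  rewrite (integralZl measurableT ik) tempk_conv_shift -!EFinM; congr EFin; ring.
have L1 : (\int[mu]_t (tconv b h t * k a (t - y))%:E = \int[mu]_t \int[mu]_s F (t, s))%E.
  have mL : measurable_fun setT (fun t : R => (tconv b h t * k a (t - y))%:E).
    apply/measurable_EFinP; apply: measurable_funM; first exact: measurable_tconv.
    exact: measurable_tempk_shift.
  have aeL : {ae mu, forall t : R, mu.-integrable setT (fun s : R => F (t, s))}.
    exact: (ae_integrable1 iF).
  have mR : measurable_fun setT (fun t : R => \int[mu]_s F (t, s))%E.
    exact: (measurable_fubini_F iF).
  have := @ae_eq_integral _ _ R mu setT _ _ measurableT mL mR.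
  apply.
  move: aeL; clear iF FF R1; apply: lebesgue_aeS => t it _.
  (* Where k_a(t - y) = 0 the section carries no information on h, but both sides vanish; elsewhere
     the factor is divided out to get integrability at t. *)
  have [k0|k0] := eqVneq (k a (t - y)) 0.
    have F0 (s : R) : setT s -> F (t, s) = 0%E by move=> _; rewrite /F/= k0 mulr0.
    by rewrite k0 mulr0 (integral0_eq mu F0).
  have ih : mu.-integrable setT (fun s : R => (h s * k b (s - t))%:E).
    have := integrableZl measurableT (k a (t - y))^-1 it.
    apply: eq_integrable => // s _; rewrite /F/= -EFinM; congr EFin.
    by rewrite mulrCA mulVf// mulr1.
  rewrite /F/=; under [RHS]eq_integral do rewrite mulrC EFinM.
  rewrite (integralZl measurableT ih) EFinM muleC; congr (_ * _)%E.
  by rewrite /tconv /Rintegral fineK; last exact: (integrable_fin_num measurableT ih).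
have ih := tconv_integrable mh hy.
have fin := integrable_fin_num measurableT ih.
have e := etrans L1 (etrans FF (etrans R1 (integralZl measurableT ih tempbeta))).
by clear iF FF R1 L1; rewrite [LHS]/tconv /Rintegral e fineM.
Qed.

End Beta.

Lemma tconv_dom_tconv b h : 0 < b -> tconv_dom h -> tconv_dom (tconv b h).
Proof.
move=> b0 [mh hD]; split; first exact: measurable_tconv.
move=> a a0; have ab0 : 0 < a + b by rewrite addr_gt0.
apply: (lebesgue_aeS _ (hD _ ab0)) => y hy.
apply: (@le_lt_trans _ _ (\int[mu]_t (tconv_abs b h t * (k a (t - y))%:E))%E); last first.
  rewrite tconv_abs_semigroup// lte_mul_pinfty// lee_fin ltW//.
  exact: tempbeta_gt0.
apply: ge0_le_integral => //.
- by move=> t _; rewrite lee_fin mulr_ge0// tempk_ge0.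
- apply/measurable_EFinP; apply: measurable_tconv_integrand.
  by apply: measurableT_comp => //; exact: measurable_tconv.
- apply: emeasurable_funM; first exact: measurable_tconv_abs.
  by apply/measurable_EFinP; exact: measurable_tempk_shift.
- by move=> t _; rewrite EFinM lee_wpmul2r ?lee_fin ?tempk_ge0// le_tconv_abs.
Qed.

Lemma tconv_ae0 a h y : measurable_fun setT h -> {ae mu, forall s, h s = 0} ->
  tconv a h y = 0.
Proof.
move=> mh h0; rewrite /tconv /Rintegral (ae_eq_integral (cst 0%E))//.
- by rewrite integral0.
- by apply/measurable_EFinP; exact: measurable_tconv_integrand.
- by apply: (lebesgue_aeS _ h0) => s -> _; rewrite mul0r.
Qed.

End TemperedConvolution.

Section L2Dominated.
Context d (T : measurableType d) (R : realType).
Variable mu : {measure set T -> \bar R}.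

Lemma L2dist_dominated (f_ : nat -> T -> R) (f g : T -> R) :
  (forall n, f_ n \in Lfun mu 2%:E) -> f \in Lfun mu 2%:E -> g \in Lfun mu 2%:E ->
  (forall x, f_ n x @[n --> \oo] --> f x) -> (forall n x, `|f_ n x| <= `|g x|) ->
  L2dist mu (f_ n) f @[n --> \oo] --> 0.
Proof.
move=> fL fL0 gL ff fg.
have fg0 x : `|f x| <= `|g x|.
  have h : `|f_ n x| @[n --> \oo] --> `|f x| by apply: cvg_norm; exact: ff.
  by apply: (cvgr_to_le h); near=> n; exact: fg.
have mdiff n : measurable_fun setT (fun x => ((f_ n x - f x) ^+ 2)%:E).
  by apply/measurable_EFinP; apply: measurable_funX; exact: Lfun2_measurable (Lfun2_sub (fL n) fL0).
have ig : mu.-integrable setT (fun x => 4%:E * (g x * g x)%:E)%E.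
  by apply: integrableZl => //; exact: Lfun2_mul.
have cv : {ae mu, forall x, setT x -> ((f_ n x - f x) ^+ 2)%:E @[n --> \oo] --> (0 : \bar R)%E}.
  apply/aeW => x _; apply: cvg_EFin; first by near=> n.
  rewrite -[fine \o _]/(fun n => (f_ n x - f x) ^+ 2).
  have : (f_ n x - f x) * (f_ n x - f x) @[n --> \oo] --> ((f x - f x) * (f x - f x)).
    by apply: cvgM; apply: cvgB => //; exact: cvg_cst.
  by rewrite subrr mul0r.
have dom : {ae mu, forall x n, setT x ->
    (`|((f_ n x - f x) ^+ 2)%:E| <= 4%:E * (g x * g x)%:E)%E}.
  (* Both |f_n| and its limit |f| are at most |g|, so the squared difference is dominated by 4
     g^2. *)
  apply/aeW => x n _; rewrite -EFinM /= lee_fin ger0_norm ?sqr_ge0//.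
  have := fg n x; have := fg0 x; rewrite !ler_norml.
  move=> /andP[h1 h2] /andP[h3 h4]; rewrite -expr2 -[g x ^+ 2]real_normK ?num_real//.
  by have := normr_ge0 (g x); nra.
have [_ _] := dominated_convergence measurableT mdiff (measurable_cst _) cv ig dom.
rewrite integral0 => /fine_cvg; rewrite /L2dist /L2dot /Rintegral/=.
by under eq_fun do under eq_integral do rewrite expr2.
Unshelve. all: by end_near. Qed.

End L2Dominated.

(** * T_a on L^2: boundedness, injectivity, and the witness for strictness *)

Section TemperedConvolutionL2.
Context {R : realType} (lambda : R).
Hypothesis lambda0 : 0 < lambda.
Local Notation mu := (@lebesgue_measure R).
Local Notation k := (tempk lambda).
Local Notation kint := (tempkint lambda).
Local Notation c_ := (tempc lambda).
Local Notation tconv := (tconv lambda).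
Local Notation tconv_abs := (tconv_abs lambda).
Local Notation tconv_dom := (tconv_dom lambda).
Implicit Types (a b : R) (h f g : R -> R).

(** Cauchy-Schwarz with the kernel split evenly, h k = (h sqrt k) (sqrt k); the second factor has
    squared norm c_a. *)
Lemma tconv_sqr_le a h y : 0 < a -> measurable_fun setT h ->
  (tconv_abs a (fun s : R => (h s ^+ 2)%R) y < +oo)%E ->
  ((tconv a h y ^+ 2)%:E <= (c_ a)%:E * tconv_abs a (fun s : R => (h s ^+ 2)%R) y)%E.
Proof.
move=> a0 mh hy.
have mk := measurable_tempk_shift lambda a y.
pose v (s : R) := Num.sqrt (k a (s - y)).
pose u (s : R) := h s * v s.
have vv s : v s ^+ 2 = k a (s - y) by rewrite sqr_sqrtr// tempk_ge0.
have mv : measurable_fun setT v.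
  apply: (measurableT_comp _ mk).
  by apply: continuous_measurable_fun; exact: sqrt_continuous.
have vL : v \in Lfun mu 2%:E.
  apply/Lfun2P; split => //; under eq_integral do rewrite vv.
  by rewrite integral_tempk_shift// tempkint_lty.
have uE : (\int[mu]_s (u s ^+ 2)%:E = tconv_abs a (fun s : R => (h s ^+ 2)%R) y)%E.
  apply: eq_integral => s _; rewrite /u exprMn vv ger0_norm// sqr_ge0//.
have uL : u \in Lfun mu 2%:E.
  by apply/Lfun2P; split; [exact: measurable_funM|rewrite uE].
have uv : L2dot mu u v = tconv a h y.
  by apply: eq_Rintegral => s _; rewrite /u -mulrA -expr2 vv.
have := L2dot_CauchySchwarz uL vL; rewrite uv -lee_fin (EFinM (L2dot mu u u)) (L2dotE uL) (L2dotE vL) uE.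
under [X in (_ <= _ * X)%E]eq_integral do rewrite vv.
by rewrite integral_tempk_shift (tempcE lambda0 a0) muleC.
Qed.

(** Young's inequality: integrating [tconv_sqr_le] over y produces a second factor c_a. *)
Lemma tconv_L2_bound a h : 0 < a -> h \in Lfun mu 2%:E ->
  (\int[mu]_y (tconv a h y ^+ 2)%:E <= (c_ a ^+ 2 * L2dot mu h h)%:E)%E.
Proof.
move=> a0 hL; have mh := Lfun2_measurable hL.
have mh2 : measurable_fun setT (fun s : R => h s ^+ 2) by exact: measurable_funX.
have mah2 : measurable_fun setT (tconv_abs a (fun s : R => h s ^+ 2)).
  exact: measurable_tconv_abs.
have [_ h2D] : tconv_dom (fun s : R => h s ^+ 2).
  by apply: tconv_dom_L1 => //; exact: Lfun2_integrable_sqr.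
have ca0 : (0 <= (c_ a)%:E)%E by rewrite lee_fin ltW// (tempc_gt0 lambda0).
apply: (@le_trans _ _ (\int[mu]_y ((c_ a)%:E * tconv_abs a (fun s : R => (h s ^+ 2)%R) y))%E).
  apply: ae_ge0_le_integral => //.
  - by move=> y _; rewrite lee_fin sqr_ge0.
  - apply/measurable_EFinP; apply: measurable_funX; exact: measurable_tconv.
  - by move=> y _; rewrite mule_ge0// tconv_abs_ge0.
  - by apply: emeasurable_funM.
  - by apply: (lebesgue_aeS _ (h2D a a0)) => y hy _; exact: tconv_sqr_le.
rewrite ge0_integralZl//; last by move=> y _; exact: tconv_abs_ge0.
rewrite integral_tconv_abs// (tempcE lambda0 a0).
have -> : (\int[mu]_s `|h s ^+ 2|%:E = (L2dot mu h h)%:E)%E.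
  by rewrite L2dotE//; apply: eq_integral => s _; rewrite ger0_norm// sqr_ge0.
rewrite -!EFinM lee_fin. by lra.
Qed.

Lemma tconv_L2 a h : 0 < a -> h \in Lfun mu 2%:E -> tconv a h \in Lfun mu 2%:E.
Proof.
move=> a0 hL; apply/Lfun2P; split.
  exact: measurable_tconv (Lfun2_measurable hL).
by apply: le_lt_trans (tconv_L2_bound a0 hL) _; rewrite ltry.
Qed.

Lemma tconv_comb_ae a (c : R) f g : 0 < a -> tconv_dom f -> tconv_dom g ->
  {ae mu, forall y, tconv a (fun s => c * f s + g s) y = c * tconv a f y + tconv a g y}.
Proof.
move=> a0 [mf fD] [mg gD]; apply: (lebesgue_aeS2 _ (fD a a0) (gD a a0)) => y fy gy.
exact: tconv_comb.
Qed.

Lemma tconv_L2dist a f g : 0 < a -> f \in Lfun mu 2%:E -> g \in Lfun mu 2%:E ->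
  L2dist mu (tconv a f) (tconv a g) <= c_ a ^+ 2 * L2dist mu f g.
Proof.
move=> a0 fL gL; have fgL := Lfun2_sub fL gL.
have Tf := tconv_L2 a0 fL; have Tg := tconv_L2 a0 gL; have Tfg := tconv_L2 a0 fgL.
rewrite -lee_fin; apply: le_trans (tconv_L2_bound a0 fgL); rewrite -L2dotE// lee_fin.
rewrite le_eqVlt; apply/orP; left; apply/eqP.
have aeE : {ae mu, forall y, tconv a f y - tconv a g y = tconv a (fun s => f s - g s) y}.
  have := tconv_comb_ae (-1) a0 (tconv_dom_L2 lambda0 gL) (tconv_dom_L2 lambda0 fL).
  apply: lebesgue_aeS => y e.
  have -> : (fun s => f s - g s) = (fun s => -1 * g s + f s).
    by apply/funext => s; ring.
  by rewrite e; ring.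
by apply: L2dot_ae => //; exact: Lfun2_sub.
Qed.

Lemma tempk1E (u : R) : 0 < u -> k 1 u = expR (- lambda * u).
Proof. by move=> u0; rewrite /tempk u0 subrr powRr0 mul1r. Qed.

(** With phi(s) = h(s) e^(-lambda s), T_1 h(y) = 0 says that phi has zero integral over ]y, +oo[. As
    phi is only known to be integrable to the right of points where T_1 h converges, one argues on
    ]a, +oo[ for such a and then lets a tend to -oo. *)
Lemma tconv1_inj h : tconv_dom h -> {ae mu, forall y, tconv 1 h y = 0} ->
  {ae mu, forall y, h y = 0}.
Proof.
move=> [mh hD] h0.
pose phi (s : R) := h s * expR (- lambda * s).
have mphi : measurable_fun setT phi.
  by apply: measurable_funM => //; exact: measurable_expRM.
pose G (y : R) := (tconv_abs 1 h y < +oo)%E /\ tconv 1 h y = 0.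
have aeG : {ae mu, forall y, G y}.
  by apply: (lebesgue_aeS2 _ (hD 1 ltr01) h0) => y h1 h2; split.
have phiE y s : (phi \_ `]y, +oo[) s = expR (- lambda * y) * (h s * k 1 (s - y)).
  rewrite patchE mem_setE in_itv/= andbT; case: ltP => ys.
    rewrite tempk1E ?subr_gt0// /phi mulrCA -expRD; congr (_ * expR _); ring.
  by rewrite tempk_le0 ?mulr0// subr_le0.
have Gint y : G y -> mu.-integrable setT (EFin \o phi \_ `]y, +oo[).
  move=> [/(tconv_integrable mh) iy _].
  have := integrableZl measurableT (expR (- lambda * y)) iy.
  by apply: eq_integrable => // s _; rewrite /= phiE EFinM.
have G0 y : G y -> \int[mu]_s (phi \_ `]y, +oo[) s = 0.
  move=> [/(tconv_integrable mh) iy y0].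
  under eq_Rintegral do rewrite phiE.
  by rewrite RintegralZl// -/(tconv 1 h y) y0 mulr0.
(* The primitive F of the restricted phi vanishes at every x > a in G, as the integrals over ]a,
   +oo[ and ]x, +oo[ are both 0; Lebesgue differentiation gives F' = phi almost everywhere. *)
have step a : G a -> {ae mu, forall x, a < x -> h x = 0}.
  move=> Ga; pose psi := phi \_ `]a, +oo[.
  have ipsi : mu.-integrable setT (EFin \o psi) by exact: Gint.
  have := @FTC1Ny R psi _ (open_integrable_locally openT ipsi).
  have ipsiS (D : set R) : measurable D -> mu.-integrable D (EFin \o psi).
    by move=> mD; apply: integrableS ipsi.
  move=> /(_ (fun y => ipsiS _ (measurable_itv _))).
  set F := fun x : R => _.
  have F0 x : G x -> a < x -> F x = 0.
    move=> Gx ax.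
    have := @Rintegral_itvB R psi -oo%O +oo%O x.
    rewrite set_itvNyy => /(_ ipsi isT isT).
    rewrite (G0 _ Ga) sub0r => /eqP; rewrite eqr_oppLR => /eqP FE; rewrite /F FE.
    rewrite Rintegral_mkcond -[RHS]oppr0 -(G0 _ Gx); congr (- _).
    apply: eq_Rintegral => s _; rewrite /psi !patchE; case: ifPn => // xs.
    rewrite mem_set//=; move: xs; rewrite inE/= !in_itv/= !andbT.
    exact: lt_trans.
  move=> aeF; apply: (lebesgue_aeS2 _ aeF aeG) => x [dF dFE] Gx ax.
  have cF : h^-1 *: (F (h *: 1 + x) - F x) @[h --> 0^'] --> psi x.
    by rewrite -dFE derive1E; exact: dF.
  have psi0 : psi x = 0.
    (* F is known to vanish only almost everywhere, so the quotient is evaluated at a good z close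
       to x: it is 0 there, at distance |psi x| from psi x, although it should be strictly
       closer. *)
    apply: contrapT => /eqP psi0.
    have npsi : 0 < `|psi x| by rewrite normr_gt0.
    move/cvgrPdist_lt : cF => /(_ _ npsi) [e /= e0 he].
    have xe : x < x + e by rewrite ltrDl.
    have [z [xz ze Gz]] := ae_exists_between aeG xe.
    have := he (z - x); rewrite /ball_/= sub0r normrN gtr0_norm ?subr_gt0// => /(_ _ _).
    rewrite /GRing.scale/= mulr1 subrK (F0 z Gz (lt_trans ax xz)) (F0 x Gx ax).
    rewrite subrr mulr0 subr0 ltxx => H; have : false by apply: H; [lra|rewrite gt_eqF// subr_gt0].
    by [].
  move: psi0; rewrite /psi patchE mem_set/= ?in_itv/= ?andbT//.
  by move=> /eqP; rewrite mulf_eq0 expR_eq0 orbF => /eqP.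
have aP n : exists a, G a /\ a < - n%:R.
  have [z [_ zn Gz]] := @ae_exists_between R _ (- n%:R - 1) (- n%:R) aeG ltac:(lra).
  by exists z.
pose a_ n := projT1 (cid (aP n)).
have aG n : G (a_ n) by rewrite /a_; case: cid => z [].
have a_lt n : a_ n < - n%:R by rewrite /a_; case: cid => z [].
have /lebesgue_aeS : {ae mu, forall x, forall n, a_ n < x -> h x = 0}.
  by apply: ae_foralln => n; exact: step.
apply => x hx; apply: (hx (Num.trunc `|x|).+1).
apply: lt_trans (a_lt _) _; rewrite ltrNl.
apply: (@le_lt_trans _ _ `|x|); first by rewrite -normrN ler_norm.
exact: truncnS_gt.
Qed.

(** T_(m+2) is a multiple of T_1 T_(m+1): injectivity of T_1 removes one unit, and T_(m+1) h is
    again in the domain. *)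
Lemma tconv_nat_inj m h : tconv_dom h -> {ae mu, forall y, tconv m.+1%:R h y = 0} ->
  {ae mu, forall y, h y = 0}.
Proof.
elim: m h => [|m IH] h hD h0; first exact: tconv1_inj.
have m0 : 0 < m.+1%:R :> R by rewrite ltr0n.
apply: (IH _ hD); apply: tconv1_inj; first exact: tconv_dom_tconv.
have [mh /(_ m.+2%:R)] := hD; rewrite ltr0n => /(_ isT) hy.
have mE : m.+2%:R = 1 + m.+1%:R :> R by rewrite -natr1 addrC.
apply: (lebesgue_aeS2 _ h0 hy) => y; rewrite mE => y0 hy'.
by rewrite (tconv_semigroup lambda0 ltr01 m0)// y0 mulr0.
Qed.

(** Applying T_(m+1-a), with m the integer part of a, to T_a h = 0 gives T_(m+1) h = 0. *)
Lemma tconv_inj a h : 0 < a -> tconv_dom h -> {ae mu, forall y, tconv a h y = 0} ->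
  {ae mu, forall y, h y = 0}.
Proof.
move=> a0 hD h0; pose m := Num.trunc a.
have am : 0 < m.+1%:R - a by rewrite subr_gt0; exact: truncnS_gt.
apply: (@tconv_nat_inj m _ hD).
have [mh /(_ m.+1%:R)] := hD; rewrite ltr0n => /(_ isT).
apply: lebesgue_aeS => y hy.
have mE : m.+1%:R - a + a = m.+1%:R by rewrite subrK.
have /= := tconv_semigroup lambda0 am a0 (y := y) mh.
rewrite mE => /(_ hy); rewrite tconv_ae0//; last exact: measurable_tconv.
move=> /esym/eqP; rewrite mulf_eq0 gt_eqF/= => [/eqP//|].
exact: tempbeta_gt0.
Qed.

(* The exponent 1/2 is where integrability near 0 survives but
   square-integrability fails. *)
Section StrictnessWitness.
Variable d : R.
Hypothesis d0 : 0 < d.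

Definition halfk (y : R) : R := k 2^-1 (- y).

Let half0 : 0 < 2^-1 :> R. Proof. by rewrite invr_gt0. Qed.

Lemma measurable_halfk : measurable_fun setT halfk.
Proof. exact: (measurableT_comp (measurable_tempk lambda _) (@oppr_measurable R setT)). Qed.

Lemma halfk_integrable : mu.-integrable setT (EFin \o halfk).
Proof.
apply: ge0_integrable_EFin; first exact: measurable_halfk.
  by move=> y; exact: tempk_ge0.
have -> : (\int[mu]_y (halfk y)%:E = kint 2^-1)%E.
  rewrite -(integral_tempk_reflect lambda 2^-1 0).
  by apply: eq_integral => y _; rewrite /halfk sub0r.
exact: tempkint_lty.
Qed.

Lemma halfk_dom : tconv_dom halfk.
Proof. by apply: tconv_dom_L1 => //; exact: halfk_integrable. Qed.

Lemma tconv_halfk_int y : (\int[mu]_s (halfk s * k d (s - y))%:E =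
  (tempbeta lambda d 2^-1 * k (d + 2^-1) (- y))%:E)%E.
Proof.
have := tempk_conv_shift lambda0 d0 half0 0 y; rewrite sub0r => <-.
by apply: eq_integral => s _; rewrite sub0r.
Qed.

(** The semigroup law for the reflected kernel: T_d raises the exponent 1/2 to d + 1/2. *)
Lemma tconv_halfk y : tconv d halfk y = tempbeta lambda d 2^-1 * k (d + 2^-1) (- y).
Proof. by rewrite /tconv /Rintegral tconv_halfk_int. Qed.

(** The square of k_(d+1/2) has power 2 (d - 1/2) = 2 d - 1, so it is at most k_(2d), which is
    integrable because d > 0. *)
Lemma tconv_halfk_L2 : tconv d halfk \in Lfun mu 2%:E.
Proof.
have -> : tconv d halfk = (fun y => tempbeta lambda d 2^-1 * k (d + 2^-1) (- y)).
  by apply/funext => y; exact: tconv_halfk.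
apply: Lfun2_mulr; apply/Lfun2P; split.
  exact: (measurableT_comp (measurable_tempk lambda _) (@oppr_measurable R setT)).
apply: (@le_lt_trans _ _ (\int[mu]_y (k (2 * d) (0 - y))%:E)%E); last first.
  by rewrite integral_tempk_reflect; apply: tempkint_lty => //; rewrite mulr_gt0.
apply: ge0_le_integral => //.
- by move=> y _; rewrite lee_fin sqr_ge0.
- apply/measurable_EFinP; apply: measurable_funX.
  exact: (measurableT_comp (measurable_tempk lambda _) (@oppr_measurable R setT)).
- apply/measurable_EFinP; exact: measurable_tempk_reflect.
- move=> y _; rewrite lee_fin sub0r /tempk; case: ifPn => [y0|_]; last by rewrite expr0n.
  rewrite exprMn -powR_mulrn ?powR_ge0// -powRrM.
  have -> : (d + 2^-1 - 1) * 2%:R = 2 * d - 1 by field.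
  rewrite ler_wpM2l ?powR_ge0// -expRM_natr ler_expR.
  by have := mulr_gt0 lambda0 y0; lra.
Qed.

(** The square of k_(1/2) is e^(-2 lambda u) / u, at least e^(-2 lambda) / u on ]0, 1], and the
    integral of 1/u over ]e, 1] is - ln e, unbounded as e tends to 0. *)
Lemma halfk_notin_L2 : halfk \notin Lfun mu 2%:E.
Proof.
apply/negP => /Lfun2P[_ hlty].
have : (\int[mu]_u (k 2^-1 u ^+ 2)%:E < +oo)%E.
  rewrite (ge0_integral_reflect 0); last 2 first.
  - by apply/measurable_EFinP; apply: measurable_funX; exact: measurable_tempk.
  - by move=> u; rewrite lee_fin sqr_ge0.
  by under eq_integral do rewrite sub0r.
set I := (\int[mu]_u _)%E => Ilty.
have I0 : (0 <= I)%E by apply: integral_ge0 => u _; rewrite lee_fin sqr_ge0.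
have lnle (e : R) : 0 < e -> e <= 1 -> ((- ln e)%:E <= (expR (2 * lambda))%:E * I)%E.
  move=> e0 e1.
  have := @ge0_FTC_oc R (fun x => x `^ (-1)) (@ln R) e 1 e1 (measurable_powR _).
  have -> : ln 1 - ln e = - ln e by rewrite ln1 sub0r.
  have H1 (x : R) : e < x -> 0 <= x `^ (-1) by rewrite powR_ge0.
  have H2 (x : R) : e < x -> {for x, continuous (fun x : R => x `^ (-1))}.
    move=> ex; apply/differentiable_continuous/derivable1_diffP.
    by apply: derivable_powR; rewrite in_itv/= (lt_trans e0).
  have H3 (x : R) : e < x -> is_derive x 1 (@ln R) (x `^ (-1)).
    move=> ex; have x0 := lt_trans e0 ex.
    by rewrite powR_inv1 ?(ltW x0)//; exact: is_derive1_ln.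
  have H4 : @ln R x @[x --> e^'+] --> ln e.
    by apply: cvg_at_right_filter; exact: continuous_ln.
  move=> /(_ H1 H2 H3 H4) <-.
  rewrite integral_mkcond /I -ge0_integralZl//; last 2 first.
  - by apply/measurable_EFinP; apply: measurable_funX; exact: measurable_tempk.
  - by move=> u _; rewrite lee_fin sqr_ge0.
  apply: ge0_le_integral => //.
  - move=> x _; rewrite patchE; case: ifPn => //; rewrite inE/= in_itv/= => /andP[ex _].
    by rewrite lee_fin H1.
  - apply/measurable_restrict => //; apply: measurable_funTS; exact/measurable_EFinP.
  - apply/measurable_EFinP; apply: measurable_funM => //.
    by apply: measurable_funX; exact: measurable_tempk.
  - move=> x _; rewrite patchE; case: ifPn => [|_]; last first.
      by rewrite -EFinM lee_fin mulr_ge0 ?expR_ge0 ?sqr_ge0.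
    rewrite inE/= in_itv/= => /andP[ex x1]; have x0 := lt_trans e0 ex.
    rewrite -EFinM lee_fin /tempk x0 exprMn -powR_mulrn ?powR_ge0// -powRrM.
    have -> : (2^-1 - 1) * 2%:R = -1 :> R by field.
    rewrite mulrCA -expRM_natr -expRD.
    rewrite ler_peMr ?powR_ge0// -[leLHS]expR0 ler_expR.
    by have := ler_wpM2l (ltW lambda0) x1; lra.
have Ifin : I = (fine I)%:E by rewrite fineK// ge0_fin_numE.
(* One more than the would-be bound on - ln e; the choice e = exp(- N) then contradicts it. *)
pose N := expR (2 * lambda) * fine I + 1.
have N0 : 0 <= N by rewrite addr_ge0// mulr_ge0 ?expR_ge0// fine_ge0.
have := lnle (expR (- N)) (expR_gt0 _).
rewrite -{1}expR0 ler_expR oppr_le0 N0 => /(_ isT).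
rewrite expRK opprK Ifin -EFinM lee_fin /N; lra.
Qed.

Definition halfk_trunc (n : nat) (y : R) : R :=
  if y < - n.+1%:R^-1 then halfk y else 0.

Lemma halfk_trunc_ge0 n y : 0 <= halfk_trunc n y <= halfk y.
Proof. by rewrite /halfk_trunc; case: ifP; rewrite ?lexx tempk_ge0. Qed.

Lemma measurable_halfk_trunc n : measurable_fun setT (halfk_trunc n).
Proof.
by apply: measurable_fun_ifT => //; [exact: measurable_fun_ltr|exact: measurable_halfk].
Qed.

(** Away from the singularity, [halfk] is at most (n+1)^(1/2) <= n + 1, so its square is at most n +
    1 times the integrable [halfk]. *)
Lemma halfk_trunc_L2 n : halfk_trunc n \in Lfun mu 2%:E.
Proof.
apply/Lfun2P; split; first exact: measurable_halfk_trunc.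
apply: (@le_lt_trans _ _ (\int[mu]_y (n.+1%:R * halfk y)%:E)%E); last first.
  exact: integrable_lty (integrableZl measurableT n.+1%:R halfk_integrable).
apply: ge0_le_integral => //.
- by move=> y _; rewrite lee_fin sqr_ge0.
- by apply/measurable_EFinP; apply: measurable_funX; exact: measurable_halfk_trunc.
- by apply/measurable_EFinP; apply: measurable_funM => //; exact: measurable_halfk.
- move=> y _; rewrite lee_fin expr2 /halfk_trunc; case: ifPn => [yn|_]; last first.
    by rewrite mul0r mulr_ge0// tempk_ge0.
  rewrite ler_wpM2r ?tempk_ge0// /halfk /tempk; case: ifPn => // y0.
  have n1 : 0 < n.+1%:R^-1 :> R by rewrite invr_gt0.
  apply: (@le_trans _ _ ((- y) `^ (2^-1 - 1))).
    rewrite ler_piMr ?powR_ge0// -[leRHS]expR0 ler_expR mulNr oppr_le0.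
    exact: mulr_ge0 (ltW lambda0) (ltW y0).
  have -> : 2^-1 - 1 = - 2^-1 :> R by field.
  rewrite powRN invf_ple ?posrE ?powR_gt0//.
  have ny : n.+1%:R^-1 <= - y by rewrite lerNr ltW.
  apply: (@le_trans _ _ (n.+1%:R^-1 `^ 2^-1)); last by rewrite ge0_ler_powR ?nnegrE ?invr_ge0// ltW.
  by rewrite ger1_powR// ?n1/= ?invf_le1// ?ler1n ?invf_le1 ?ler1n.
Qed.

Lemma halfk_trunc_cvg y : halfk_trunc n y @[n --> \oo] --> halfk y.
Proof.
have [y0|y0] := leP 0 y.
  have e n : halfk_trunc n y = halfk y.
    rewrite /halfk_trunc ltNge (le_trans _ y0) ?oppr_le0//=.
    by rewrite /halfk tempk_le0// oppr_le0.
  under eq_fun do rewrite e; exact: cvg_cst.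
have yn : \forall n \near \oo, (n.+1%:R^-1 : R) < - y.
  have := @cvg_harmonic R; move/cvgrPdist_lt => /(_ (- y)); rewrite oppr_gt0 => /(_ y0).
  by apply: filterS => n; rewrite sub0r normrN /harmonic/= ger0_norm.
apply: cvg_near_cst; apply: filterS yn => n yn.
by rewrite /halfk_trunc ltrNr yn.
Qed.

Lemma tconv_halfk_trunc_cvg y :
  tconv d (halfk_trunc n) y @[n --> \oo] --> tconv d halfk y.
Proof.
have mk := measurable_tempk_shift lambda d y.
have ik0 : mu.-integrable setT (EFin \o (fun s => halfk s * k d (s - y))).
  apply: ge0_integrable_EFin.
  - by apply: measurable_funM => //; exact: measurable_halfk.
  - by move=> s; rewrite mulr_ge0 ?tempk_ge0.
  - by rewrite tconv_halfk_int ltry.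
have ik : mu.-integrable setT (fun s => (halfk s * k d (s - y))%:E) by exact: ik0.
have m_ n : measurable_fun setT (fun s => (halfk_trunc n s * k d (s - y))%:E).
  by apply/measurable_EFinP; apply: measurable_funM => //; exact: measurable_halfk_trunc.
have cv : {ae mu, forall s, setT s -> (halfk_trunc n s * k d (s - y))%:E @[n --> \oo]
    --> (halfk s * k d (s - y))%:E}.
  apply/aeW => s _; apply: cvg_EFin; first by near=> n.
  rewrite -[fine \o _]/(fun n => halfk_trunc n s * k d (s - y)).
  by apply: cvgMl; exact: halfk_trunc_cvg.
have dom : {ae mu, forall s n, setT s ->
    (`|(halfk_trunc n s * k d (s - y))%:E| <= (halfk s * k d (s - y))%:E)%E}.
  apply/aeW => s n _; have /andP[h1 h2] := halfk_trunc_ge0 n s.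
  by rewrite /= lee_fin ger0_norm ?mulr_ge0 ?tempk_ge0// ler_wpM2r ?tempk_ge0.
have [_ _] := @dominated_convergence _ _ R mu setT measurableT _ _ _ m_ (measurable_int _ ik) cv ik dom.
rewrite tconv_halfk_int => /fine_cvg h; rewrite tconv_halfk; exact: h.
Unshelve. all: by end_near. Qed.

(** The truncations do not converge in L^2, but their transforms do: the kernel is nonnegative, so
    all of them are dominated by T_d halfk, which is in L^2. *)
Lemma tconv_halfk_trunc_L2dist :
  L2dist mu (tconv d (halfk_trunc n)) (tconv d halfk) @[n --> \oo] --> 0.
Proof.
apply: (@L2dist_dominated _ _ R mu (fun n => tconv d (halfk_trunc n)) _ (tconv d halfk)).
- by move=> n; apply: tconv_L2 => //; exact: halfk_trunc_L2.
- exact: tconv_halfk_L2.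
- exact: tconv_halfk_L2.
- exact: tconv_halfk_trunc_cvg.
- move=> n y.
  have hle : tconv d (halfk_trunc n) y <= tconv d halfk y.
    apply: le_Rintegral => //.
    + apply: tconv_integrable; first exact: measurable_halfk_trunc.
      apply: (@le_lt_trans _ _ (\int[mu]_s (halfk s * k d (s - y))%:E)%E).
        apply: ge0_le_integral => //.
        * by move=> s _; rewrite lee_fin mulr_ge0// tempk_ge0.
        * apply/measurable_EFinP; apply: measurable_tconv_integrand.
          by apply: measurableT_comp => //; exact: measurable_halfk_trunc.
        * by apply/measurable_EFinP; apply: measurable_tconv_integrand; exact: measurable_halfk.
        * move=> s _; have /andP[h1 h2] := halfk_trunc_ge0 n s.
          by rewrite lee_fin ger0_norm// ler_wpM2r// tempk_ge0.
      by rewrite tconv_halfk_int ltry.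
    + apply: ge0_integrable_EFin.
      * by apply: measurable_tconv_integrand; exact: measurable_halfk.
      * by move=> s; rewrite mulr_ge0 ?tempk_ge0.
      * by rewrite tconv_halfk_int ltry.
    + move=> s _; have /andP[h1 h2] := halfk_trunc_ge0 n s.
      by rewrite ler_wpM2r// tempk_ge0.
  have h0 : 0 <= tconv d (halfk_trunc n) y.
    apply: Rintegral_ge0 => s _; have /andP[h1 h2] := halfk_trunc_ge0 n s.
    by rewrite mulr_ge0// tempk_ge0.
  by rewrite !ger0_norm// (le_trans h0).
Qed.

End StrictnessWitness.

End TemperedConvolutionL2.

(** * Density of step functions *)

Section StepFunctionsDense.
Context {R : realType}.
Local Notation mu := (@lebesgue_measure R).
Implicit Types (f g : R -> R) (phi psi : step_fun R).

Lemma indic_itv_L2 (a b : R) : \1_(`[a, b[%classic) \in Lfun mu 2%:E.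
Proof.
apply/Lfun2P; split; first exact: measurable_indic.
have -> : (\int[mu]_x (\1_(`[a, b[%classic) x ^+ 2)%:E =
    \int[mu]_x (EFin \o \1_(`[a, b[%classic)) x)%E.
  by apply: eq_integral => x _; rewrite /= indicE; case: (_ \in _); rewrite ?expr1n ?expr0n.
have ii := @integrable_indic_itv R a b true true.
exact: (integrable_lty measurableT ii).
Qed.

Lemma step_eval_L2 phi : step_eval phi \in Lfun mu 2%:E.
Proof.
apply: (@Lfun2_sum _ _ R mu _ (fun i x => step_coef phi i *
  \1_(`[step_knot phi i, step_knot phi i.+1[%classic) x)) => i.
apply: Lfun2_mulr; exact: indic_itv_L2.
Qed.

Section Grid.
Variables (g : R -> R) (N m : nat).

Let M : R := m.+1%:R.
Let M0 : 0 < M. Proof. by rewrite ltr0n. Qed.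
Let knot (i : nat) : R := - N%:R + i%:R / M.

Let knot_le i : knot i <= knot i.+1.
Proof. by rewrite lerD2l ler_pM2r ?invr_gt0// ler_nat. Qed.

(** Cells of width 1/(m+1) filling [-N, N[, each carrying the value of g at its left end;
    [grid_point] is the left end of the cell of x. *)
Definition grid_step : step_fun R :=
  @StepFun R (2 * N * m.+1)%N (fun i => g (knot i)) knot (fun i _ => knot_le i).

Definition grid_point (x : R) : R := - N%:R + (Num.trunc ((x + N%:R) * m.+1%:R))%:R / m.+1%:R.

Lemma step_eval_grid x : step_eval grid_step x =
  if (- N%:R <= x) && (x < N%:R) then g (grid_point x) else 0.
Proof.
have memE i : x \in `[knot i, knot i.+1[%classic =
    ((i%:R <= (x + N%:R) * M) && ((x + N%:R) * M < i.+1%:R)).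
  rewrite mem_setE in_itv/= /knot.
  by rewrite -lerBrDl opprK ler_pdivrMr// -ltrBlDl opprK ltr_pdivlMr.
rewrite /step_eval /=; under eq_bigr do rewrite indicE memE.
have [Nx|xN] := leP (- N%:R) x; last first.
  rewrite big1// => i _; have -> : (i%:R <= (x + N%:R) * M) = false.
    apply/negbTE; rewrite -ltNge (@lt_le_trans _ _ 0)//.
    by rewrite pmulr_llt0//; lra.
  by rewrite mulr0.
have xN0 : 0 <= (x + N%:R) * M by apply: mulr_ge0; [lra|exact: ltW].
under eq_bigr do rewrite -truncn_eq//.
set t := Num.trunc _.
have tlt : (t < 2 * N * m.+1)%N = (x < N%:R).
  rewrite truncn_lt_nat// natrM ltr_pM2r// natrM; apply/idP/idP => ?; lra.
case: ifPn => /= xN.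
  rewrite -tlt in xN.
  rewrite (bigD1 (Ordinal xN))//= eqxx mulr1 big1 ?addr0// => i it.
  by case: eqP => [ti|]; [move: it; rewrite -val_eqE/= -ti eqxx|rewrite mulr0].
rewrite big1// => i _; case: eqP => [ti|]; last by rewrite mulr0.
by move: xN; rewrite -tlt ti ltn_ord.
Qed.

Lemma grid_point_dist x : - N%:R <= x -> `|grid_point x - x| <= m.+1%:R^-1.
Proof.
move=> Nx; have xN0 : 0 <= (x + N%:R) * M by apply: mulr_ge0; [lra|exact: ltW].
have /andP[h1 h2] := truncn_itv xN0.
rewrite /grid_point -/M; set t := Num.trunc _ in h1 h2 *.
have -> : - N%:R + t%:R / M - x = - (((x + N%:R) * M - t%:R) / M).
  by field; rewrite gt_eqF.
rewrite normrN normrM normfV (gtr0_norm M0) ger0_norm ?subr_ge0//.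
rewrite ler_piMl ?invr_ge0 ?(ltW M0)//.
by move: h2; rewrite -natr1; lra.
Qed.

End Grid.

(** Truncation to [-K, K]. It turns L^1 approximation into L^2 approximation: for two values bounded
    by K, the squared difference is at most 2 K times the difference. *)
Definition clamp (K x : R) : R := if x < - K then - K else if K < x then K else x.

Lemma clamp_lip (K x y : R) : 0 <= K -> `|clamp K x - clamp K y| <= `|x - y|.
Proof.
move=> K0; rewrite /clamp; case: (ltP x (- K)) => ?; case: (ltP y (- K)) => ?;
  case: (ltP K x) => ?; case: (ltP K y) => ?;
  rewrite ler_norml; case: (ler0P (x - y)) => ?; apply/andP; split; lra.
Qed.

Lemma clamp_id (K x : R) : `|x| <= K -> clamp K x = x.
Proof.
rewrite ler_norml /clamp => /andP[h1 h2].
by rewrite ltNge h1/= ltNge h2.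
Qed.

Lemma norm_clamp (K x : R) : 0 <= K -> `|clamp K x| <= K.
Proof.
move=> K0; rewrite /clamp; case: (ltP x (- K)) => ?; case: (ltP K x) => ?;
 rewrite ler_norml; apply/andP; split; lra.
Qed.

Let window (N : nat) (f : R -> R) (x : R) : R :=
  if (- N%:R <= x) && (x < N%:R) then f x else 0.

Let windowE N f : window N f = (fun x => \1_(`[- N%:R, N%:R[%classic) x * f x).
Proof.
apply/funext => x; rewrite /window indicE mem_setE in_itv/=.
by case: ifP => _; rewrite ?mul1r ?mul0r.
Qed.

Let measurable_window N f : measurable_fun setT f -> measurable_fun setT (window N f).
Proof. by move=> mf; rewrite windowE; exact: measurable_funM. Qed.

Let window_L2 N (K : R) f : measurable_fun setT f -> (forall x, `|f x| <= K) ->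
  window N f \in Lfun mu 2%:E.
Proof.
move=> mf fK; apply: (@Lfun2_le _ _ R mu _ (fun x => K * \1_(`[- N%:R, N%:R[%classic) x)).
- exact: measurable_window.
- by apply: Lfun2_mulr; exact: indic_itv_L2.
- move=> x; rewrite windowE [X in _ <= X]normrM normrM mulrC ler_wpM2r//.
  by rewrite (le_trans (fK x))// ler_norm.
Qed.

Let grid_cvg g (N : nat) (K : R) : 0 <= K -> continuous g ->
  L2dist mu (step_eval (grid_step (clamp K \o g) N m)) (window N (clamp K \o g))
    @[m --> \oo] --> 0.
Proof.
move=> K0 cg.
have mg : measurable_fun setT (clamp K \o g).
  apply: continuous_measurable_fun => x; apply/cvgrPdist_le => e e0.
  have := cg x; move/cvgrPdist_le => /(_ e e0); apply: filterS => y.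
  by apply: le_trans; exact: clamp_lip.
apply: (@L2dist_dominated _ _ R mu _ _ (window N (fun=> K))).
- by move=> m; exact: step_eval_L2.
- by apply: (@window_L2 _ K) => // x; exact: norm_clamp.
- by apply: (@window_L2 _ K) => // x; rewrite ger0_norm.
- move=> x; under eq_fun do rewrite step_eval_grid.
  rewrite /window; case: ifPn => [/andP[Nx _]|_]; last exact: cvg_cst.
  have tx : grid_point N m x @[m --> \oo] --> x.
    apply/cvgrPdist_le => e e0; have := @cvg_harmonic R.
    move/cvgrPdist_le => /(_ e e0); apply: filterS => m.
    rewrite sub0r normrN /harmonic/= ger0_norm// distrC.
    exact: le_trans (grid_point_dist m Nx).
  have gtx : g (grid_point N m x) @[m --> \oo] --> g x.
    exact: (cvg_comp _ _ tx (cg x)).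
  apply/cvgrPdist_le => e e0; move/cvgrPdist_le : gtx => /(_ e e0).
  by apply: filterS => m; apply: le_trans; exact: clamp_lip.
- move=> m x; rewrite step_eval_grid /window; case: ifP => // _.
  by rewrite (ger0_norm K0); exact: norm_clamp.
Qed.

(** Four functions in a chain: f, its truncation f_N in height and support, a clamped continuous
    function h close to f_N in L^1, and a grid sampling of h. Two uses of the triangle inequality
    turn errors e/16 into at most 2 (2 + 2) e/16 + 2 e/16 < e. *)
Lemma step_fun_dense f (e : R) : f \in Lfun mu 2%:E -> 0 < e ->
  exists phi, L2dist mu (step_eval phi) f < e.
Proof.
move=> fL e0; have mf := Lfun2_measurable fL.
pose f_ n x := if `|f x| <= n%:R then window n f x else 0.
have mf_ n : measurable_fun setT (f_ n).
  apply: measurable_fun_ifT => //; last exact: measurable_window.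
  by apply: measurable_fun_ler => //; exact: measurableT_comp.
have f_f n x : `|f_ n x| <= `|f x|.
  by rewrite /f_ /window; case: ifP => _; [case: ifP => _|]; rewrite ?normr0.
have f_L n : f_ n \in Lfun mu 2%:E by exact: (@Lfun2_le _ _ R mu _ f (mf_ n) fL (f_f n)).
have f_cvg x : f_ n x @[n --> \oo] --> f x.
  have lt_trunc (z : R) (n : nat) : ((Num.trunc z).+1 <= n)%N -> z < n%:R.
    by move=> zn; apply: lt_le_trans (truncnS_gt z) _; rewrite ler_nat.
  apply: cvg_near_cst; exists (maxn (Num.trunc `|f x|).+1 (Num.trunc `|x|).+1) => // n /=.
  rewrite geq_max => /andP[/lt_trunc fn /lt_trunc]; rewrite ltr_norml => /andP[xn1 xn2].
  by rewrite /f_ (ltW fn) /window (ltW xn1) xn2.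
have : L2dist mu (f_ n) f @[n --> \oo] --> 0.
  exact: (@L2dist_dominated _ _ R mu _ _ f).
have e80 : 0 < e / 16 by rewrite divr_gt0.
move/cvgrPdist_lt => /(_ _ e80)[N _ /(_ N (leqnn N))].
rewrite sub0r normrN ger0_norm ?L2dist_ge0// => fNe.
pose K : R := N%:R.
have K0 : 0 <= K by [].
have fNK x : `|f_ N x| <= K.
  rewrite /f_ /window; case: ifP => [fx|_]; last by rewrite normr0.
  by case: ifP => _ //; rewrite normr0.
pose E : set R := `[- N%:R, N%:R]%classic.
have mE : measurable E by exact: measurable_itv.
have Efin : (mu E < +oo)%E by rewrite lebesgue_measure_itv/=; case: ifP => _; rewrite ?ltry// -EFinB ltry.
have bfN : [bounded f_ N x | x in E].
  exists K; split; first exact: num_real.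
  by move=> y Ky x _ /=; rewrite (le_trans (fNK x))// ltW.
have mfE : measurable_fun E (f_ N) by exact: measurable_funTS (mf_ N).
have iE : mu.-integrable E (EFin \o f_ N).
  exact: (@measurable_bounded_integrable _ _ R mu _ _ mE Efin mfE bfN).
have [g_ [cg_ ig_ g_cvg]] := approximation_continuous_integrable mE Efin iE.
(* The L^1 error is later multiplied by 2 K; the extra 1 keeps the denominator positive when K =
   0. *)
have del0 : 0 < e / 16 / (2 * K + 1) by rewrite divr_gt0//; lra.
have [n gn] : exists n, (\int[mu]_(z in E) `|(f_ N z - g_ n z)%:E| < (e / 16 / (2 * K + 1))%:E)%E.
  move/fine_cvgP : g_cvg => [gfin /cvgrPdist_lt /(_ _ del0) glt].
  have [n _ /(_ n (leqnn n)) [h1 h2]] := filterI gfin glt.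
  exists n; rewrite -(fineK h1) lte_fin.
  by move: h2; rewrite sub0r normrN; apply: le_lt_trans; exact: ler_norm.
pose g := g_ n; pose h := window N (clamp K \o g).
have mcg : measurable_fun setT (clamp K \o g).
  apply: continuous_measurable_fun => x; apply/cvgrPdist_le => r r0.
  have := cg_ n x; move/cvgrPdist_le => /(_ r r0); apply: filterS => y.
  by apply: le_trans; exact: clamp_lip.
have hL : h \in Lfun mu 2%:E.
  by apply: (@window_L2 _ K) => // x; exact: norm_clamp.
have hf : L2dist mu h (f_ N) <= e / 16.
  have dL := Lfun2_sub hL (f_L N).
  rewrite -lee_fin /L2dist L2dotE//.
  have mi1 : measurable_fun E (fun z : R => `|(f_ N z - g z)%:E|%E).
    apply: measurableT_comp => //; apply/measurable_EFinP.
    by apply: measurable_funB => //; apply: measurable_funTS; exact: continuous_measurable_fun (cg_ n).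
  have mr1 : measurable_fun setT ((fun z : R => `|(f_ N z - g z)%:E|%E) \_ E).
    exact/(measurable_restrictT _ mE).
  apply: (@le_trans _ _ (\int[mu]_x ((2 * K)%:E * ((fun z => `|(f_ N z - g z)%:E|%E) \_ E) x))%E).
    apply: ge0_le_integral => //.
    - by move=> x _; rewrite lee_fin sqr_ge0.
    - by apply/measurable_EFinP; apply: measurable_funX; exact: Lfun2_measurable dL.
    - exact: emeasurable_funM.
    - move=> x _; rewrite patchE /h /window; case: ifPn => [/andP[h1 h2]|nx].
        rewrite mem_set ?/E/= ?in_itv/= ?h1 ?(ltW h2)// -EFinM lee_fin.
        have := clamp_lip (g x) (f_ N x) K0; rewrite (clamp_id (fNK x)) => lip.
        rewrite distrC; rewrite -real_normK ?num_real// expr2 ler_pM//.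
        rewrite (le_trans (ler_normB _ _))//; have := norm_clamp (g x) K0; have := fNK x.
        by rewrite /=; lra.
      have -> : f_ N x = 0 by rewrite /f_ /window (negbTE nx); case: ifP.
      by rewrite subrr expr0n; case: ifP => _; rewrite ?mule0// -EFinM lee_fin mulr_ge0// mulr_ge0.
  rewrite ge0_integralZl//; last 2 first.
  - by move=> x _; rewrite patchE; case: ifP.
  - by rewrite lee_fin mulr_ge0.
  rewrite -integral_mkcond.
  apply: (@le_trans _ _ ((2 * K)%:E * (e / 16 / (2 * K + 1))%:E)%E).
    by rewrite lee_wpmul2l ?lee_fin ?mulr_ge0// ltW.
  rewrite -EFinM lee_fin mulrCA ler_piMr ?(ltW e80)// ler_pdivrMr; lra.
have := grid_cvg N K0 (cg_ n); move/cvgrPdist_lt => /(_ _ e80)[m _ /(_ m (leqnn m))].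
rewrite sub0r normrN ger0_norm ?L2dist_ge0// => hm.
exists (grid_step (clamp K \o g) N m).
have sL := step_eval_L2 (grid_step (clamp K \o g) N m).
have t1 := L2dist_triangle sL (f_L N) fL.
have t2 := L2dist_triangle sL hL (f_L N).
move: hm hf t1 t2; rewrite -/h; lra.
Qed.

End StepFunctionsDense.

(** * Wiener integral *)

Section FatouRieszFischer.
Context d (T : measurableType d) (R : realType).
Variable mu : {measure set T -> \bar R}.

Lemma L2dot_mulr2 (a b : R) (f g : T -> R) : f \in Lfun mu 2%:E -> g \in Lfun mu 2%:E ->
  L2dot mu (fun x => a * f x) (fun x => b * g x) = a * b * L2dot mu f g.
Proof.
move=> fL gL; rewrite L2dot_mulr//; last exact: Lfun2_mulr.
by rewrite L2dotC L2dot_mulr// L2dotC mulrA.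
Qed.

Lemma fatou_ae (f_ : nat -> T -> R) (f : T -> R) (C : R) :
  (forall n, measurable_fun setT (f_ n)) -> measurable_fun setT f ->
  (forall n x, 0 <= f_ n x) -> (forall x, 0 <= f x) ->
  {ae mu, forall x, f_ n x @[n --> \oo] --> f x} ->
  (forall n, (\int[mu]_x (f_ n x)%:E <= C%:E)%E) ->
  (\int[mu]_x (f x)%:E <= C%:E)%E.
Proof.
move=> mf_ mf f_0 f0 cvf intC.
pose F n (x : T) : \bar R := (f_ n x)%:E.
have mF n : measurable_fun setT (F n) by exact/measurable_EFinP.
have F0 n x : setT x -> (0 <= F n x)%E by rewrite lee_fin.
have minf : measurable_fun setT (fun x => limn_einf (F^~ x)).
  by rewrite /limn_einf; apply: measurableT_comp => //;
     apply: measurable_fun_limn_esup => n; apply: measurableT_comp.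
have inf0 x : setT x -> (0 <= limn_einf (F^~ x))%E.
  move=> _; rewrite limn_einf_lim; apply: lime_ge; first exact: is_cvg_einfs.
  near=> n; apply: le_ereal_inf_tmp => _ [k _ <-]; exact: F0.
rewrite (@ge0_ae_eq_integral _ _ _ mu setT _ (fun x => limn_einf (F^~ x)))//; last 3 first.
- exact/measurable_EFinP.
- by move=> x _; rewrite lee_fin.
- apply: filterS cvf => x fx _.
  have Fx : F n x @[n --> \oo] --> (f x)%:E by apply: cvg_EFin => //; near=> n.
  rewrite is_cvg_limn_einfE; last by apply/cvg_ex; exists (f x)%:E.
  by apply/esym/cvg_lim.
apply: (le_trans (fatou mu measurableT mF F0)).
rewrite limn_einf_lim; apply: lime_le; first exact: is_cvg_einfs.
near=> n; apply: (@le_trans _ _ (\int[mu]_x F n x)%E); last exact: intC.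
by apply: ereal_inf_lbound; exists n => //=.
Unshelve. all: by end_near. Qed.

End FatouRieszFischer.

(** * Completeness of L^2 over a probability space *)

Section RieszFischer.
Context d (T : measurableType d) (R : realType) (P : probability T R).

Lemma prob_cst_L2 (c : R) : (fun=> c) \in Lfun P 2%:E.
Proof.
apply/Lfun2P; split => //; rewrite integral_cst// [X in (_ * X)%E](_ : _ = 1%E) ?mule1; last exact: probability_setT.
exact: ltry.
Qed.

Lemma prob_L1_le (X : T -> R) (e : R) : X \in Lfun P 2%:E -> 0 <= e ->
  L2dot P X X <= e ^+ 2 -> (\int[P]_w `|X w|%:E <= e%:E)%E.
Proof.
move=> XL e0 Xe; have mX := Lfun2_measurable XL.
have aXL : (fun w => `|X w|) \in Lfun P 2%:E.
  by apply: (Lfun2_le _ XL) => [|w]; [exact: measurableT_comp|rewrite normr_id].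
have := L2dot_CauchySchwarz aXL (prob_cst_L2 1).
have -> : L2dot P (fun=> 1) (fun=> 1) = 1.
  rewrite /L2dot Rintegral_cst// mulr1 mul1r [X in fine X](_ : _ = 1%E)//.
  exact: probability_setT.
have -> : L2dot P (fun w => `|X w|) (fun w => `|X w|) = L2dot P X X.
  by apply: eq_Rintegral => w _; rewrite -normrM -expr2 ger0_norm// sqr_ge0.
rewrite mulr1 => h; have : L2dot P (fun w => `|X w|) (fun=> 1) <= e.
  rewrite -(ler_pXn2r (n := 2))// ?nnegrE//; first exact: le_trans h Xe.
  by apply: Rintegral_ge0 => w _; rewrite mulr1.
rewrite /L2dot; under eq_Rintegral do rewrite mulr1.
have i1 : P.-integrable setT (fun w => (`|X w| * 1)%:E) by exact: Lfun2_mul aXL (prob_cst_L2 1).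
have i2 : P.-integrable setT (fun w => `|X w|%:E).
  by apply: eq_integrable i1 => // w _; rewrite mulr1.
by rewrite /Rintegral -lee_fin fineK//; exact: (integrable_fin_num measurableT i2).
Qed.

(** Consecutive terms are 2^-(n+1) apart in L^2, hence in L^1, so the increments are summable almost
    surely and the sequence converges almost surely; Fatou carries the distance bounds to the
    limit. *)
Lemma L2_rapid_complete (X : nat -> T -> R) :
  (forall n, X n \in Lfun P 2%:E) ->
  (forall n m, (n <= m)%N -> L2dist P (X n) (X m) <= ((2 ^ n.+1)%:R^-1) ^+ 2) ->
  exists2 Y, Y \in Lfun P 2%:E & L2dist P (X n) Y @[n --> \oo] --> 0.
Proof.
move=> XL Xc; have mX n := Lfun2_measurable (XL n).
pose D n w := `|X n.+1 w - X n w|.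
have mD n : measurable_fun setT (D n) by apply: measurableT_comp => //; exact: measurable_funB.
have intD n : (\int[P]_w (D n w)%:E <= (1 / (2 ^ n.+1)%:R)%:E)%E.
  apply: (@prob_L1_le (fun w => X n.+1 w - X n w)).
  - exact: Lfun2_sub.
  - by rewrite div1r invr_ge0.
  - by rewrite div1r -/(L2dist P (X n.+1) (X n)) L2distC; exact: Xc.
have sumD0 w : (0 <= \sum_(n <oo) (D n w)%:E)%E.
  by apply: nneseries_ge0 => n _ _; rewrite lee_fin normr_ge0.
have sumD : (\int[P]_w (\sum_(n <oo) (D n w)%:E) < +oo)%E.
  rewrite integral_nneseries//; last 2 first.
  - by move=> n; apply/measurable_EFinP.
  - by move=> n w _; rewrite lee_fin normr_ge0.
  apply: (@le_lt_trans _ _ (1%:E)%E); last by rewrite ltry.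
  apply: le_trans (@epsilon_trick0 R 1 xpredT ler01).
  apply: lee_nneseries => n _ //.
  by move=> _; apply: integral_ge0 => w _; rewrite lee_fin normr_ge0.
have aeD : {ae P, forall w, (\sum_(n <oo) (D n w)%:E < +oo)%E}.
  have : P.-integrable setT (fun w => \sum_(n <oo) (D n w)%:E)%E.
    apply/integrableP; split.
      apply: ge0_emeasurable_sum; first by move=> n w _ _; rewrite lee_fin normr_ge0.
      by move=> n _; apply/measurable_EFinP; exact: mD.
    rewrite (eq_integral (fun w => \sum_(n <oo) (D n w)%:E)%E)// => w _.
    by rewrite gee0_abs// sumD0.
  move=> /(integrable_ae measurableT); apply: filterS => w /(_ I).
  by rewrite ge0_fin_numE.
have aecv : {ae P, forall w, cvgn (fun n => X n w)}.
  apply: filterS aeD => w Dw.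
  have : cvgn (series (telescope (fun n => X n w))).
    apply: normed_cvg; apply: nnseries_is_cvg => [i|]; first exact: normr_ge0.
    exact: Dw.
  rewrite telescopeK => cv.
  have -> : (fun n => X n w) = (fun n => (X n w - X 0%N w) + X 0%N w).
    by apply/funext => n; rewrite subrK.
  by apply: is_cvgD => //; exact: is_cvg_cst.
(* The upper limit is measurable on the whole space and equals the limit wherever the sequence
   converges. *)
pose Y w := fine (limn_esup (fun n => (X n w)%:E)).
have mY : measurable_fun setT Y.
  apply: measurableT_comp; first exact: fine_measurable.
  by apply: measurable_fun_limn_esup => n; exact/measurable_EFinP.
have aeY : {ae P, forall w, X n w @[n --> \oo] --> Y w}.
  apply: filterS aecv => w /cvg_ex[l Xl].
  have Xl' : (X n w)%:E @[n --> \oo] --> l%:E by apply: cvg_EFin => //; near=> n.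
  rewrite /Y is_cvg_limn_esupE; last by apply/cvg_ex; exists l%:E.
  by rewrite (cvg_lim _ Xl').
have bound n : (\int[P]_w ((X n w - Y w) ^+ 2)%:E <= (((2 ^ n.+1)%:R^-1) ^+ 2)%:E)%E.
  apply: (@fatou_ae _ _ _ P (fun m w => (X n w - X (m + n)%N w) ^+ 2)).
  - by move=> m; apply: measurable_funX; exact: measurable_funB.
  - by apply: measurable_funX; exact: measurable_funB.
  - by move=> m w; exact: sqr_ge0.
  - by move=> w; exact: sqr_ge0.
  - apply: filterS aeY => w Xw.
    have Xw' : X (m + n)%N w @[m --> \oo] --> Y w by rewrite (cvg_shiftn n (fun m => X m w)).
    have h : X n w - X (m + n)%N w @[m --> \oo] --> X n w - Y w.
      by apply: cvgB => //; exact: cvg_cst.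
    by rewrite expr2; under eq_fun do rewrite expr2; exact: cvgM.
  - move=> m; rewrite -(L2dotE (Lfun2_sub (XL n) (XL _))) lee_fin.
    by apply: Xc; exact: leq_addl.
have YL : Y \in Lfun P 2%:E.
  have dL : (fun w => X 0%N w - Y w) \in Lfun P 2%:E.
    apply/Lfun2P; split; first exact: measurable_funB.
    by apply: (le_lt_trans (bound 0%N)); rewrite ltry.
  have -> : Y = (fun w => X 0%N w - (X 0%N w - Y w)) by apply/funext => w; ring.
  exact: Lfun2_sub.
exists Y => //.
have b0 : ((2 ^ n.+1)%:R^-1 : R) @[n --> \oo] --> 0.
  apply: (@squeeze_cvgr _ _ _ _ (fun=> 0) (@harmonic R)); [|exact: cvg_cst|exact: cvg_harmonic].
  near=> n; rewrite invr_ge0 ler0n/= /harmonic/= lef_pV2 ?posrE ?ltr0n ?expn_gt0//.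
  by rewrite ler_nat ltnW// ltn_expl.
have b20 : ((2 ^ n.+1)%:R^-1 : R) ^+ 2 @[n --> \oo] --> 0.
  rewrite -[X in _ --> X](mul0r (0 : R)); under eq_fun do rewrite expr2.
  exact: cvgM.
apply: squeeze_cvgr (cvg_cst 0) b20; near=> n.
rewrite L2dist_ge0/= -lee_fin; apply: le_trans (bound n).
by rewrite /L2dist L2dotE//; exact: Lfun2_sub.
Unshelve. all: by end_near. Qed.

End RieszFischer.

(** * The Wiener integral of a process with squared increments M |t - s| *)

Section WienerIsometry.
Context (R : realType) (disp : measure_display) (Omega : measurableType disp).
Variables (P : probability Omega R) (L : R -> Omega -> R) (M : R).
Local Notation mu := (@lebesgue_measure R).
Hypothesis M0 : 0 < M.
Hypothesis LL : forall t, L t \in Lfun P 2%:E.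
Hypothesis Ldist : forall s t, L2dist P (L s) (L t) = M * `|t - s|.
Implicit Types (phi psi : step_fun R) (f g : R -> R).

Let incr_L2 a b : (fun w => L b w - L a w) \in Lfun P 2%:E.
Proof. exact: Lfun2_sub. Qed.

(** Polarisation: the squared norms of L at the four times cancel, leaving a combination of the four
    distances. [indic_dot] gives the same combination as the length of an intersection of
    intervals. *)
Let incr_dot a b c e : L2dot P (fun w => L b w - L a w) (fun w => L e w - L c w) =
  M * ((`|e - a| + `|b - c| - `|b - e| - `|a - c|) / 2).
Proof.
have E x y : L2dot P (L x) (L y) = (L2dot P (L x) (L x) + L2dot P (L y) (L y) - M * `|y - x|) / 2.
  by rewrite -Ldist L2distE//; field.
have D x y (Z : Omega -> R) : Z \in Lfun P 2%:E ->
    L2dot P (fun w => L y w - L x w) Z = L2dot P (L y) Z - L2dot P (L x) Z.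
  move=> ZL; rewrite (_ : (fun w => _) = (fun w => -1 * L x w + L y w)); last first.
    by apply/funext => w; ring.
  by rewrite L2dot_combl//; ring.
rewrite D// ![L2dot P _ (fun w => L e w - L c w)]L2dotC !D//.
rewrite ![L2dot P (L e) (L _)]L2dotC ![L2dot P (L c) (L _)]L2dotC.
rewrite (E b e) (E b c) (E a e) (E a c) (distrC e b) (distrC c b) (distrC c a).
by field.
Qed.

Let indic_dot a b c e : a <= b -> c <= e ->
  L2dot mu (\1_(`[a, b[%classic)) (\1_(`[c, e[%classic)) =
  (`|e - a| + `|b - c| - `|b - e| - `|a - c|) / 2.
Proof.
move=> ab ce.
have -> : L2dot mu (\1_(`[a, b[%classic)) (\1_(`[c, e[%classic)) =
    fine (mu `[Num.max a c, Num.min b e[%classic).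
  congr fine; rewrite -[in RHS](setIT `[Num.max a c, Num.min b e[%classic).
  rewrite -integral_indic//; apply: eq_integral => x _; congr EFin; rewrite !indicE !mem_setE !in_itv/=.
  rewrite ge_max lt_min; case: (a <= x); case: (c <= x); case: (x < b); case: (x < e) => /=;
    by rewrite ?mulr0 ?mul0r ?mulr1.
have [bc|cb] := leP b c.
  have h : Num.min b e <= Num.max a c by rewrite le_max !ge_min bc ?orbT.
  rewrite set_itv_ge ?measure0; last by rewrite bnd_simp -leNgt.
  rewrite (ger0_norm (_ : 0 <= e - a)) ?(ler0_norm (_ : b - c <= 0))
    ?(ler0_norm (_ : b - e <= 0)) ?(ler0_norm (_ : a - c <= 0)) /=; lra.
have [ea|ae] := leP e a.
  have h : Num.min b e <= Num.max a c by rewrite le_max !ge_min ea ?orbT.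
  rewrite set_itv_ge ?measure0; last by rewrite bnd_simp -leNgt.
  rewrite (ler0_norm (_ : e - a <= 0)) ?(ger0_norm (_ : 0 <= b - c))
    ?(ger0_norm (_ : 0 <= b - e)) ?(ger0_norm (_ : 0 <= a - c)) /=; lra.
rewrite (gtr0_norm (_ : 0 < e - a)) ?(gtr0_norm (_ : 0 < b - c)) ?subr_gt0//.
rewrite lebesgue_measure_itv/= lte_fin maxr_absE minr_absE.
have := maxr_absE a c; have := minr_absE b e => be ac.
case: ifPn => [_|]; first by rewrite -EFinB /=; lra.
have : Num.max a c <= Num.min b e.
  by rewrite ge_max !le_min ab ce (ltW cb) (ltW ae).
by rewrite be ac -leNgt /=; lra.
Qed.

Lemma step_integral_L2 phi : step_integral L phi \in Lfun P 2%:E.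
Proof.
apply: (@Lfun2_sum _ _ R P _ (fun i w => step_coef phi i *
  (L (step_knot phi i.+1) w - L (step_knot phi i) w))) => i.
by apply: Lfun2_mulr; exact: Lfun2_sub.
Qed.

Lemma step_integral_dot phi psi :
  L2dot P (step_integral L phi) (step_integral L psi) =
  M * L2dot mu (step_eval phi) (step_eval psi).
Proof.
pose F (chi : step_fun R) (i : nat) w := step_coef chi i *
  (L (step_knot chi i.+1) w - L (step_knot chi i) w).
pose G (chi : step_fun R) (i : nat) x := step_coef chi i *
  \1_(`[step_knot chi i, step_knot chi i.+1[%classic) x.
have FL chi i : F chi i \in Lfun P 2%:E by apply: Lfun2_mulr; exact: Lfun2_sub.
have GL chi i : G chi i \in Lfun mu 2%:E by apply: Lfun2_mulr; exact: indic_itv_L2.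
transitivity (\sum_(i < step_size phi) \sum_(j < step_size psi) L2dot P (F phi i) (F psi j)).
  rewrite (@L2dot_suml _ _ R P _ (fun i => F phi i))//; last exact: step_integral_L2.
  apply: eq_bigr => i _; rewrite L2dotC (@L2dot_suml _ _ R P _ (fun j => F psi j))//.
  by apply: eq_bigr => j _; rewrite L2dotC.
transitivity (M * \sum_(i < step_size phi) \sum_(j < step_size psi) L2dot mu (G phi i) (G psi j)).
  rewrite mulr_sumr; apply: eq_bigr => i _; rewrite mulr_sumr; apply: eq_bigr => j _.
  rewrite (@L2dot_mulr2 _ _ R P) ?(@L2dot_mulr2 _ _ R mu)//; try exact: indic_itv_L2.
  rewrite incr_dot indic_dot; try exact: step_knot_le.
  ring.
congr (_ * _); rewrite (@L2dot_suml _ _ R mu _ (fun i => G phi i))//; last exact: step_eval_L2.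
apply: eq_bigr => i _; rewrite [RHS]L2dotC (@L2dot_suml _ _ R mu _ (fun j => G psi j))//.
by apply: eq_bigr => j _; rewrite L2dotC.
Qed.

Lemma step_integral_dist phi psi :
  L2dist P (step_integral L phi) (step_integral L psi) =
  M * L2dist mu (step_eval phi) (step_eval psi).
Proof.
rewrite !L2distE; first by rewrite !step_integral_dot; ring.
all: try exact: step_integral_L2; exact: step_eval_L2.
Qed.

Lemma is_wiener_integralP f X : is_wiener_integral P L f X <->
  [/\ f \in Lfun mu 2%:E, X \in Lfun P 2%:E & exists f_ : nat -> step_fun R,
    L2dist mu (step_eval (f_ n)) f @[n --> \oo] --> 0 /\
    L2dist P (step_integral L (f_ n)) X @[n --> \oo] --> 0].
Proof.
split=> -[fL XL [f_ [cf cX]]]; split => //; exists f_; split.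
- by apply/cvg_Lnorm2P => // n; exact: step_eval_L2.
- by apply/cvg_Lnorm2P => // n; exact: step_integral_L2.
- by apply/cvg_Lnorm2P => // n; exact: step_eval_L2.
- by apply/cvg_Lnorm2P => // n; exact: step_integral_L2.
Qed.

(** Limit of the step identity. The approximating sequences of f and g are arbitrary, so the result
    holds for every version of the integral, whichever one is chosen later. *)
Lemma is_wiener_integral_dot f g X Y : is_wiener_integral P L f X ->
  is_wiener_integral P L g Y -> L2dot P X Y = M * L2dot mu f g.
Proof.
move=> /is_wiener_integralP[fL XL [f_ [cf cX]]] /is_wiener_integralP[gL YL [g_ [cg cY]]].
have sL phi := step_integral_L2 phi; have eL phi := step_eval_L2 phi.
have h1 := L2dot_cvg (fun n => sL (f_ n)) (fun n => sL (g_ n)) XL YL cX cY.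
have h2 := L2dot_cvg (fun n => eL (f_ n)) (fun n => eL (g_ n)) fL gL cf cg.
have h3 : L2dot P (step_integral L (f_ n)) (step_integral L (g_ n)) @[n --> \oo] -->
    M * L2dot mu f g.
  under eq_fun do rewrite step_integral_dot.
  by apply: cvgM => //; exact: cvg_cst.
exact: (cvg_unique (@Rhausdorff R) h1 h3).
Qed.

Lemma is_wiener_integral_exists f : f \in Lfun mu 2%:E ->
  exists X, is_wiener_integral P L f X.
Proof.
move=> fL.
(* Calibrated for [L2_rapid_complete]: two steps within e_n and e_m of f are within 4 e_n of each
   other for n <= m, and M times this is the square of 2^-(n+1). *)
pose e n : R := ((2 ^ n.+1)%:R^-1) ^+ 2 / (4 * M).
have e0 n : 0 < e n by rewrite divr_gt0 ?mulr_gt0// exprn_gt0// invr_gt0 ltr0n expn_gt0.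
pose f_ n := projT1 (cid (step_fun_dense fL (e0 n))).
have fE n : L2dist mu (step_eval (f_ n)) f < e n by rewrite /f_; case: cid.
have e_mono n m : (n <= m)%N -> e m <= e n.
  move=> nm; rewrite ler_pM2r ?invr_gt0 ?mulr_gt0// lerXn2r ?nnegrE ?invr_ge0//.
  by rewrite lef_pV2 ?posrE ?ltr0n ?expn_gt0// ler_nat leq_exp2l.
have sL n := step_integral_L2 (f_ n).
have [n m nm|X XL cX] := @L2_rapid_complete _ _ R P (fun n => step_integral L (f_ n)) sL.
  rewrite step_integral_dist.
  have := L2dist_triangle (step_eval_L2 (f_ n)) fL (step_eval_L2 (f_ m)).
  rewrite [L2dist mu f _]L2distC => h.
  have h2 : L2dist mu (step_eval (f_ n)) (step_eval (f_ m)) <= 4 * e n.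
    by have := fE n; have := fE m; have := e_mono n m nm; move: h; lra.
  apply: (@le_trans _ _ (M * (4 * e n))); first by rewrite ler_pM2l.
  rewrite /e; move: (_ ^+ 2) => p.
  by rewrite le_eqVlt; apply/orP; left; apply/eqP; field; rewrite gt_eqF.
exists X; apply/is_wiener_integralP; split => //; exists f_; split => //.
have e_cvg : e n @[n --> \oo] --> 0.
  rewrite /e -[X in _ --> X](mul0r (4 * M)^-1); apply: cvgMl.
  have b0 : ((2 ^ n.+1)%:R^-1 : R) @[n --> \oo] --> 0.
    apply: (@squeeze_cvgr _ _ _ _ (fun=> 0) (@harmonic R)); [|exact: cvg_cst|exact: cvg_harmonic].
    near=> n; rewrite invr_ge0 ler0n/= /harmonic/= lef_pV2 ?posrE ?ltr0n ?expn_gt0//.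
    by rewrite ler_nat ltnW// ltn_expl.
  rewrite -[X in _ --> X](mul0r (0 : R)); under eq_fun do rewrite expr2.
  exact: cvgM.
apply: squeeze_cvgr (cvg_cst 0) e_cvg; near=> n.
by rewrite L2dist_ge0/= ltW.
Unshelve. all: by end_near. Qed.

Local Notation W := (wiener_integral P L).

Lemma wiener_integralP f : f \in Lfun mu 2%:E -> is_wiener_integral P L f (W f).
Proof. by move=> /is_wiener_integral_exists[X hX]; apply: xgetPex; exists X. Qed.

Lemma wiener_integral_L2 f : f \in Lfun mu 2%:E -> W f \in Lfun P 2%:E.
Proof. by move=> /wiener_integralP[]. Qed.

Lemma wiener_integral_dot f g : f \in Lfun mu 2%:E -> g \in Lfun mu 2%:E ->
  L2dot P (W f) (W g) = M * L2dot mu f g.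
Proof. by move=> fL gL; apply: is_wiener_integral_dot; exact: wiener_integralP. Qed.

Lemma wiener_integral_dist f g : f \in Lfun mu 2%:E -> g \in Lfun mu 2%:E ->
  L2dist P (W f) (W g) = M * L2dist mu f g.
Proof.
move=> fL gL; have WfL := wiener_integral_L2 fL; have WgL := wiener_integral_L2 gL.
by rewrite !L2distE// !wiener_integral_dot//; ring.
Qed.

Lemma wiener_integral_ae f g : f \in Lfun mu 2%:E -> g \in Lfun mu 2%:E ->
  {ae mu, forall x, f x = g x} -> {ae P, forall w, W f w = W g w}.
Proof.
move=> fL gL fg; apply: L2dist_eq0; [exact: wiener_integral_L2..|].
rewrite wiener_integral_dist// (L2dist_ae fL gL gL gL)//; last exact/aeW.
rewrite /L2dist /L2dot; under eq_Rintegral do rewrite subrr mul0r.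
by rewrite /Rintegral integral0 mulr0.
Qed.

Lemma wiener_integral_ae_inj f g : f \in Lfun mu 2%:E -> g \in Lfun mu 2%:E ->
  {ae P, forall w, W f w = W g w} -> {ae mu, forall x, f x = g x}.
Proof.
move=> fL gL fg; apply: L2dist_eq0 => //.
have WfL := wiener_integral_L2 fL; have WgL := wiener_integral_L2 gL.
have := wiener_integral_dist fL gL.
rewrite (L2dist_ae WfL WgL WgL WgL)//; last exact/aeW.
rewrite {1}/L2dist /L2dot; under eq_Rintegral do rewrite subrr mul0r.
rewrite /Rintegral integral0 => /esym/eqP; rewrite mulf_eq0 gt_eqF//= => /eqP.
by [].
Qed.

(** Versions are chosen separately for each integrand, so linearity holds only almost surely: the
    squared distance of the two sides expands, by the isometry, to M times an expression that
    cancels. *)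
Lemma wiener_integral_comb (a : R) f g : f \in Lfun mu 2%:E -> g \in Lfun mu 2%:E ->
  {ae P, forall w, W (fun x => a * f x + g x) w = a * W f w + W g w}.
Proof.
move=> fL gL; have hL := Lfun2_comb a fL gL.
have WfL := wiener_integral_L2 fL; have WgL := wiener_integral_L2 gL.
have WhL := wiener_integral_L2 hL.
apply: L2dist_eq0 => //; first exact: Lfun2_comb.
have cL := Lfun2_comb a WfL WgL.
rewrite L2distE// L2dot_combr// L2dot_combl// !L2dot_combr// !wiener_integral_dot//.
rewrite !L2dot_combl// !L2dot_combr// [L2dot mu g f]L2dotC; ring.
Qed.

End WienerIsometry.

(** * Second moments from characteristic functions *)

Section TrigBounds.
Context {R : realType}.
Implicit Types x u : R.

Lemma norm_sin_le u : `|sin u| <= `|u|.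
Proof.
wlog u0 : u / 0 <= u => [H|].
  have [/H//|/ltW u0] := leP 0 u.
  by have := H (- u); rewrite oppr_ge0 sinN !normrN; exact.
have [|c _] := @MVT_segment R sin cos 0 u u0 (fun x _ => is_derive_sin x).
  by apply: continuous_subspaceT; exact: continuous_sin.
by rewrite sin0 !subr0 => ->; rewrite normrM ler_piMl// cos_max.
Qed.

Lemma one_sub_cosE u : 1 - cos u = 2 * sin (u / 2) ^+ 2.
Proof.
have {1}-> : u = (u / 2) *+ 2 by rewrite -mulr_natr; field.
by rewrite cos_mulr2n cos2sin2; ring.
Qed.

Lemma one_sub_cos_ge0 u : 0 <= 1 - cos u.
Proof. by rewrite subr_ge0 cos_le1. Qed.

Lemma one_sub_cos_le u : 1 - cos u <= u ^+ 2 / 2.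
Proof.
rewrite one_sub_cosE -real_normK ?num_real//.
have -> : u ^+ 2 / 2 = 2 * `|u / 2| ^+ 2 by rewrite real_normK ?num_real//; field.
by rewrite ler_pM2l// lerXn2r ?nnegrE//; exact: norm_sin_le.
Qed.

Lemma one_sub_cos_le_norm u : 1 - cos u <= `|u|.
Proof.
rewrite one_sub_cosE -real_normK ?num_real// expr2.
have h1 := norm_sin_le (u / 2); have h2 := sin_max (u / 2).
have : `|u / 2| = `|u| / 2 by rewrite normrM normfV (ger0_norm (ler0n R 2)).
have := normr_ge0 (sin (u / 2)); nra.
Qed.

Lemma norm_sin_sub_le u : `|sin u - u| <= u ^+ 2.
Proof.
wlog u0 : u / 0 <= u => [H|].
  have [/H//|/ltW u0] := leP 0 u.
  have := H (- u); rewrite oppr_ge0 sinN sqrrN -opprD normrN; exact.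
have [|c cu] := @MVT_segment R sin cos 0 u u0 (fun x _ => is_derive_sin x).
  by apply: continuous_subspaceT; exact: continuous_sin.
rewrite sin0 !subr0 => ->; move: cu; rewrite in_itv/= => /andP[c0 cu].
have := one_sub_cos_le_norm c; have := one_sub_cos_ge0 c; rewrite (ger0_norm c0) => h1 h2.
have -> : cos c * u - u = - ((1 - cos c) * u) by ring.
by rewrite normrN ger0_norm ?mulr_ge0// expr2 ler_wpM2r// (le_trans h2).
Qed.

(** A concrete sequence of arguments tending to 0, at which the characteristic function is expanded;
    a sequence is what dominated convergence and Fatou take. *)
Definition theta (n : nat) : R := n.+1%:R^-1.

Lemma theta_gt0 n : 0 < theta n. Proof. by rewrite invr_gt0 ltr0n. Qed.

Lemma theta_cvg : theta n @[n --> \oo] --> 0.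
Proof. exact: cvg_harmonic. Qed.

Lemma theta_le1 n : theta n <= 1.
Proof. by rewrite invf_le1// ler1n. Qed.

Lemma sin_theta_cvg x : sin (theta n * x) / theta n @[n --> \oo] --> x.
Proof.
apply/cvgrPdist_le => e e0.
have : theta n * x ^+ 2 @[n --> \oo] --> 0.
  by rewrite -[X in _ --> X](mul0r (x ^+ 2)); apply: cvgMl; exact: theta_cvg.
move/cvgrPdist_le => /(_ e e0); apply: filterS => n; have t0 := theta_gt0 n.
rewrite sub0r normrN ger0_norm; last by rewrite mulr_ge0 ?sqr_ge0// ltW.
move=> h; apply: le_trans h.
have -> : x - sin (theta n * x) / theta n =
    - ((sin (theta n * x) - theta n * x) / theta n) by field; rewrite gt_eqF.
rewrite normrN normrM normfV (gtr0_norm t0) ler_pdivrMr//.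
by apply: le_trans (norm_sin_sub_le _) _; rewrite exprMn expr2; lra.
Qed.

(** Bounded functions below x^2 and converging to it. By the half-angle formula this is the square
    of 2 sin(theta x / 2) / theta. *)
Definition cos_quot (n : nat) x : R := 2 * (1 - cos (theta n * x)) / theta n ^+ 2.

Lemma cos_quot_ge0 n x : 0 <= cos_quot n x.
Proof. by rewrite mulr_ge0 ?invr_ge0 ?sqr_ge0 ?mulr_ge0 ?one_sub_cos_ge0. Qed.

Lemma cos_quot_le n x : cos_quot n x <= x ^+ 2.
Proof.
rewrite /cos_quot ler_pdivrMr ?exprn_gt0 ?theta_gt0//.
by have := one_sub_cos_le (theta n * x); rewrite exprMn; lra.
Qed.

Lemma cos_quot_cvg x : cos_quot n x @[n --> \oo] --> x ^+ 2.
Proof.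
have h : 2 * (sin (theta n * (x / 2)) / theta n) @[n --> \oo] --> 2 * (x / 2).
  by apply: cvgMr; exact: sin_theta_cvg.
have E n : cos_quot n x =
    2 * (sin (theta n * (x / 2)) / theta n) * (2 * (sin (theta n * (x / 2)) / theta n)).
  have -> : theta n * (x / 2) = theta n * x / 2 by rewrite mulrA.
  by rewrite /cos_quot one_sub_cosE; field; rewrite gt_eqF// theta_gt0.
have -> : x ^+ 2 = 2 * (x / 2) * (2 * (x / 2)) by field.
by under eq_fun do rewrite E; exact: cvgM.
Qed.

Lemma measurable_cos_quot n : measurable_fun setT (cos_quot n).
Proof.
apply: measurable_funM => //; apply: measurable_funM => //; apply: measurable_funB => //.
apply: measurableT_comp; last exact: measurable_funM.
by apply: continuous_measurable_fun; exact: continuous_cos.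
Qed.

Lemma measurable_sinR : measurable_fun setT (@sin R).
Proof. by apply: continuous_measurable_fun; exact: continuous_sin. Qed.

Lemma measurable_cosR : measurable_fun setT (@cos R).
Proof. by apply: continuous_measurable_fun; exact: continuous_cos. Qed.

End TrigBounds.

Section CosIntegral.
Context d (T : measurableType d) (R : realType).
Variable m : {measure set T -> \bar R}.

Lemma integral_cos_quot_cvg (f : T -> R) : f \in Lfun m 2%:E ->
  \int[m]_x cos_quot n (f x) @[n --> \oo] --> L2dot m f f.
Proof.
move=> fL; have mf := Lfun2_measurable fL.
have m_ n : measurable_fun setT (fun x => (cos_quot n (f x))%:E).
  by apply/measurable_EFinP; exact: (measurableT_comp (measurable_cos_quot n) mf).
have mff : measurable_fun setT (fun x => (f x * f x)%:E).
  by apply/measurable_EFinP; exact: measurable_funM.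
have cv : {ae m, forall x, setT x -> (cos_quot n (f x))%:E @[n --> \oo] --> (f x * f x)%:E}.
  apply/aeW => x _; apply: cvg_EFin; first by near=> n.
  by rewrite -expr2; exact: cos_quot_cvg.
have dom : {ae m, forall x n, setT x -> (`|(cos_quot n (f x))%:E| <= (f x * f x)%:E)%E}.
  apply/aeW => x n _; rewrite /= lee_fin ger0_norm ?cos_quot_ge0// -expr2.
  exact: cos_quot_le.
have [_ _] := dominated_convergence measurableT m_ mff cv (Lfun2_mul fL fL) dom.
have -> : (\int[m]_x (f x * f x)%:E = (L2dot m f f)%:E)%E.
  have ff := Lfun2_mul fL fL.
  by rewrite /L2dot /Rintegral fineK//; exact: (integrable_fin_num measurableT ff).
move=> /fine_cvg; exact.
Unshelve. all: by end_near. Qed.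

End CosIntegral.

(** * Moments of a variable with characteristic function exp(t (- a(x) + i b(x))) *)

Section SecondMoment.
Context (R : realType) (disp : measure_display) (Omega : measurableType disp).
Variables (P : probability Omega R) (X : Omega -> R) (M t : R) (a b : R -> R).
Hypothesis mX : measurable_fun setT X.
Hypothesis t0 : 0 <= t.
Hypothesis M0 : 0 <= M.
Hypothesis a_ge0 : forall x, 0 <= a x.
Hypothesis a_le : forall x, a x <= x ^+ 2 * M / 2.
Hypothesis b_le : forall x, `|b x| <= x ^+ 2 * M.
Hypothesis a_cvg : 2 * a (theta n) / theta n ^+ 2 @[n --> \oo] --> M.
Hypothesis cosX : forall x, \int[P]_w cos (x * X w) = expR (- (t * a x)) * cos (t * b x).
Hypothesis sinX : forall x, \int[P]_w sin (x * X w) = expR (- (t * a x)) * sin (t * b x).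

Let bounded_integrable (f : Omega -> R) (C : R) : measurable_fun setT f ->
  (forall w, `|f w| <= C) -> P.-integrable setT (EFin \o f).
Proof.
move=> mf fC; apply: measurable_bounded_integrable => //.
  by rewrite [X in (X < _)%E](_ : _ = 1%E) ?ltry//; exact: probability_setT.
exists C; split; first exact: num_real.
by move=> y Cy w _ /=; rewrite (le_trans (fC w))// ltW.
Qed.

Let mcos x : measurable_fun setT (fun w => cos (x * X w)).
Proof. by apply: (measurableT_comp measurable_cosR); exact: measurable_funM. Qed.

Let int_cos_quot n : \int[P]_w cos_quot n (X w) =
  2 * (1 - expR (- (t * a (theta n))) * cos (t * b (theta n))) / theta n ^+ 2.
Proof.
rewrite -cosX.
have ic : P.-integrable setT (EFin \o (fun w => cos (theta n * X w))).
  by apply: (@bounded_integrable _ 1) => // w; exact: cos_max.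
have i1 : P.-integrable setT (EFin \o (fun _ : Omega => (1:R))).
  by apply: (@bounded_integrable _ 1) => // w; rewrite normr1.
have i1c : P.-integrable setT (EFin \o (fun w => 1 - cos (theta n * X w))).
  by have := integrableB measurableT i1 ic; apply: eq_integrable.
have -> : 1 - \int[P]_w cos (theta n * X w) = \int[P]_w (1 - cos (theta n * X w)).
  rewrite RintegralB//; congr (_ - _); rewrite Rintegral_cst// mul1r.
  by rewrite [X in fine X](_ : _ = 1%E)//; exact: probability_setT.
rewrite mulrAC -RintegralZl//; apply: eq_Rintegral => w _; rewrite /cos_quot; lra.
Qed.

Let quot n := 2 * (1 - expR (- (t * a (theta n))) * cos (t * b (theta n))) / theta n ^+ 2.

Let th2 n : 0 < theta n ^+ 2 :> R. Proof. by rewrite exprn_gt0// theta_gt0. Qed.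

(** From 1 - e^(-p) cos q <= p + q^2 / 2 with p = t a and q = t b; since b is O(theta^2), the q-term
    is of lower order after division by theta^2. *)
Let quot_le n : quot n <= t * (2 * a (theta n) / theta n ^+ 2) + t ^+ 2 * M ^+ 2 * theta n ^+ 2.
Proof.
rewrite /quot; set x := theta n.
have e1 : 1 - t * a x <= expR (- (t * a x)) by have := expR_ge1Dx (- (t * a x)); lra.
have e2 : expR (- (t * a x)) <= 1 by rewrite expR_le1 oppr_le0 mulr_ge0.
have e0 := expR_ge0 (- (t * a x)).
have c1 := one_sub_cos_le (t * b x); have c0 := one_sub_cos_ge0 (t * b x).
have bb : b x ^+ 2 <= (x ^+ 2 * M) ^+ 2.
  have Bp : 0 <= x ^+ 2 * M by rewrite mulr_ge0 ?sqr_ge0.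
  by rewrite -(real_normK (num_real (b x))) lerXn2r ?nnegrE//; exact: b_le.
have num : 1 - expR (- (t * a x)) * cos (t * b x) <= t * a x + t ^+ 2 * (x ^+ 2 * M) ^+ 2 / 2.
  have : (t * b x) ^+ 2 <= t ^+ 2 * (x ^+ 2 * M) ^+ 2 by rewrite exprMn ler_wpM2l ?sqr_ge0.
  by nra.
rewrite ler_pdivrMr ?th2//.
have -> : (t * (2 * a x / x ^+ 2) + t ^+ 2 * M ^+ 2 * x ^+ 2) * x ^+ 2 =
  2 * (t * a x + t ^+ 2 * (x ^+ 2 * M) ^+ 2 / 2) by field; rewrite gt_eqF// theta_gt0.
by rewrite ler_pM2l.
Qed.

(** From cos <= 1 and e^(-p) <= 1 / (1 + p) <= 1 - p + p^2 for p = t a >= 0. *)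
Let quot_ge n : t * (2 * a (theta n) / theta n ^+ 2) - t ^+ 2 * M ^+ 2 * theta n ^+ 2 <= quot n.
Proof.
rewrite /quot; set x := theta n; have ax0 := a_ge0 x; have ax1 := a_le x.
have ta0 : 0 <= t * a x by rewrite mulr_ge0.
have e2 : expR (- (t * a x)) <= 1 - t * a x + (t * a x) ^+ 2.
  have e1 := expR_ge1Dx (t * a x); rewrite expRN.
  apply: (@le_trans _ _ (1 + t * a x)^-1); first by rewrite lef_pV2 ?posrE ?expR_gt0//; lra.
  rewrite -[leLHS]mul1r ler_pdivrMr; last lra.
  by have := exprn_ge0 3 ta0; rewrite !exprS expr0; nra.
have ec : expR (- (t * a x)) * cos (t * b x) <= expR (- (t * a x)).
  by rewrite ler_piMr ?expR_ge0 ?cos_le1.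
have aa : (t * a x) ^+ 2 <= t ^+ 2 * (x ^+ 2 * M / 2) ^+ 2.
  by rewrite exprMn ler_wpM2l ?sqr_ge0// lerXn2r ?nnegrE// ?mulr_ge0 ?sqr_ge0 ?invr_ge0.
rewrite ler_pdivlMr ?th2//.
have -> : (t * (2 * a x / x ^+ 2) - t ^+ 2 * M ^+ 2 * x ^+ 2) * x ^+ 2 =
  2 * (t * a x - 2 * (t ^+ 2 * (x ^+ 2 * M / 2) ^+ 2)) by field; rewrite gt_eqF// theta_gt0.
have := sqr_ge0 (t * a x); lra.
Qed.

Let quot_cvg : quot n @[n --> \oo] --> t * M.
Proof.
have h1 : t * (2 * a (theta n) / theta n ^+ 2) @[n --> \oo] --> t * M by apply: cvgMr.
have h2 : t ^+ 2 * M ^+ 2 * (theta n * theta n) @[n --> \oo] --> t ^+ 2 * M ^+ 2 * (0 * 0).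
  by apply: cvgMr; apply: cvgM; exact: theta_cvg.
rewrite !mulr0 in h2.
have h3 : t * (2 * a (theta n) / theta n ^+ 2) + t ^+ 2 * M ^+ 2 * (theta n * theta n)
    @[n --> \oo] --> t * M by rewrite -[X in _ --> X]addr0; exact: cvgD.
have h4 : t * (2 * a (theta n) / theta n ^+ 2) - t ^+ 2 * M ^+ 2 * (theta n * theta n)
    @[n --> \oo] --> t * M by rewrite -[X in _ --> X]subr0; exact: cvgB.
apply: squeeze_cvgr h4 h3; near=> n.
by have := quot_le n; have := quot_ge n; rewrite [theta n ^+ 2]expr2 => -> ->.
Unshelve. all: by end_near. Qed.

(** Fatou along [cos_quot]: its expectations are bounded uniformly in n because 2 a / theta^2 <= M
    and theta <= 1. Only once X is known to be in L^2 can dominated convergence identify the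
    moment. *)
Lemma second_moment_L2 : X \in Lfun P 2%:E.
Proof.
apply/Lfun2P; split => //.
apply: (@le_lt_trans _ _ (t * M + t ^+ 2 * M ^+ 2)%:E); last by rewrite ltry.
apply: (@fatou_ae _ _ _ P (fun n w => cos_quot n (X w))).
- by move=> n; exact: (measurableT_comp (measurable_cos_quot n) mX).
- exact: measurable_funX.
- by move=> n w; exact: cos_quot_ge0.
- by move=> w; exact: sqr_ge0.
- by apply/aeW => w; exact: cos_quot_cvg.
- move=> n.
  have icq : P.-integrable setT (EFin \o (fun w => cos_quot n (X w))).
    apply: (@bounded_integrable _ (4 / theta n ^+ 2)).
      exact: (measurableT_comp (measurable_cos_quot n) mX).
    move=> w; rewrite ger0_norm ?cos_quot_ge0// ler_pM2r ?invr_gt0 ?th2//.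
    by have := cos_geN1 (theta n * X w); lra.
  rewrite -[leLHS]fineK; last exact: (integrable_fin_num measurableT icq).
  rewrite lee_fin -/(Rintegral P setT (fun w => cos_quot n (X w))) int_cos_quot.
  apply: le_trans (quot_le n) _; apply: lerD.
    rewrite ler_wpM2l// ler_pdivrMr ?th2//; have := a_le (theta n); lra.
  rewrite ler_piMr ?mulr_ge0 ?sqr_ge0// exprn_ile1 ?theta_le1//.
  exact/ltW/theta_gt0.
Qed.

Lemma second_moment : L2dot P X X = t * M.
Proof.
have := integral_cos_quot_cvg second_moment_L2.
under eq_fun do rewrite int_cos_quot.
by move=> /cvg_unique; apply => //; exact: quot_cvg.
Qed.

(** The functions sin(theta X) / theta tend to X below |X|, while their expectations are at most t
    |b(theta)| / theta <= t M theta. *)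
Lemma first_moment : \int[P]_w X w = 0.
Proof.
have XL := second_moment_L2.
have iX : P.-integrable setT (fun w => (X w)%:E).
  have := Lfun2_mul XL (prob_cst_L2 P 1).
  by apply: eq_integrable => // w _; rewrite mulr1.
have iaX : P.-integrable setT (fun w => (`|X w|)%:E) by exact: integrable_norm iX.
have m_ n : measurable_fun setT (fun w => (sin (theta n * X w) / theta n)%:E).
  apply/measurable_EFinP; apply: measurable_funM => //.
  by apply: (measurableT_comp measurable_sinR); exact: measurable_funM.
have mXE : measurable_fun setT (fun w => (X w)%:E) by apply/measurable_EFinP.
have cv : {ae P, forall w, setT w -> (sin (theta n * X w) / theta n)%:E @[n --> \oo] --> (X w)%:E}.
  by apply/aeW => w _; apply: cvg_EFin; [near=> n|exact: sin_theta_cvg].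
have dom : {ae P, forall w n, setT w ->
    (`|(sin (theta n * X w) / theta n)%:E| <= (`|X w|)%:E)%E}.
  apply/aeW => w n _; have th := theta_gt0 (R := R) n.
  rewrite /= lee_fin normrM normfV (gtr0_norm th) ler_pdivrMr//.
  by apply: le_trans (norm_sin_le _) _; rewrite normrM (gtr0_norm th) mulrC.
have [_ _] := dominated_convergence measurableT m_ mXE cv iaX dom.
have -> : (\int[P]_w (X w)%:E = (\int[P]_w X w)%:E)%E.
  by rewrite /Rintegral fineK//; exact: (integrable_fin_num measurableT iX).
move=> /fine_cvg h1.
have h2 : \int[P]_w (sin (theta n * X w) / theta n) @[n --> \oo] --> 0.
  have e0 : t * M * theta n @[n --> \oo] --> 0.
    by rewrite -[X in _ --> X](mulr0 (t * M)); apply: cvgMr; exact: theta_cvg.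
  apply/norm_cvg0P; apply: squeeze_cvgr (cvg_cst 0) e0; near=> n.
  have th := theta_gt0 (R := R) n.
  rewrite normr_ge0/= RintegralZr//; last first.
    apply: (@bounded_integrable _ 1) => [|w]; last exact: sin_max.
    by apply: (measurableT_comp measurable_sinR); exact: measurable_funM.
  rewrite sinX normrM normfV (gtr0_norm th) ler_pdivrMr// normrM (ger0_norm (expR_ge0 _)).
  apply: (@le_trans _ _ (`|sin (t * b (theta n))|)).
    by rewrite ler_piMl// expR_le1 oppr_le0 mulr_ge0.
  apply: le_trans (norm_sin_le _) _; rewrite normrM (ger0_norm t0).
  by have := ler_wpM2l t0 (b_le (theta n)); rewrite expr2; lra.
exact: (cvg_unique (@Rhausdorff R) h1 h2).
Unshelve. all: by end_near. Qed.

End SecondMoment.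

(** * Second-order behaviour of the exponent, and moments of the one-sided process *)

Section LevyMeasureFacts.
Context (R : realType) (nu : {measure set R -> \bar R}).
Hypothesis hnu : levy_measure nu.
Hypothesis hnu2 : (\int[nu]_(x in [set x : R | (1 < `|x|)%R]) (x ^+ 2)%:E < +oo)%E.

(** Split at |x| = 1: x^2 <= min(x^2, 1) + x^2 1_(|x| > 1), both integrable by hypothesis. *)
Lemma levy_id_L2 : (fun x : R => x) \in Lfun nu 2%:E.
Proof.
apply/Lfun2P; split; first exact: measurable_id.
pose A : set R := [set x : R | (1 < `|x|)%R].
have mA : measurable A.
  have -> : A = setT `&` ((fun x : R => `|x|) @^-1` `]1, +oo[%classic).
    by apply/seteqP; split => x /=; rewrite in_itv/= andbT; [split|case].
  exact: (@normr_measurable R setT).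
have mmin : measurable_fun setT (fun x : R => (Num.min (`|x| ^+ 2) 1)%:E).
  apply/measurable_EFinP; apply: measurable_minr => //; apply: measurable_funX.
  exact: normr_measurable.
have msq : measurable_fun setT (fun x : R => (x ^+ 2)%:E).
  by apply/measurable_EFinP; exact: measurable_funX.
have mr : measurable_fun setT ((fun x : R => (x ^+ 2)%:E) \_ A).
  by apply/(measurable_restrictT _ mA); exact: measurable_funTS.
apply: (@le_lt_trans _ _ (\int[nu]_x ((Num.min (`|x| ^+ 2) 1)%:E +
    ((fun x : R => (x ^+ 2)%:E) \_ A) x))%E).
  apply: ge0_le_integral => //.
  - by move=> x _; rewrite lee_fin sqr_ge0.
  - exact: emeasurable_funD.
  - move=> x _; rewrite patchE; case: ifPn => [_|].
      by rewrite leeDr// lee_fin le_min sqr_ge0 ler01.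
    rewrite notin_setE /A/= => /negP; rewrite -leNgt => x1.
    rewrite adde0 lee_fin le_min real_normK ?num_real// lexx/=.
    by rewrite -real_normK ?num_real// exprn_ile1.
rewrite ge0_integralD//.
- have := levy_measure_min hnu => hmin; rewrite lte_add_pinfty//.
  by rewrite -integral_mkcond.
- by move=> x _; rewrite patchE; case: ifP => // _; rewrite lee_fin sqr_ge0.
Qed.

Definition levy_var : R := L2dot nu (fun x => x) (fun x => x).

Lemma levy_var_ge0 : 0 <= levy_var. Proof. exact: L2dot_ge0. Qed.

(** A zero second moment would concentrate nu on the origin, which carries no mass. *)
Lemma levy_var_gt0 : nu [set: R] != 0%E -> 0 < levy_var.
Proof.
move=> nu0; rewrite lt0r levy_var_ge0 andbT; apply: contraNneq nu0 => /(L2dot_eq0 levy_id_L2).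
move=> [N [mN N0 sN]]; rewrite -measure_le0.
have TN : [set: R] `<=` N `|` [set 0].
  move=> x _; have [->|x0] := eqVneq x 0; first by right.
  by left; apply: sN => /= /eqP; rewrite (negbTE x0).
apply: (le_trans (le_measure nu _ _ TN)).
- by rewrite inE.
- by rewrite inE; exact: measurableU.
apply: (le_trans (measureU2 nu mN (measurable_set1 0))).
by rewrite [X in (X + _)%E]N0 add0e [leLHS](levy_measure0 hnu).
Qed.

Definition levy_cos (x : R) : R := \int[nu]_u (1 - cos (x * u)).
(** The compensator x u removes the first-order term, so this imaginary part of the exponent is
    O(x^2). [levy_cos] is minus the real part. *)
Definition levy_sin (x : R) : R := \int[nu]_u (sin (x * u) - x * u).

Let sq_int (c : R) : nu.-integrable setT (fun u : R => (c * (u * u))%:E).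
Proof. exact: (integrableZl measurableT c (Lfun2_mul levy_id_L2 levy_id_L2)). Qed.

Let sqE (c : R) : \int[nu]_u (c * (u * u)) = c * levy_var.
Proof. by rewrite RintegralZl//; exact: Lfun2_mul levy_id_L2 levy_id_L2. Qed.

Let mcos x : measurable_fun setT (fun u : R => 1 - cos (x * u)).
Proof.
apply: measurable_funB => //; apply: (measurableT_comp measurable_cosR).
exact: measurable_funM.
Qed.

Let msin x : measurable_fun setT (fun u : R => sin (x * u) - x * u).
Proof.
apply: measurable_funB; last exact: measurable_funM.
by apply: (measurableT_comp measurable_sinR); exact: measurable_funM.
Qed.

Lemma levy_cos_integrable x : nu.-integrable setT (fun u : R => (1 - cos (x * u))%:E).
Proof.
apply: le_integrable (sq_int (x ^+ 2 / 2)) => //; first exact/measurable_EFinP.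
move=> u _; have uu : 0 <= u * u by rewrite -expr2 sqr_ge0.
have xx : 0 <= x ^+ 2 / 2 by rewrite divr_ge0 ?sqr_ge0.
rewrite /= lee_fin (ger0_norm (one_sub_cos_ge0 _)) (ger0_norm (mulr_ge0 xx uu)).
by have := one_sub_cos_le (x * u); rewrite exprMn [u ^+ 2]expr2; lra.
Qed.

Lemma levy_sin_integrable x : nu.-integrable setT (fun u : R => (sin (x * u) - x * u)%:E).
Proof.
apply: le_integrable (sq_int (x ^+ 2)) => //; first exact/measurable_EFinP.
move=> u _; have uu : 0 <= u * u by rewrite -expr2 sqr_ge0.
rewrite /= lee_fin (ger0_norm (mulr_ge0 (sqr_ge0 x) uu)).
by have := norm_sin_sub_le (x * u); rewrite exprMn [u ^+ 2]expr2.
Qed.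

Lemma levy_cos_ge0 x : 0 <= levy_cos x.
Proof. by apply: Rintegral_ge0 => u _; exact: one_sub_cos_ge0. Qed.

Lemma levy_cos_le x : levy_cos x <= x ^+ 2 * levy_var / 2.
Proof.
rewrite mulrAC -sqE; apply: le_Rintegral => //; [exact: levy_cos_integrable|exact: sq_int|].
by move=> u _; have := one_sub_cos_le (x * u); rewrite exprMn [u ^+ 2]expr2; lra.
Qed.

Lemma levy_sin_le x : `|levy_sin x| <= x ^+ 2 * levy_var.
Proof.
have is_ := levy_sin_integrable x.
apply: (le_trans (le_normr_Rintegral measurableT is_)).
rewrite -sqE; apply: le_Rintegral => //; [exact: integrable_norm is_|exact: sq_int|].
by move=> u _; have := norm_sin_sub_le (x * u); rewrite exprMn [u ^+ 2]expr2.
Qed.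

Lemma levy_cos_cvg : 2 * levy_cos (theta n) / theta n ^+ 2 @[n --> \oo] --> levy_var.
Proof.
have := integral_cos_quot_cvg levy_id_L2; rewrite -/levy_var.
suff E n : \int[nu]_x cos_quot n x = 2 * levy_cos (theta n) / theta n ^+ 2.
  by under eq_fun do rewrite E.
rewrite /levy_cos mulrAC -RintegralZl//; last exact: levy_cos_integrable.
by apply: eq_Rintegral => u _; rewrite /cos_quot mulrAC.
Qed.

Lemma levy_psiE x : levy_psi nu x = (- levy_cos x +i* levy_sin x)%C.
Proof.
rewrite /levy_psi /cintegral /levy_cos /levy_sin; congr (_ +i* _)%C.
  rewrite -[RHS]mulN1r -RintegralZl//; last exact: levy_cos_integrable.
  by apply: eq_Rintegral => u _ /=; rewrite expR0; ring.
by apply: eq_Rintegral => u _ /=; rewrite expR0; ring.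
Qed.

Context (disp : measure_display) (Omega : measurableType disp) (P : probability Omega R).
Variable X : R -> {RV P >-> R}.
Hypothesis hX : centered_pure_jump_levy nu X.

Let charfun_eq t x : 0 <= t ->
  ((\int[P]_w cos (x * X t w)) +i* (\int[P]_w sin (x * X t w)))%C =
  ((expR (- (t * levy_cos x)) * cos (t * levy_sin x)) +i*
   (expR (- (t * levy_cos x)) * sin (t * levy_sin x)))%C.
Proof.
move=> t0; have := cpj_charfun hX x t0; rewrite levy_psiE.
have -> : charfun P (X t) x =
    ((\int[P]_w cos (x * X t w)) +i* (\int[P]_w sin (x * X t w)))%C.
  by congr (_ +i* _)%C; apply: eq_Rintegral => w _ /=; rewrite expR0 mul1r.
move=> ->; have -> : (t%:C * (- levy_cos x +i* levy_sin x))%C =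
    (- (t * levy_cos x) +i* (t * levy_sin x))%C.
  by congr (_ +i* _)%C => /=; ring.
by [].
Qed.

Let cosX t x : 0 <= t -> \int[P]_w cos (x * X t w) =
  expR (- (t * levy_cos x)) * cos (t * levy_sin x).
Proof. by move=> /(charfun_eq x) []. Qed.

Let sinX t x : 0 <= t -> \int[P]_w sin (x * X t w) =
  expR (- (t * levy_cos x)) * sin (t * levy_sin x).
Proof. by move=> /(charfun_eq x) []. Qed.

Let mX (t : R) : measurable_fun setT (X t). Proof. exact: (@measurable_funPT _ _ _ _ (X t)). Qed.

Lemma levy_L2 (t : R) : 0 <= t -> (X t : Omega -> R) \in Lfun P 2%:E.
Proof.
move=> t0; apply: (@second_moment_L2 _ _ _ P _ levy_var t levy_cos levy_sin) => //.
- exact: levy_var_ge0.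
- exact: levy_cos_ge0.
- exact: levy_cos_le.
- exact: levy_sin_le.
- by move=> x; exact: cosX.
Qed.

Lemma levy_second_moment t : 0 <= t -> L2dot P (X t) (X t) = t * levy_var.
Proof.
move=> t0; apply: (@second_moment _ _ _ P _ levy_var t levy_cos levy_sin) => //.
- exact: levy_var_ge0.
- exact: levy_cos_ge0.
- exact: levy_cos_le.
- exact: levy_sin_le.
- exact: levy_cos_cvg.
- by move=> x; exact: cosX.
Qed.

Lemma levy_mean t : 0 <= t -> \int[P]_w X t w = 0.
Proof.
move=> t0; apply: (@first_moment _ _ _ P _ levy_var t levy_cos levy_sin) => //.
- exact: levy_var_ge0.
- exact: levy_cos_ge0.
- exact: levy_cos_le.
- exact: levy_sin_le.
- by move=> x; exact: cosX.
- by move=> x; exact: sinX.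
Qed.

(** Stationarity equates the laws of X t - X s and X (t - s), hence the integrals of y^2 against
    them. *)
Lemma levy_dist s t : 0 <= s -> 0 <= t -> L2dist P (X s) (X t) = levy_var * `|t - s|.
Proof.
wlog st : s t / s <= t => [H s0 t0|s0 t0].
  have [/H|/ltW/H] := leP s t; first exact.
  by move=> /(_ t0 s0); rewrite L2distC distrC.
have ts0 : 0 <= t - s by rewrite subr_ge0.
rewrite (ger0_norm ts0) L2distC mulrC -levy_second_moment//.
have Dm : measurable_fun setT (fun w => X t w - X s w) by exact: measurable_funB.
have law (B : set R) : measurable B ->
    P ((fun w => X t w - X s w) @^-1` B) = P (X (t - s) @^-1` B).
  by move=> mB; apply: (levy_stationary (cpj_levy hX)).
have msq : measurable_fun setT (fun x : R => (x ^+ 2)%:E).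
  by apply/measurable_EFinP; exact: measurable_funX.
have sq0 : {in setT, forall x : R, (0 <= (x ^+ 2)%:E)%E} by move=> x _; rewrite lee_fin sqr_ge0.
have e1 := ge0_integral_pushforward Dm P measurableT msq sq0.
have e2 := ge0_integral_pushforward (mX (t - s)) P measurableT msq sq0.
apply: EFin_inj; rewrite /L2dist L2dotE; last by apply: Lfun2_sub; exact: levy_L2.
rewrite L2dotE; last exact: levy_L2.
transitivity (\int[pushforward P (fun w => (X t w - X s w)%R)]_y (y ^+ 2)%:E)%E.
  by rewrite e1.
transitivity (\int[pushforward P (X (t - s))]_y (y ^+ 2)%:E)%E; last by rewrite e2.
by apply: eq_measure_integral => B mB _; exact: law.
Qed.

End LevyMeasureFacts.

(** * Two-sided process *)

Section TwoSidedLevy.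
Context (R : realType) (disp : measure_display) (Omega : measurableType disp).
Variable P : probability Omega R.

(** The joint law is the product of the marginals, by uniqueness on rectangles; Fubini then leaves
    the inner integral x E[Y] = 0. *)
Lemma independent_mean0_dot (X Y : {RV P >-> R}) :
  (X : Omega -> R) \in Lfun P 2%:E -> (Y : Omega -> R) \in Lfun P 2%:E ->
  (forall A B, measurable A -> measurable B ->
    P (X @^-1` A `&` Y @^-1` B) = (P (X @^-1` A) * P (Y @^-1` B))%E) ->
  \int[P]_w Y w = 0 -> L2dot P X Y = 0.
Proof.
move=> XL YL indep Y0.
have mX : measurable_fun setT X by exact: (@measurable_funPT _ _ _ _ X).
have mY : measurable_fun setT Y by exact: (@measurable_funPT _ _ _ _ Y).
pose XY (w : Omega) : R * R := (X w, Y w).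
have mXY : measurable_fun setT XY by exact: measurable_fun_pair.
unshelve epose (pf := (pushforward P XY : {measure set (R * R) -> \bar R})); first exact: mXY.
pose m1 := distribution P X; pose m2 := distribution P Y.
have prodE (C : set (R * R)) : measurable C -> (m1 \x m2)%E C = pf C.
  apply: product_measure_unique => A B mA mB.
  rewrite /pf /m1 /m2 /distribution /pushforward -indep//; congr (P _).
pose f (p : R * R) : \bar R := (p.1 * p.2)%:E.
have mf : measurable_fun setT f.
  by apply/measurable_EFinP; apply: measurable_funM; [exact: measurable_fst|exact: measurable_snd].
have iXY : P.-integrable (XY @^-1` setT) (f \o XY) by exact: Lfun2_mul XL YL.
have ipf : pf.-integrable setT f by exact: (integrable_pushforward mXY mf iXY measurableT).
have iprod : (m1 \x m2)%E.-integrable setT f.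
  apply/integrableP; split => //; move/integrableP : ipf => [_].
  suff -> : (\int[m1 \x m2]_p `|f p| = \int[pf]_p `|f p|)%E by [].
  by apply: eq_measure_integral => C mC _; exact: prodE.
have e1 : (\int[P]_w (X w * Y w)%:E = \int[pf]_p f p)%E.
  by apply/esym; exact: (integral_pushforward mXY mf iXY measurableT).
have e2 : (\int[pf]_p f p = \int[m1 \x m2]_p f p)%E.
  by apply: eq_measure_integral => C mC _; exact/esym/prodE.
have iY : P.-integrable setT (fun w => (Y w)%:E).
  have := Lfun2_mul YL (prob_cst_L2 P 1).
  by apply: eq_integrable => // w _; rewrite mulr1.
have mE : measurable_fun setT (fun y : R => y%:E) by exact/measurable_EFinP.
have im2 : m2.-integrable setT (fun y : R => y%:E).
  exact: (integrable_pushforward mY mE iY measurableT).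
have im20 : (\int[m2]_y y%:E = 0)%E.
  have e3 : (\int[m2]_y y%:E = \int[P]_w (Y w)%:E)%E.
    exact: (integral_pushforward mY mE iY measurableT).
  rewrite e3 -[LHS]fineK; last exact: (integrable_fin_num measurableT iY).
  by rewrite -/(Rintegral P setT Y) Y0.
rewrite /L2dot /Rintegral e1 e2 -(integral12_prod_meas1 iprod).
rewrite integral0_eq// => x _; rewrite /fubini_F /f/=.
under eq_integral do rewrite EFinM.
by rewrite (integralZl measurableT im2) im20 mule0.
Qed.

Variable nu : {measure set R -> \bar R}.
Hypothesis hnu : levy_measure nu.
Hypothesis hnu2 : (\int[nu]_(x in [set x : R | (1 < `|x|)%R]) (x ^+ 2)%:E < +oo)%E.

Local Notation v := (levy_var nu).

(** No fixed jumps: the process is continuous in L^2 by [levy_dist], so an almost sure left limit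
    has to agree with the L^2 limit X tau. *)
Lemma levy_left_limit (X : R -> {RV P >-> R}) (tau : R) (Z : Omega -> R) :
  centered_pure_jump_levy nu X -> 0 < tau -> measurable_fun setT Z ->
  {ae P, forall w, X u w @[u --> tau^'-] --> Z w} -> {ae P, forall w, X tau w = Z w}.
Proof.
move=> hX tau0 mZ cvZ; have XL := levy_L2 hnu hnu2 hX.
have mX (t : R) : measurable_fun setT (X t) by exact: (@measurable_funPT _ _ _ _ (X t)).
(* Times increasing strictly to tau from u_0 = 0; after a shift by N, Fatou bounds the squared error
   by v tau theta_N for every N. *)
pose u_ n := tau - tau * theta n.
have u_lt n : u_ n < tau by rewrite /u_ gtrBl mulr_gt0// theta_gt0.
have u_ge0 n : 0 <= u_ n by rewrite /u_ subr_ge0 ler_piMr ?(ltW tau0)// theta_le1.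
have u_cvg : u_ n @[n --> \oo] --> tau.
  rewrite -[X in _ --> X]subr0; apply: cvgB; first exact: cvg_cst.
  by rewrite -[X in _ --> X](mulr0 tau); apply: cvgMr; exact: theta_cvg.
have udist n : L2dist P (X tau) (X (u_ n)) = v * (tau * theta n).
  rewrite (levy_dist hnu hnu2 hX)// ?(ltW tau0)// distrC ger0_norm.
    by rewrite /u_; congr (_ * _); ring.
  by rewrite subr_ge0 ltW.
have v0 := levy_var_ge0 nu.
have bound N : (\int[P]_w ((X tau w - Z w) ^+ 2)%:E <= (v * (tau * theta N))%:E)%E.
  apply: (@fatou_ae _ _ _ P (fun n w => (X tau w - X (u_ (n + N)%N) w) ^+ 2)).
  - by move=> n; apply: measurable_funX; exact: measurable_funB.
  - by apply: measurable_funX; exact: measurable_funB.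
  - by move=> n w; exact: sqr_ge0.
  - by move=> w; exact: sqr_ge0.
  - apply: filterS cvZ => w /cvg_at_leftP Xw.
    have h0 : X (u_ n) w @[n --> \oo] --> Z w by apply: Xw; split.
    have h1 : X (u_ (n + N)%N) w @[n --> \oo] --> Z w.
      by rewrite (cvg_shiftn N (fun n => X (u_ n) w)).
    have h : X tau w - X (u_ (n + N)%N) w @[n --> \oo] --> X tau w - Z w.
      by apply: cvgB => //; exact: cvg_cst.
    by rewrite expr2; under eq_fun do rewrite expr2; exact: cvgM.
  - move=> n.
    rewrite -(L2dotE (Lfun2_sub (XL _ (ltW tau0)) (XL _ (u_ge0 _)))) lee_fin.
    rewrite -/(L2dist P (X tau) (X (u_ (n + N)%N))) udist ler_wpM2l// ler_wpM2l ?(ltW tau0)//.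
    by rewrite lef_pV2 ?posrE// ler_nat ltnS leq_addl.
have ZL : (fun w => X tau w - Z w) \in Lfun P 2%:E.
  apply/Lfun2P; split; first exact: measurable_funB.
  by apply: (le_lt_trans (bound 0%N)); rewrite ltry.
have : L2dot P (fun w => X tau w - Z w) (fun w => X tau w - Z w) = 0.
  apply/eqP; rewrite eq_le L2dot_ge0 andbT.
  have h : v * (tau * theta n) @[n --> \oo] --> (0 : R).
    rewrite -[X in _ --> X](mulr0 v); apply: cvgMr.
    by rewrite -[X in _ --> X](mulr0 tau); apply: cvgMr; exact: theta_cvg.
  apply: (cvgr_to_ge h); near=> n.
  by rewrite -lee_fin L2dotE//; exact: bound.
move=> /(L2dot_eq0 ZL); apply: filterS => w /eqP.
by rewrite subr_eq0 => /eqP.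
Unshelve. all: by end_near. Qed.

Variables (L1 L2 L : R -> {RV P >-> R}).
Hypothesis hL1 : centered_pure_jump_levy nu L1.
Hypothesis hL2 : centered_pure_jump_levy nu L2.
Hypothesis hL12 : independent_processes P L1 L2.
Hypothesis hL : {ae P, forall w, forall t : R, L t w = two_sided L1 L2 t w}.

Let mL (t : R) : measurable_fun setT (L t). Proof. exact: (@measurable_funPT _ _ _ _ (L t)). Qed.

Lemma two_sided_pos (t : R) : 0 <= t -> {ae P, forall w, L t w = L1 t w}.
Proof. by move=> t0; apply: filterS hL => w /(_ t); rewrite /two_sided t0. Qed.

Lemma two_sided_neg (t : R) : t < 0 -> {ae P, forall w, L t w = - L2 (- t) w}.
Proof.
move=> t0; have nt0 : 0 < - t by rewrite oppr_gt0.
have mZ : measurable_fun setT (fun w => - L t w) by exact: measurableT_comp.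
have cvZ : {ae P, forall w, L2 u w @[u --> (- t)^'-] --> - L t w}.
  apply: filterS2 hL (levy_cadlag (cpj_levy hL2)) => w /(_ t) + [_ /(_ _ nt0) cv].
  by rewrite /two_sided leNgt t0/= => ->; rewrite opprK.
by apply: filterS (levy_left_limit hL2 nt0 mZ cvZ) => w ->; rewrite opprK.
Qed.

Lemma two_sided_indep_dot (s t : R) : 0 <= s -> 0 <= t -> L2dot P (L1 s) (L2 t) = 0.
Proof.
move=> s0 t0; apply: independent_mean0_dot.
- exact: (levy_L2 hnu hnu2 hL1).
- exact: (levy_L2 hnu hnu2 hL2).
- move=> A B mA mB; apply: hL12; apply: sub_gen_smallest.
    by exists s, A.
  by exists t, B.
- exact: (levy_mean hnu hnu2 hL2).
Qed.

Lemma two_sided_L2 (t : R) : (L t : Omega -> R) \in Lfun P 2%:E.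
Proof.
have [t0|t0] := leP 0 t.
  by apply: Lfun2_ae (two_sided_pos t0) => //; exact: (levy_L2 hnu hnu2 hL1).
apply: Lfun2_ae (two_sided_neg t0) => //.
have nt0 : 0 <= - t by rewrite oppr_ge0 ltW.
have := Lfun2_mulr (-1) (levy_L2 hnu hnu2 hL2 nt0).
by under eq_fun do rewrite mulN1r.
Qed.

Let negL2 (t : R) : t < 0 -> (fun w => - L2 (- t) w) \in Lfun P 2%:E.
Proof.
move=> t0; have nt0 : 0 <= - t by rewrite oppr_ge0 ltW.
have := Lfun2_mulr (-1) (levy_L2 hnu hnu2 hL2 nt0).
by under eq_fun do rewrite mulN1r.
Qed.

Lemma two_sided_dist (s t : R) : L2dist P (L s) (L t) = v * `|t - s|.
Proof.
have LL := two_sided_L2; have L1L := levy_L2 hnu hnu2 hL1; have L2L := levy_L2 hnu hnu2 hL2.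
wlog st : s t / s <= t => [H|].
  have [/H//|/ltW/H] := leP s t; by rewrite L2distC distrC.
have [s0|s0] := leP 0 s.
  have t0 := le_trans s0 st.
  rewrite (L2dist_ae (LL s) (L1L s s0) (LL t) (L1L t t0) (two_sided_pos s0) (two_sided_pos t0)).
  exact: levy_dist.
have ns0 : 0 <= - s by rewrite oppr_ge0 ltW.
have [t0|t0] := leP 0 t; last first.
  have nt0 : 0 <= - t by rewrite oppr_ge0 ltW.
  rewrite (L2dist_ae (LL s) (negL2 s0) (LL t) (negL2 t0) (two_sided_neg s0) (two_sided_neg t0)).
  have -> : L2dist P (fun w => - L2 (- s) w) (fun w => - L2 (- t) w) =
      L2dist P (L2 (- s)) (L2 (- t)) by apply: eq_Rintegral => w _; ring.
  rewrite (levy_dist hnu hnu2 hL2)//; congr (_ * _).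
  by rewrite -normrN; congr `|_|; ring.
(* Across the origin the increment is L1(t) + L2(-s), two orthogonal terms, so the second moments v
   t and v (-s) add up to v (t - s). *)
rewrite (L2dist_ae (LL s) (negL2 s0) (LL t) (L1L t t0) (two_sided_neg s0) (two_sided_pos t0)).
rewrite L2distC /L2dist (_ : (fun w => _) = (fun w => 1 * L2 (- s) w + L1 t w)); last first.
  by apply/funext => w; ring.
rewrite L2dot_combl ?L2dot_combr ?L1L ?L2L//; last exact: Lfun2_comb (L2L _ ns0) (L1L _ t0).
rewrite [L2dot P (L2 _) (L1 _)]L2dotC two_sided_indep_dot//.
rewrite (levy_second_moment hnu hnu2 hL1)// (levy_second_moment hnu hnu2 hL2)//.
rewrite ger0_norm; first ring.
by rewrite subr_ge0.
Qed.

Lemma two_sided_var : L2dot P (L 1) (L 1) = v.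
Proof.
have L1L := levy_L2 hnu hnu2 hL1 ler01; have LL := two_sided_L2 1.
rewrite (L2dot_ae LL L1L LL L1L (two_sided_pos ler01) (two_sided_pos ler01)).
by rewrite (levy_second_moment hnu hnu2 hL1)// mul1r.
Qed.

End TwoSidedLevy.

(** * Kernel of the tempered fractional process *)

Section TemperedKernelPrimitive.
Context {R : realType} (lambda d : R).
Hypotheses (lambda0 : 0 < lambda) (d0 : 0 < d).
Local Notation mu := (@lebesgue_measure R).
Local Notation k := (tempk lambda).
Implicit Types a b u y : R.

(** The primitive of [tempk] that vanishes on ]-oo, 0]; T_a of the indicator of [b, c[ is a
    difference of two of its translates. *)
Definition tempK (a u : R) : R := \int[mu]_v (if v < u then k a v else 0).

Let cut a u (v : R) : R := if v < u then k a v else 0.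

Let measurable_cut a u : measurable_fun setT (cut a u).
Proof.
apply: measurable_fun_ifT => //; first exact: measurable_fun_ltr.
exact: measurable_tempk.
Qed.

Let cut_ge0 a u v : 0 <= cut a u v.
Proof. by rewrite /cut; case: ifP => // _; exact: tempk_ge0. Qed.

Let cut_integrable a u : 0 < a -> mu.-integrable setT (EFin \o cut a u).
Proof.
move=> a0; apply: ge0_integrable_EFin; [exact: measurable_cut|exact: cut_ge0|].
apply: (@le_lt_trans _ _ (tempkint lambda a)); last exact: tempkint_lty.
apply: ge0_le_integral => //.
- by move=> v _; rewrite lee_fin.
- by apply/measurable_EFinP; exact: measurable_cut.
- by apply/measurable_EFinP; exact: measurable_tempk.
- by move=> v _; rewrite lee_fin /cut; case: ifP => // _; exact: tempk_ge0.
Qed.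

Lemma integral_indic_tempk a (b c y : R) : 0 < a -> b <= c ->
  (\int[mu]_s (\1_(`[b, c[%classic) s * k a (s - y))%:E =
   (tempK a (c - y) - tempK a (b - y))%:E)%E.
Proof.
move=> a0 bc.
have bcy : b - y <= c - y by rewrite lerD2r.
pose g v := cut a (c - y) v - cut a (b - y) v.
have g0 v : 0 <= g v.
  rewrite subr_ge0 /cut; case: (ltP v (b - y)) => [vb|_]; last by case: ifP => // _; exact: tempk_ge0.
  by rewrite (lt_le_trans vb).
have mg : measurable_fun setT g by exact: measurable_funB.
have mEg : measurable_fun setT (EFin \o g) by apply/measurable_EFinP; exact: mg.
have ic := cut_integrable (c - y) a0; have ib := cut_integrable (b - y) a0.
have -> : tempK a (c - y) - tempK a (b - y) = \int[mu]_v g v.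
  by rewrite RintegralB.
have ig : mu.-integrable setT (EFin \o g).
  by have := integrableB measurableT ic ib; apply: eq_integrable.
have -> : (\int[mu]_v g v)%:E = (\int[mu]_v (g v)%:E)%E.
  by rewrite /Rintegral fineK//; exact: (integrable_fin_num measurableT ig).
rewrite [RHS](ge0_integral_shift y)//.
apply: eq_integral => s _; congr EFin; rewrite /g /cut indicE mem_setE in_itv/=.
rewrite !ltrD2r; case: (ltP s b) => [sb|bs] /=.
  by rewrite (lt_le_trans sb bc) mul0r subrr.
by case: ifP => _; rewrite ?mul1r ?mul0r subr0.
Qed.

Lemma tconv_indic a (b c y : R) : 0 < a -> b <= c ->
  tconv lambda a (\1_(`[b, c[%classic)) y = tempK a (c - y) - tempK a (b - y).
Proof. by move=> a0 bc; rewrite /tconv /Rintegral integral_indic_tempk. Qed.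

Lemma Rintegral_tempk_cc a (b c y : R) : 0 < a -> b <= c ->
  \int[mu]_(s in `[b, c]) k a (s - y) = tempK a (c - y) - tempK a (b - y).
Proof.
move=> a0 bc; apply: EFin_inj; rewrite -integral_indic_tempk// /Rintegral.
have -> : (\int[mu]_(s in `[b, c]) (k a (s - y))%:E =
    \int[mu]_s (\1_(`[b, c[%classic) s * k a (s - y))%:E)%E.
  rewrite -integral_itv_bndo_bndc; last first.
    by apply/measurable_EFinP; apply: measurable_funTS; exact: measurable_tempk_shift.
  rewrite integral_mkcond; apply: eq_integral => s _.
  by rewrite patchE indicE; case: (_ \in _); rewrite ?mul1r ?mul0r.
by rewrite fineK// integral_indic_tempk.
Qed.

Lemma tempK_le0 a u : u <= 0 -> tempK a u = 0.
Proof.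
move=> u0; rewrite /tempK /Rintegral integral0_eq// => v _.
by case: ifP => // vu; rewrite tempk_le0// (le_trans (ltW vu)).
Qed.

Lemma tempK_oc a u : 0 < a ->
  (\int[mu]_(v in `]0%R, u]) (k a v)%:E = (tempK a u)%:E)%E.
Proof.
move=> a0; have iu := cut_integrable u a0.
rewrite /tempK /Rintegral fineK; last exact: (integrable_fin_num measurableT iu).
have mk : measurable_fun setT (EFin \o k a) by apply/measurable_EFinP; exact: measurable_tempk.
rewrite -integral_itv_bndo_bndc; last exact: measurable_funTS.
rewrite [LHS]integral_mkcond; apply: eq_integral => v _; rewrite patchE mem_setE in_itv/=.
case: (ltP 0 v) => [v0|v0] /=; first by case: ifP.
by rewrite tempk_le0// if_same.
Qed.

(* Integration by parts: [u^d e^(-lambda u)] has derivative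
   [d u^(d-1) e^(-lambda u) - lambda u^d e^(-lambda u)]. *)
Lemma tempK_parts u : d * tempK d u = k (d + 1) u + lambda * tempK (d + 1) u.
Proof.
have d10 : 0 < d + 1 by rewrite addr_gt0.
have [u0|u0] := leP u 0; first by rewrite !tempK_le0// tempk_le0// !mulr0 addr0.
pose q (v : R) := v `^ d * expR (- lambda * v).
have kq v : 0 < v -> k (d + 1) v = q v by move=> v0; rewrite /tempk v0 addrK.
have mq : measurable_fun setT q.
  by apply: measurable_funM; [exact: measurable_powR|exact: measurable_expRM].
have dE (v : R) : is_derive v 1 (fun v : R => expR (- lambda * v)) (- lambda * expR (- lambda * v)).
  have h3 : is_derive v 1 (fun v : R => - lambda * v) (- lambda).
    have := @is_deriveZ _ _ _ id (- lambda) v 1 1 (is_derive_id v 1).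
    by rewrite /GRing.scale/= mulr1.
  have := @is_derive1_comp R expR (fun v : R => - lambda * v) v _ _ (is_derive_expR _) h3.
  by rewrite mulrC.
have cE (v : R) : {for v, continuous (fun v : R => expR (- lambda * v))}.
  apply/differentiable_continuous/derivable1_diffP.
  by have [] := dE v.
have dq (v : R) : 0 < v -> is_derive v 1 q (d * k d v - lambda * q v).
  move=> v0; have h1 := is_derive1_powR d v0.
  have := @is_deriveM _ _ (fun v : R => v `^ d) (fun v : R => expR (- lambda * v)) v 1 _ _ h1 (dE v).
  rewrite /GRing.scale/= => h; apply: is_derive_eq.
  by rewrite /tempk v0 /q; ring.
have cq (v : R) : 0 < v -> {for v, continuous q}.
  move=> v0; apply/differentiable_continuous/derivable1_diffP.
  by have [] := dq v v0.
have iq (b : R) : mu.-integrable `[0, b] (EFin \o q).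
  have b_int := cut_integrable (b + 1) d10.
  have b_int' : mu.-integrable `[0, b] (EFin \o cut (d + 1) (b + 1)).
    by apply: integrableS b_int.
  apply: eq_integrable b_int' => // v; rewrite inE/= in_itv/= => /andP[v0 vb].
  rewrite /cut ifT; last by rewrite (le_lt_trans vb)// ltrDl.
  move: v0; rewrite le_eqVlt => /predU1P[<-|v0]; last by rewrite kq.
  by rewrite tempk_le0// /q powR0 ?gt_eqF// mul0r.
pose Q (v : R) := \int[mu]_(t in `[0, v]) q t.
(* The candidate primitive of d k_d, with q = k_(d+1) on ]0, +oo[. Continuity of F at 0 suffices,
   which covers d < 1, where k_d is unbounded there. *)
pose F (v : R) := q v + lambda * Q v.
have dF (v : R) : 0 < v -> is_derive v 1 F (d * k d v).
  move=> v0; have vv1 : v < v + 1 by rewrite ltrDl.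
  have [dQ dQE] := continuous_FTC1_closed vv1 (iq (v + 1)) v0 (cq v v0).
  have hQ : is_derive v 1 Q (q v) by split; [exact: dQ|rewrite -derive1E].
  have hQ2 := @is_deriveZ _ _ _ Q lambda v 1 _ hQ.
  have := @is_deriveD _ _ _ q (lambda *: Q) v 1 _ _ (dq v v0) hQ2.
  by rewrite /GRing.scale/= subrK.
have F0 : F 0 = 0.
  by rewrite /F /Q set_itv1 Rintegral_set1 mulr0 addr0 /q powR0 ?gt_eqF// mul0r.
have cF : F x @[x --> 0^'+] --> F 0.
  rewrite F0 -[X in _ --> X]addr0; apply: cvgD.
    rewrite -[X in _ --> X](mul0r (expR (- lambda * 0))); apply: cvgM; first exact: powR_cvg0.
    by apply: cvg_at_right_filter; exact: cE.
  rewrite -[X in _ --> X](mulr0 lambda); apply: cvgMr.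
  have := parameterized_integral_cvg_left (ltr01 : (0 : R) < 1) (iq 1).
  by move=> h; apply: cvg_at_right_filter; exact: h.
have ckd (v : R) : 0 < v -> {for v, continuous (fun v => d * k d v)}.
  move=> v0; pose g (v : R) := d * (v `^ (d - 1) * expR (- lambda * v)).
  have cg : {for v, continuous g}.
    have cP : {for v, continuous (fun v : R => v `^ (d - 1))}.
      apply/differentiable_continuous/derivable1_diffP.
      by apply: derivable_powR; rewrite in_itv/= v0.
    by apply: cvgMr; apply: cvgM; [exact: cP|exact: cE].
  rewrite /prop_for /continuous_at.
  have -> : d * k d v = g v by rewrite /tempk v0.
  apply: cvg_trans cg; apply: near_eq_cvg; near=> w.
  have w0 : 0 < w by near: w; exact: lt_nbhsr.
  by rewrite /tempk w0.
have mdk : measurable_fun setT (fun v => d * k d v).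
  by apply: measurable_funM => //; exact: measurable_tempk.
have dk0 (v : R) : 0 < v -> 0 <= d * k d v by move=> _; rewrite mulr_ge0 ?tempk_ge0// ltW.
have := ge0_FTC_oc (ltW u0) mdk dk0 ckd dF cF.
have mk : measurable_fun `]0, u]%classic (EFin \o k d).
  by apply/measurable_EFinP; apply: measurable_funTS; exact: measurable_tempk.
have -> : (\int[mu]_(v in `]0%R, u]) (d * k d v)%:E = (d * tempK d u)%:E)%E.
  under eq_integral do rewrite EFinM.
  rewrite ge0_integralZl//; last 2 first.
  - by move=> v _; rewrite lee_fin tempk_ge0.
  - by rewrite lee_fin ltW.
  by rewrite tempK_oc.
rewrite F0 subr0 => -[->]; rewrite /F (kq u u0); congr (_ + _ * _).
apply: EFin_inj; rewrite -tempK_oc//.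
have -> : (Q u)%:E = (\int[mu]_(t in `[0%R, u]) (q t)%:E)%E.
  by rewrite /Q /Rintegral fineK//; exact: (integrable_fin_num _ (iq u)).
rewrite -integral_itv_obnd_cbnd; last first.
  by apply/measurable_EFinP; exact: measurable_funTS.
by apply: eq_integral => t; rewrite inE/= in_itv/= => /andP[t0 _]; rewrite kq.
Unshelve. all: by end_near. Qed.

Lemma tempered_powerE u : tempered_power d lambda u = k (d + 1) u.
Proof.
rewrite /tempered_power /pos_part /tempk addrK; case: ifP => // _.
by rewrite powR0 ?gt_eqF// mul0r.
Qed.

(** [tempK_parts] at t - y and at - y absorbs the power terms. The oriented integral makes the
    formula uniform in the sign of t, so increments of the kernel are plain differences of
    [tempK]. *)
Lemma tflp2_kernelE t y :
  tflp2_kernel d lambda t y = d * (tempK d (t - y) - tempK d (- y)).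
Proof.
have d10 : 0 < d + 1 by rewrite addr_gt0.
have oriE : oriented_integral 0 t (fun s => tempered_power d lambda (s - y)) =
    tempK (d + 1) (t - y) - tempK (d + 1) (- y).
  rewrite /oriented_integral; case: ifPn => [t0|].
    under eq_Rintegral do rewrite tempered_powerE.
    by rewrite Rintegral_tempk_cc// sub0r.
  rewrite -ltNge => /ltW t0; under eq_Rintegral do rewrite tempered_powerE.
  by rewrite Rintegral_tempk_cc// sub0r opprB.
rewrite /tflp2_kernel oriE !tempered_powerE [RHS]mulrBr !tempK_parts; ring.
Qed.

(** A single [tempK d (c - y)] tends to c_d > 0 as y tends to -oo and is not in L^2; the difference
    is, being T_d of an indicator. *)
Lemma tempK_diff_L2 (b c : R) : b <= c ->
  (fun y => tempK d (c - y) - tempK d (b - y)) \in Lfun mu 2%:E.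
Proof.
move=> bc; rewrite (_ : (fun y => _) = tconv lambda d (\1_(`[b, c[%classic))).
  by apply: tconv_L2 => //; exact: indic_itv_L2.
by apply/funext => y; rewrite tconv_indic.
Qed.

Lemma tflp2_kernel_L2 t : tflp2_kernel d lambda t \in Lfun mu 2%:E.
Proof.
have [t0|/ltW t0] := leP 0 t.
  rewrite (_ : tflp2_kernel d lambda t =
      (fun y => d * (tempK d (t - y) - tempK d (0 - y)))).
    by apply: Lfun2_mulr; exact: tempK_diff_L2.
  by apply/funext => y; rewrite tflp2_kernelE sub0r.
rewrite (_ : tflp2_kernel d lambda t =
    (fun y => - d * (tempK d (0 - y) - tempK d (t - y)))).
  by apply: Lfun2_mulr; exact: tempK_diff_L2.
by apply/funext => y; rewrite tflp2_kernelE sub0r; ring.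
Qed.

(** Valid at every y and not just almost everywhere, since each indicator times the kernel is
    integrable; this permits rewriting the integrand of the Wiener integral as a function. *)
Lemma tconv_step (phi : step_fun R) y : tconv lambda d (step_eval phi) y =
  \sum_(i < step_size phi) step_coef phi i *
    (tempK d (step_knot phi i.+1 - y) - tempK d (step_knot phi i - y)).
Proof.
pose F i s := step_coef phi i *
  (\1_(`[step_knot phi i, step_knot phi i.+1[%classic) s * k d (s - y)).
have iF0 (b c : R) : b <= c -> mu.-integrable setT (EFin \o
    (fun s => \1_(`[b, c[%classic) s * k d (s - y))).
  move=> bc; apply: ge0_integrable_EFin.
  - by apply: measurable_tconv_integrand; exact: measurable_indic.
  - by move=> s; rewrite mulr_ge0 ?tempk_ge0// indicE.
  - by rewrite integral_indic_tempk// ltry.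
suff : forall n, (n <= step_size phi)%N ->
    mu.-integrable setT (EFin \o (fun s => \sum_(i < n) F i s)) /\
    \int[mu]_s (\sum_(i < n) F i s) = \sum_(i < n) step_coef phi i *
      (tempK d (step_knot phi i.+1 - y) - tempK d (step_knot phi i - y)).
  move=> /(_ _ (leqnn _)) [_ <-]; apply: eq_Rintegral => s _.
  by rewrite /step_eval mulr_suml; apply: eq_bigr => i _; rewrite /F mulrA.
elim=> [_|n IH nphi].
  rewrite big_ord0; under [X in _ /\ X = _]eq_Rintegral do rewrite big_ord0.
  split; last by rewrite /Rintegral integral0.
  by apply: eq_integrable (@integrable0 _ _ R mu setT) => // s _; rewrite /= big_ord0.
have [i1 e1] := IH (ltnW nphi).
have kn := step_knot_le nphi.
have i2 : mu.-integrable setT (EFin \o F n).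
  exact: (integrableZl measurableT (step_coef phi n) (iF0 _ _ kn)).
split.
  have := integrableD measurableT i1 i2.
  by apply: eq_integrable => // s _; rewrite /= big_ord_recr.
under eq_Rintegral do rewrite big_ord_recr/=.
rewrite RintegralD// e1 big_ord_recr/=; congr (_ + _).
rewrite /F RintegralZl//; last exact: iF0.
by congr (_ * _); rewrite /Rintegral integral_indic_tempk.
Qed.

End TemperedKernelPrimitive.

Section GammaTfi.
Context {R : realType} (lambda : R).
Hypothesis lambda0 : 0 < lambda.
Local Notation mu := (@lebesgue_measure R).

Lemma Gamma_gt0 (a : R) : 0 < a -> 0 < Gamma a.
Proof.
move=> a0; rewrite (_ : Gamma a = tempc 1 a); first exact: (tempc_gt0 ltr01).
rewrite /Gamma Rintegral_mkcond; apply: eq_Rintegral => s _.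
rewrite patchE mem_setE in_itv/= andbT /tempk; case: ifP => // _.
by rewrite mulN1r.
Qed.

Lemma tfi_negE (a : R) (f : R -> R) (y : R) :
  tfi_neg a lambda f y = (Gamma a)^-1 * tconv lambda a f y.
Proof.
rewrite /tfi_neg /tconv Rintegral_mkcond; congr (_ * _); apply: eq_Rintegral => s _.
rewrite patchE mem_setE in_itv/= andbT /tempk subr_gt0; case: ifP => _.
  by rewrite mulrA.
by rewrite mulr0.
Qed.

Lemma tfi_neg_L2 (a : R) (f : R -> R) : 0 < a -> f \in Lfun mu 2%:E ->
  tfi_neg a lambda f \in Lfun mu 2%:E.
Proof.
move=> a0 fL; rewrite (_ : tfi_neg a lambda f = (fun y => (Gamma a)^-1 * tconv lambda a f y)).
  by apply: Lfun2_mulr; exact: tconv_L2.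
by apply/funext => y; exact: tfi_negE.
Qed.

Lemma tfi_neg_comb_ae (a c : R) (f g : R -> R) : 0 < a -> f \in Lfun mu 2%:E ->
  g \in Lfun mu 2%:E -> {ae mu, forall y,
    tfi_neg a lambda (fun x => c * f x + g x) y =
    c * tfi_neg a lambda f y + tfi_neg a lambda g y}.
Proof.
move=> a0 fL gL.
have := tconv_comb_ae c a0 (tconv_dom_L2 lambda0 fL) (tconv_dom_L2 lambda0 gL).
by apply: lebesgue_aeS => y e; rewrite !tfi_negE e; ring.
Qed.

Lemma tfi_neg_tconv_ae (a : R) (f : R -> R) : 0 < a -> f \in Lfun mu 2%:E ->
  {ae mu, forall y, tconv lambda a (fun x => (Gamma a)^-1 * f x) y = tfi_neg a lambda f y}.
Proof.
move=> a0 fL.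
have := tconv_comb_ae (Gamma a)^-1 a0 (tconv_dom_L2 lambda0 fL)
  (tconv_dom_L2 lambda0 (@Lfun2_cst0 _ _ R mu)).
apply: lebesgue_aeS => y; rewrite tfi_negE.
have -> : (fun s => (Gamma a)^-1 * f s + 0) = (fun x => (Gamma a)^-1 * f x).
  by apply/funext => x; rewrite addr0.
move=> ->; rewrite [X in _ + X](_ : _ = 0) ?addr0//.
rewrite /tconv; under eq_Rintegral do rewrite mul0r.
by rewrite /Rintegral integral0.
Qed.

End GammaTfi.

(** * The closed span of the tempered process and the integral on it *)

Section ClosedSpan.
Context (R : realType) (disp : measure_display) (Omega : measurableType disp).
Variables (P : probability Omega R) (L : R -> Omega -> R) (M lambda d : R).
Local Notation mu := (@lebesgue_measure R).
Hypothesis M0 : 0 < M.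
Hypothesis LL : forall t, L t \in Lfun P 2%:E.
Hypothesis Ldist : forall s t, L2dist P (L s) (L t) = M * `|t - s|.
Hypotheses (lambda0 : 0 < lambda) (d0 : 0 < d).

Local Notation W := (wiener_integral P L).
Local Notation S := (tflp2 P L d lambda).
Local Notation kern := (tflp2_kernel d lambda).
Local Notation tconv := (tconv lambda).

Let d10 : 0 < d + 1. Proof. by rewrite addr_gt0. Qed.

Let W_L2 f : f \in Lfun mu 2%:E -> W f \in Lfun P 2%:E.
Proof. exact: (wiener_integral_L2 M0 LL Ldist). Qed.

Lemma wiener_integral_sum n (c : nat -> R) (F G : nat -> R -> R) :
  (forall i, F i \in Lfun mu 2%:E) -> (forall i, G i \in Lfun mu 2%:E) ->
  (fun x => \sum_(i < n) c i * (F i x - G i x)) \in Lfun mu 2%:E /\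
  {ae P, forall w, W (fun x => \sum_(i < n) c i * (F i x - G i x)) w =
    \sum_(i < n) c i * (W (F i) w - W (G i) w)}.
Proof.
move=> FL GL; elim: n => [|n [SL IH]].
  have z : (fun x : R => \sum_(i < 0) c i * (F i x - G i x)) = (fun=> 0).
    by apply/funext => x; rewrite big_ord0.
  have zL : (fun=> 0) \in Lfun mu 2%:E by exact: Lfun2_cst0.
  rewrite z; split => //.
  have : L2dot P (W (fun=> 0)) (W (fun=> 0)) = 0.
    by rewrite (wiener_integral_dot M0 LL Ldist zL zL) L2dot_cst0l mulr0.
  move=> /(L2dot_eq0 (W_L2 zL)); apply: filterS => w ->.
  by rewrite big_ord0.
set Sn := (fun x : R => \sum_(i < n) c i * (F i x - G i x)) in SL IH.
have H1 : (fun x => - c n * G n x + Sn x) \in Lfun mu 2%:E by exact: Lfun2_comb.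
have E : (fun x : R => \sum_(i < n.+1) c i * (F i x - G i x)) =
    (fun x => c n * F n x + (- c n * G n x + Sn x)).
  by apply/funext => x; rewrite big_ord_recr /Sn/=; ring.
rewrite E; split; first exact: Lfun2_comb.
have a1 := wiener_integral_comb M0 LL Ldist (c n) (FL n) H1.
have a2 := wiener_integral_comb M0 LL Ldist (- c n) (GL n) SL.
apply: filterS3 a1 a2 IH => w -> -> ->; rewrite big_ord_recr/=; ring.
Qed.

(** Equal to 1 / Gamma(d). It is divided out by [scale_step] when step functions are chosen. *)
Let c0 : R := (Gamma (d + 1))^-1 * d.

Let c0_neq0 : c0 != 0.
Proof. by rewrite gt_eqF// mulr_gt0// invr_gt0 Gamma_gt0. Qed.

Lemma tflp2_L2 t : S t \in Lfun P 2%:E.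
Proof. by apply: Lfun2_mulr; apply: W_L2; exact: tflp2_kernel_L2. Qed.

Lemma step_integral_tflp2_L2 phi : step_integral S phi \in Lfun P 2%:E.
Proof.
apply: (@Lfun2_sum _ _ R P _ (fun i w => step_coef phi i *
  (S (step_knot phi i.+1) w - S (step_knot phi i) w))) => i.
by apply: Lfun2_mulr; apply: Lfun2_sub; exact: tflp2_L2.
Qed.

Lemma step_integral_tflp2 phi : {ae P, forall w,
  step_integral S phi w = W (fun y => c0 * tconv d (step_eval phi) y) w}.
Proof.
pose c i := (Gamma (d + 1))^-1 * step_coef phi i.
have kL t := tflp2_kernel_L2 lambda0 d0 t.
have [_ a1] := wiener_integral_sum (step_size phi) c
  (fun i => kL (step_knot phi i.+1)) (fun i => kL (step_knot phi i)).
have E : (fun y => c0 * tconv d (step_eval phi) y) =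
   (fun x => \sum_(i < step_size phi) c i *
      (kern (step_knot phi i.+1) x - kern (step_knot phi i) x)).
  apply/funext => y; rewrite (tconv_step lambda0 d0) mulr_sumr; apply: eq_bigr => i _.
  by rewrite !(tflp2_kernelE lambda0 d0) /c0 /c; ring.
rewrite E; apply: filterS a1 => w ->; apply: eq_bigr => i _.
by rewrite /tflp2 /c -mulrBr mulrCA mulrA.
Qed.

Let scale_step (r : R) (phi : step_fun R) : step_fun R :=
  StepFun (fun i => r * step_coef phi i) (@step_knot_le R phi).

(** Step integrals of the process are Wiener integrals of c0 T_d phi, so membership in the closed
    span reduces, through the isometry, to approximating g in L^2(R) by transforms of step
    functions. Here g need not itself be the transform of an L^2 function, as the witness
    requires. *)
Lemma closed_span_wiener g : g \in Lfun mu 2%:E ->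
  (forall e, 0 < e -> exists phi, L2dist mu (tconv d (step_eval phi)) g < e) ->
  closed_span P S (W g).
Proof.
move=> gL happ; split; first exact: W_L2.
have th0 n : 0 < theta n :> R by exact: theta_gt0.
pose f_ n := projT1 (cid (happ _ (th0 n))).
have fE n : L2dist mu (tconv d (step_eval (f_ n))) g < theta n by rewrite /f_; case: cid.
exists (fun n => scale_step c0^-1 (f_ n)).
apply/cvg_Lnorm2P; [by move=> n; exact: step_integral_tflp2_L2|exact: W_L2|].
have tL n : tconv d (step_eval (f_ n)) \in Lfun mu 2%:E.
  by apply: tconv_L2 => //; exact: step_eval_L2.
have E n : L2dist P (step_integral S (scale_step c0^-1 (f_ n))) (W g) =
    M * L2dist mu (tconv d (step_eval (f_ n))) g.
  rewrite -(wiener_integral_dist M0 LL Ldist (tL n) gL).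
  apply: L2dist_ae; [exact: step_integral_tflp2_L2|exact: W_L2|exact: W_L2|exact: W_L2| |exact/aeW].
  have := step_integral_tflp2 (scale_step c0^-1 (f_ n)).
  have -> : (fun y => c0 * tconv d (step_eval (scale_step c0^-1 (f_ n))) y) =
      tconv d (step_eval (f_ n)).
    apply/funext => y; rewrite !(tconv_step lambda0 d0)/= mulr_sumr.
    by apply: eq_bigr => i _; rewrite mulrA mulrA divff// mul1r.
  by [].
under eq_fun do rewrite E.
have h : M * theta n @[n --> \oo] --> (0 : R).
  by rewrite -[X in _ --> X](mulr0 M); apply: cvgMr; exact: theta_cvg.
apply: squeeze_cvgr (cvg_cst 0) h; near=> n.
by rewrite mulr_ge0 ?L2dist_ge0 ?(ltW M0)//= ler_wpM2l ?(ltW M0)// ltW.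
Unshelve. all: by end_near. Qed.

Lemma step_tconv_dense f (e : R) : f \in Lfun mu 2%:E -> 0 < e ->
  exists phi, L2dist mu (tconv d (step_eval phi)) (tconv d f) < e.
Proof.
move=> fL e0; have cd0 := tempc_gt0 lambda0 d0.
have e0' : 0 < e / tempc lambda d ^+ 2 by rewrite divr_gt0// exprn_gt0.
have [phi hphi] := step_fun_dense fL e0'; exists phi.
apply: le_lt_trans (tconv_L2dist lambda0 d0 (step_eval_L2 phi) fL) _.
by rewrite mulrC -ltr_pdivlMr// exprn_gt0.
Qed.

Lemma closed_span_tflp2_integral f : f \in Lfun mu 2%:E ->
  closed_span P S (tflp2_integral P L d lambda f).
Proof.
move=> fL; have tL := tfi_neg_L2 lambda0 d0 fL; apply: closed_span_wiener => // e e0.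
have gL := Lfun2_mulr (Gamma d)^-1 fL.
have [phi hphi] := step_tconv_dense gL e0; exists phi; move: hphi.
have sL := step_eval_L2 phi.
rewrite (L2dist_ae (tconv_L2 lambda0 d0 sL) (tconv_L2 lambda0 d0 sL)
  (tconv_L2 lambda0 d0 gL) tL)//; first exact/aeW.
exact: tfi_neg_tconv_ae.
Qed.

Lemma closed_span_halfk : closed_span P S (W (tconv d (halfk lambda))).
Proof.
have hL := tconv_halfk_L2 lambda0 d0; apply: closed_span_wiener => // e e0.
have e40 : 0 < e / 4 by rewrite divr_gt0.
have := tconv_halfk_trunc_L2dist lambda0 d0.
move/cvgrPdist_lt => /(_ _ e40)[n _ /(_ n (leqnn n))].
rewrite sub0r normrN ger0_norm ?L2dist_ge0// => hn.
have tnL := halfk_trunc_L2 lambda0 n.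
have [phi hphi] := step_tconv_dense tnL e40; exists phi.
apply: le_lt_trans (L2dist_triangle (tconv_L2 lambda0 d0 (step_eval_L2 phi))
  (tconv_L2 lambda0 d0 tnL) hL) _.
have -> : e = 2 * (e / 4) + 2 * (e / 4) by field.
by apply: ltrD; (rewrite ltr_pM2l; last exact: ltr0Sn).
Qed.

(** Equality would give T_d halfk = T_d (f / Gamma(d)) almost everywhere, hence halfk = f / Gamma(d)
    almost everywhere by injectivity on [tconv_dom], putting [halfk] in L^2. *)
Lemma wiener_halfk_not_tflp2 f : f \in Lfun mu 2%:E ->
  ~ {ae P, forall w, W (tconv d (halfk lambda)) w = tflp2_integral P L d lambda f w}.
Proof.
move=> fL; have hL := tconv_halfk_L2 lambda0 d0; have tL := tfi_neg_L2 lambda0 d0 fL.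
move=> /(wiener_integral_ae_inj M0 LL Ldist hL tL) htfi.
have gL := Lfun2_mulr (Gamma d)^-1 fL.
have gD := tconv_dom_L2 lambda0 gL; have hD := halfk_dom lambda0.
have diff0 : {ae mu, forall y, tconv d
    (fun s => -1 * ((Gamma d)^-1 * f s) + halfk lambda s) y = 0}.
  have a1 := tconv_comb_ae (-1) d0 gD hD.
  have a2 := tfi_neg_tconv_ae lambda0 d0 fL.
  have a3 : {ae mu, forall y, tconv d (halfk lambda) y - tconv d (fun x => (Gamma d)^-1 * f x) y = 0}.
    by apply: (lebesgue_aeS2 _ htfi a2) => y -> ->; rewrite subrr.
  by apply: (lebesgue_aeS2 _ a1 a3) => y -> e; rewrite mulN1r addrC.
have := tconv_inj lambda0 d0 (tconv_dom_comb (-1) gD hD) diff0.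
move=> h0; have : {ae mu, forall y, halfk lambda y = (Gamma d)^-1 * f y}.
  apply: (lebesgue_aeS _ h0) => y /eqP.
  by rewrite mulN1r addrC subr_eq0 => /eqP.
move=> /(@Lfun2_ae _ _ R mu _ _ (measurable_halfk lambda) gL).
exact/negP/halfk_notin_L2.
Qed.

Lemma tflp2_integral_inj f g : f \in Lfun mu 2%:E -> g \in Lfun mu 2%:E ->
  {ae P, forall w, tflp2_integral P L d lambda f w = tflp2_integral P L d lambda g w} ->
  {ae mu, forall x, f x = g x}.
Proof.
move=> fL gL; have tfL := tfi_neg_L2 lambda0 d0 fL; have tgL := tfi_neg_L2 lambda0 d0 gL.
move=> /(wiener_integral_ae_inj M0 LL Ldist tfL tgL) htfi.
have fD := tconv_dom_L2 lambda0 fL; have gD := tconv_dom_L2 lambda0 gL.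
have G0 : (Gamma d)^-1 != 0 by rewrite invr_eq0 gt_eqF// Gamma_gt0.
have diff0 : {ae mu, forall y, tconv d (fun s => -1 * g s + f s) y = 0}.
  have a1 := tconv_comb_ae (-1) d0 gD fD.
  apply: (lebesgue_aeS2 _ a1 htfi) => y ->; rewrite !tfi_negE => /(mulfI G0) ->.
  by rewrite mulN1r addNr.
have := tconv_inj lambda0 d0 (tconv_dom_comb (-1) gD fD) diff0.
by apply: lebesgue_aeS => y /eqP; rewrite mulN1r addrC subr_eq0 => /eqP.
Qed.

Lemma tflp2_integral_comb (a : R) f g : f \in Lfun mu 2%:E -> g \in Lfun mu 2%:E ->
  {ae P, forall w, tflp2_integral P L d lambda (fun x => a * f x + g x) w =
    a * tflp2_integral P L d lambda f w + tflp2_integral P L d lambda g w}.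
Proof.
move=> fL gL; have tfL := tfi_neg_L2 lambda0 d0 fL; have tgL := tfi_neg_L2 lambda0 d0 gL.
have tfgL := tfi_neg_L2 lambda0 d0 (Lfun2_comb a fL gL).
have a1 := wiener_integral_ae M0 LL Ldist tfgL (Lfun2_comb a tfL tgL)
  (tfi_neg_comb_ae lambda0 a d0 fL gL).
have a2 := wiener_integral_comb M0 LL Ldist a tfL tgL.
by apply: filterS2 a1 a2 => w; rewrite /tflp2_integral => -> ->.
Qed.

Lemma tflp2_integral_isometry f g : f \in Lfun mu 2%:E -> g \in Lfun mu 2%:E ->
  L2dot P (tflp2_integral P L d lambda f) (tflp2_integral P L d lambda g) =
  M * A1_dot d lambda f g.
Proof.
move=> fL gL; have tfL := tfi_neg_L2 lambda0 d0 fL; have tgL := tfi_neg_L2 lambda0 d0 gL.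
exact: (wiener_integral_dot M0 LL Ldist).
Qed.

End ClosedSpan.

(** The spaces consist of classes, represented here by functions: linearity, injectivity and
    non-membership are therefore stated up to null sets. The factor E[L(1)^2] is the normalisation
    of the Wiener integral. A nonzero nu excludes L = 0, for which the closed span has a single
    class. *)
Theorem theorem3p8 (R : realType) (disp : measure_display)
    (Omega : measurableType disp) (P : probability Omega R)
    (nu : {measure set R -> \bar R}) (L1 L2 L : R -> {RV P >-> R})
    (d lambda : R)
    (hnu : levy_measure nu)
    (hnu2 : (\int[nu]_(x in [set x : R | (1 < `|x|)%R]) (x ^+ 2)%:E < +oo)%E)
    (hnu_neq0 : nu [set: R] != 0%E)
    (hL1 : centered_pure_jump_levy nu L1)
    (hL2 : centered_pure_jump_levy nu L2)
    (hL12 : independent_processes P L1 L2)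
    (hL : {ae P, forall w, forall t : R, L t w = two_sided L1 L2 t w})
    (hd : 0 < d) (hlambda : 0 < lambda) :
  let I := tflp2_integral P L d lambda in
  let Sp := closed_span P (tflp2 P L d lambda) in
  [/\ forall (a : R) (f g : R -> R), A1 d lambda f -> A1 d lambda g ->
        {ae P, forall w, I (fun x => a * f x + g x) w = a * I f w + I g w},
      forall f g : R -> R, A1 d lambda f -> A1 d lambda g ->
        ('E_P[fun w => (I f w * I g w)%R] =
        'E_P[fun w => (L 1%R w ^+ 2)%R] * (A1_dot d lambda f g)%:E)%E,
      forall f g : R -> R, A1 d lambda f -> A1 d lambda g ->
        {ae P, forall w, I f w = I g w} ->
        {ae (@lebesgue_measure R), forall x, f x = g x},
      forall f : R -> R, A1 d lambda f -> Sp (I f) &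
      exists X : Omega -> R, Sp X /\
        forall f : R -> R, A1 d lambda f -> ~ {ae P, forall w, X w = I f w}].
Proof.
move=> I Sp; pose M := levy_var nu.
have M0 : 0 < M by exact: (levy_var_gt0 hnu hnu2 hnu_neq0).
have LL := two_sided_L2 hnu hnu2 hL1 hL2 hL.
have Ldist := two_sided_dist hnu hnu2 hL1 hL2 hL12 hL.
pose L' (t : R) : Omega -> R := L t.
have I_L2 f : f \in Lfun (@lebesgue_measure R) 2%:E -> I f \in Lfun P 2%:E.
  move=> fL; apply: (@wiener_integral_L2 _ _ _ P L' M M0 LL Ldist).
  exact: tfi_neg_L2.
split.
- move=> a f g [fL _] [gL _].
  exact: (@tflp2_integral_comb _ _ _ P L' M lambda d M0 LL Ldist hlambda hd a f g fL gL).
- move=> f g [fL _] [gL _].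
  have e1 : ('E_P[fun w => (I f w * I g w)%R] = (L2dot P (I f) (I g))%:E)%E.
    rewrite unlock /L2dot /Rintegral fineK//.
    exact: (integrable_fin_num measurableT (Lfun2_mul (I_L2 f fL) (I_L2 g gL))).
  have e2 : ('E_P[fun w => (L 1%R w ^+ 2)%R] = M%:E)%E.
    by rewrite unlock -(L2dotE (LL 1)) (two_sided_var hnu hnu2 hL1 hL2 hL).
  rewrite e1 e2 -EFinM; congr EFin.
  exact: (@tflp2_integral_isometry _ _ _ P L' M lambda d M0 LL Ldist hlambda hd f g fL gL).
- move=> f g [fL _] [gL _].
  exact: (@tflp2_integral_inj _ _ _ P L' M lambda d M0 LL Ldist hlambda hd f g fL gL).
- move=> f [fL _].
  exact: (@closed_span_tflp2_integral _ _ _ P L' M lambda d M0 LL Ldist hlambda hd f fL).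
- exists (wiener_integral P L' (tconv lambda d (halfk lambda))); split.
    exact: (@closed_span_halfk _ _ _ P L' M lambda d M0 LL Ldist hlambda hd).
  move=> f [fL _].
  exact: (@wiener_halfk_not_tflp2 _ _ _ P L' M lambda d M0 LL Ldist hlambda hd f fL).
Qed.
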